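(* Let $p,q$ be positive natural numbers, let $\Delta(x,y)\in\mathbb{C}\{x,y\}$, and let $\mathcal{F}_{\omega_{p,q,\Delta}}$ be the cuspidal foliation on $(\mathbb{C}^2,0)$ given by $$\omega_{p,q,\Delta}=d(y^p-x^q)+\Delta(x,y)(px\,dy-qy\,dx).$$ Suppose that $\mathcal{F}_{\omega_{p,q,\Delta}}$ is non-dicritical. Then the following statements are equivalent: (a) The foliation $\mathcal{F}_{\omega_{p,q,\Delta}}$ is of the second type. (b) The intersection number satisfies $(\Delta,y^p-x^q)_0\ge \mathrm{PH}_{(p,q)}-1$. (c) The foliation $\mathcal{F}_{\omega_{p,q,\Delta}}$ has the same reduction of singularities as the foliation $d(y^p-x^q)=0$.
   Context: $\mathrm{PH}_{(p,q)}=(p-1)(q-1)$ is the Poincaré–Hopf index of the foliation $d(y^p-x^q)$. For $f,g\in\mathbb{C}\{x,y\}$, $(f,g)_0=\dim_{\mathbb{C}}\mathbb{C}\{x,y\}/(f,g)$ is the intersection number (possibly $+\infty$). A singular foliation on $(\mathbb{C}^2,0)$ is given by $\omega=A\,dx+B\,dy$ with $A,B$ coprime elements of the maximal ideal of $\mathbb{C}\{x,y\}$. A separatrix is an irreducible curve $f=0$ (in general formal) that is invariant: $\omega\wedge df=f\cdot g\,dx\wedge dy$ for some power series $g$. The foliation is non-dicritical if it has finitely many separatrices. Reduction of singularities: the dual vector field of $\omega$ is $X=B\,\partial_x-A\,\partial_y$. A singular point is simple (reduced) if the linear part of the dual vector field there has eigenvalues $\lambda,\mu$, not both zero, such that either $\lambda\mu\neq0$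 and $\lambda/\mu\notin\mathbb{Q}^+$ (non-degenerate), or $\lambda\mu=0$ (saddle-node). A saddle-node has a strong separatrix, tangent to the eigenspace of the non-zero eigenvalue, and a (formal) weak separatrix, tangent to the eigenspace of the zero eigenvalue. The (minimal) reduction of singularities $\pi:(M,\mathcal{D})\to(\mathbb{C}^2,0)$ of the foliation is the composition of the minimal number of point blow-ups after which the strict transform of the foliation has only simple singularities and its separatrices are smooth, disjoint, transverse to the exceptional divisor $\mathcal{D}=\pi^{-1}(0)$ and do not pass through corners of $\mathcal{D}$. A saddle-node $P\in\mathcal{D}$ of the strict transform is tangent if $\mathcal{D}$ contains at $P$ the weak separatrix of $P$. The foliation is of the second type if its strict transform by $\pi$ has no tangent saddle-node. *)

(* Defs.v *)
From HB Require Import structures.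
From mathcomp Require Import all_boot all_order all_algebra complex.
From mathcomp Require Import boolp classical_sets reals constructive_ereal ereal.

Set Implicit Arguments.
Unset Strict Implicit.
Unset Printing Implicit Defensive.

Import Order.TTheory GRing.Theory Num.Theory.
Local Open Scope ring_scope.

Section Divisibility.
Variable S : comNzRingType.
Implicit Types a b c : S.

Definition divides a b := exists c, b = a * c.
Definition invertible a := exists b, a * b = 1.
Definition associated a b := exists2 u, invertible u & b = u * a.
Definition irreducible a :=
  [/\ a <> 0, ~ invertible a &
      forall b c, a = b * c -> invertible b \/ invertible c].
Definition coprime_elts a b :=
  forall c, divides c a -> divides c b -> invertible c.
Definition in_ideal2 a b c := exists u v, c = u * a + v * b.

End Divisibility.

Section FormalSeries.
Variable K : comNzRingType.

(* [f i j] is the coefficient of x^i y^j in [f]. *)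
Record fps := Fps { fcoef :> nat -> nat -> K }.

Implicit Types f g h : fps.

HB.instance Definition _ := gen_eqMixin fps.
HB.instance Definition _ := gen_choiceMixin fps.

Lemma fpsP f g : (forall i j, f i j = g i j) -> f = g.
Proof.
by case: f g => [f] [g] /= e; congr Fps; apply/funext => i; apply/funext => j.
Qed.

Definition fps0 := Fps (fun _ _ => 0).
Definition fps_opp f := Fps (fun i j => - f i j).
Definition fps_add f g := Fps (fun i j => f i j + g i j).
Definition fps1 := Fps (fun i j => ((i == 0%N) && (j == 0%N))%:R).
Definition fps_mul f g := Fps (fun i j =>
  \sum_(k < i.+1) \sum_(l < j.+1) f k l * g (i - k)%N (j - l)%N).
Definition fps_scale (a : K) f := Fps (fun i j => a * f i j).

Fact fps_addA : associative fps_add.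
Proof. by move=> f g h; apply: fpsP => i j /=; rewrite addrA. Qed.
Fact fps_addC : commutative fps_add.
Proof. by move=> f g; apply: fpsP => i j /=; rewrite addrC. Qed.
Fact fps_add0 : left_id fps0 fps_add.
Proof. by move=> f; apply: fpsP => i j /=; rewrite add0r. Qed.
Fact fps_addN : left_inverse fps0 fps_opp fps_add.
Proof. by move=> f; apply: fpsP => i j /=; rewrite addNr. Qed.

HB.instance Definition _ :=
  GRing.isZmodule.Build fps fps_addA fps_addC fps_add0 fps_addN.

(* The ring axioms are transferred from {poly {poly K}} by truncation. *)
Let agree n m (P : {poly {poly K}}) f :=
  forall k l, (k <= n)%N -> (l <= m)%N -> P`_k`_l = f k l.

Let trunc n m f : {poly {poly K}} :=
  \poly_(i < n.+1) \poly_(j < m.+1) f i j.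

Let agree_trunc n m f : agree n m (trunc n m f) f.
Proof. by move=> k l kn lm; rewrite coef_poly ltnS kn coef_poly ltnS lm. Qed.

Let agree_mul n m P Q f g :
  agree n m P f -> agree n m Q g -> agree n m (P * Q) (fps_mul f g).
Proof.
move=> Pf Qg i j le_in le_jm; rewrite coefM coef_sum /=.
apply: eq_bigr => k _; rewrite coefM; apply: eq_bigr => l _.
rewrite Pf ?Qg //; try exact: leq_trans (leq_subr _ _) _.
- by apply: leq_trans le_in; rewrite -ltnS.
- by apply: leq_trans le_jm; rewrite -ltnS.
Qed.

Let agree_add n m P Q f g :
  agree n m P f -> agree n m Q g -> agree n m (P + Q) (f + g).
Proof. by move=> Pf Qg i j ? ?; rewrite !coefD Pf ?Qg. Qed.

Let agree1 n m : agree n m 1 fps1.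
Proof. by move=> i j _ _; rewrite coef1; case: i => [|i]; rewrite ?coef1 ?coef0. Qed.

Let agree_eq f g (P : nat -> nat -> {poly {poly K}}) :
  (forall n m, agree n m (P n m) f) -> (forall n m, agree n m (P n m) g) ->
  f = g.
Proof. by move=> Pf Pg; apply: fpsP => i j; rewrite -(Pf i j) // (Pg i j). Qed.

Fact fps_mulA : associative fps_mul.
Proof.
move=> f g h.
apply: (@agree_eq _ _ (fun n m => trunc n m f * (trunc n m g * trunc n m h)))
  => n m; last rewrite mulrA.
all: by do ![apply: agree_mul | apply: agree_trunc].
Qed.

Fact fps_mulC : commutative fps_mul.
Proof.
move=> f g.
apply: (@agree_eq _ _ (fun n m => trunc n m f * trunc n m g))
  => n m; last rewrite mulrC.
all: by do ![apply: agree_mul | apply: agree_trunc].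
Qed.

Fact fps_mul1 : left_id fps1 fps_mul.
Proof.
move=> f; apply: (@agree_eq _ _ (fun n m => 1 * trunc n m f))
  => n m; last rewrite mul1r; last exact: agree_trunc.
by apply: agree_mul; [apply: agree1 | apply: agree_trunc].
Qed.

Fact fps_mulDl : left_distributive fps_mul fps_add.
Proof.
move=> f g h; apply: (@agree_eq _ _
  (fun n m => (trunc n m f + trunc n m g) * trunc n m h))
  => n m; last rewrite mulrDl.
all: by do ![apply: agree_mul | apply: agree_add | apply: agree_trunc].
Qed.

Fact fps_oner_neq0 : fps1 != 0.
Proof.
apply/eqP => /(congr1 (fun f : fps => f 0 0)%N) /= /eqP.
by rewrite oner_eq0.
Qed.

HB.instance Definition _ := GRing.Zmodule_isComNzRing.Build fps
  fps_mulA fps_mulC fps_mul1 fps_mulDl fps_oner_neq0.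

Fact fps_scaleA (a b : K) f :
  fps_scale a (fps_scale b f) = fps_scale (a * b) f.
Proof. by apply: fpsP => i j /=; rewrite mulrA. Qed.
Fact fps_scale1 : left_id 1 fps_scale.
Proof. by move=> f; apply: fpsP => i j /=; rewrite mul1r. Qed.
Fact fps_scaleDr : right_distributive fps_scale +%R.
Proof. by move=> a f g; apply: fpsP => i j /=; rewrite mulrDr. Qed.
Fact fps_scaleDl f : {morph fps_scale^~ f : a b / a + b}.
Proof. by move=> a b; apply: fpsP => i j /=; rewrite mulrDl. Qed.

HB.instance Definition _ := GRing.Zmodule_isLmodule.Build K fps
  fps_scaleA fps_scale1 fps_scaleDr fps_scaleDl.

Fact fps_scaleAl (a : K) f g : a *: (f * g) = (a *: f) * g.
Proof.
apply: fpsP => i j /=; rewrite mulr_sumr; apply: eq_bigr => k _.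
by rewrite mulr_sumr; apply: eq_bigr => l _; rewrite mulrA.
Qed.

HB.instance Definition _ := GRing.Lmodule_isLalgebra.Build K fps fps_scaleAl.

Definition fps_x : fps := Fps (fun i j => ((i == 1%N) && (j == 0%N))%:R).
Definition fps_y : fps := Fps (fun i j => ((i == 0%N) && (j == 1%N))%:R).

Definition fps_dx f : fps := Fps (fun i j => f i.+1 j *+ i.+1).
Definition fps_dy f : fps := Fps (fun i j => f i j.+1 *+ j.+1).

(* f(x, x (y + c)): since x^i (x (y + c))^j = x^(i + j) (y + c)^j, only the
   finitely many monomials with i + j = a contribute to x^a y^b. *)
Definition fps_subst_affine (c : K) f : fps := Fps (fun a b =>
  \sum_(j < a.+1) f (a - j)%N j * (c ^+ (j - b) *+ 'C(j, b))).

(* f(x y, y) *)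
Definition fps_subst_infty f : fps := Fps (fun a b =>
  if (a <= b)%N then f a (b - a)%N else 0).

End FormalSeries.

Section ConvergentSeries.
Variable K : numFieldType.
Implicit Types f g : fps K.

(* Absolute summability on a closed polydisc of radius r. *)
Definition summable_at (r : K) f := exists M : K, forall N,
  \sum_(i < N) \sum_(j < N) `|f i j| * r ^+ (i + j) <= M.

Definition convergent : {pred fps K} :=
  fun f => `[< exists2 r : K, 0 < r & summable_at r f >].

Let summable_le (r s : K) f :
  0 < r -> r <= s -> summable_at s f -> summable_at r f.
Proof.
move=> r0 rs [M HM]; exists M => N; apply: le_trans (HM N).
apply: ler_sum => i _; apply: ler_sum => j _; apply: ler_wpM2l => //.
by apply: lerXn2r; rewrite // nnegrE ltW // (lt_le_trans r0).
Qed.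

Let convergent2 f g : f \in convergent -> g \in convergent ->
  exists r : K, [/\ 0 < r, summable_at r f & summable_at r g].
Proof.
move=> /asboolP[r r0 fr] /asboolP[s s0 gs].
have /orP[rs|sr] := real_leVge (gtr0_real r0) (gtr0_real s0).
- by exists r; split=> //; apply: summable_le gs.
- by exists s; split=> //; apply: summable_le fr.
Qed.

Let convolution_le (u : nat -> nat -> K) N : (forall i j, 0 <= u i j) ->
  \sum_(i < N) \sum_(k < i.+1) u k (i - k)%N <=
  \sum_(k < N) \sum_(m < N) u k m.
Proof.
move=> u0.
have -> : \sum_(i < N) \sum_(k < i.+1) u k (i - k)%N =
    \sum_(k < N) \sum_(i < N | (k <= i)%N) u k (i - k)%N.
  rewrite [RHS](exchange_big_dep xpredT) //=; apply: eq_bigr => i _.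
  by rewrite (big_ord_widen _ (fun k => u k (i - k)%N) (ltn_ord i)).
apply: ler_sum => k _.
rewrite -(big_mkord (fun i => k <= i)%N (fun i => u k (i - k)%N)).
rewrite (big_cat_nat (n := k)) //=; last exact: ltnW.
rewrite big_nat_cond big1 ?add0r; last first.
  by move=> i /andP[/andP[_ ik] ki]; move: (leq_trans ik ki); rewrite ltnn.
rewrite -{1}(add0n (k : nat)) big_addn big_mkord.
rewrite (big_ord_widen_cond _ (fun i => k <= i + k)%N
  (fun i => u k (i + k - k)%N) (leq_subr k N)) big_mkcond.
by apply: ler_sum => i _; case: ifP => // _; rewrite addnK.
Qed.

Fact convergent_subalg : GRing.subalg_closed convergent.
Proof.
split.
- apply/asboolP; exists 1 => //; exists 1 => -[|N]; first by rewrite big_ord0.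
  rewrite big_ord_recl big_ord_recl /= normr1 expr1n mulr1.
  by rewrite !big1 ?addr0 // => i _; rewrite ?big1 // => *; rewrite normr0 mul0r.
- move=> a f g fc gc; have [r [r0 [M HM] [M' HM']]] := convergent2 fc gc.
  apply/asboolP; exists r => //; exists (`|a| * M + M') => N.
  apply: le_trans (lerD (ler_wpM2l (normr_ge0 a) (HM N)) (HM' N)).
  rewrite mulr_sumr -big_split; apply: ler_sum => i _ /=.
  rewrite mulr_sumr -big_split; apply: ler_sum => j _ /=.
  rewrite mulrA -mulrDl -normrM; apply: ler_wpM2r; first exact/exprn_ge0/ltW.
  exact: ler_normD.
- move=> f g fc gc; have [r [r0 [M HM] [M' HM']]] := convergent2 fc gc.
  apply/asboolP; exists r => //; exists (M * M') => N.
  have nn (h : fps K) i j : 0 <= `|h i j| * r ^+ (i + j).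
    by rewrite mulr_ge0 // exprn_ge0 // ltW.
  have nn2 (h : fps K) : 0 <= \sum_(i < N) \sum_(j < N) `|h i j| * r ^+ (i + j).
    by apply: sumr_ge0 => i _; apply: sumr_ge0.
  apply: le_trans (ler_pM (nn2 f) (nn2 g) (HM N) (HM' N)).
  pose u k m j l := (`|f k l| * r ^+ (k + l)) * (`|g m j| * r ^+ (m + j)).
  have u0 k m j l : 0 <= u k m j l by rewrite mulr_ge0.
  have -> : (\sum_(i < N) \sum_(j < N) `|f i j| * r ^+ (i + j)) *
      (\sum_(i < N) \sum_(j < N) `|g i j| * r ^+ (i + j)) =
      \sum_(k < N) \sum_(m < N) \sum_(l < N) \sum_(j < N) u k m j l.
    rewrite mulr_suml; apply: eq_bigr => k _; rewrite mulr_sumr.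
    apply: eq_bigr => m _; rewrite mulr_suml; apply: eq_bigr => l _.
    by rewrite mulr_sumr.
  have step1 : \sum_(i < N) \sum_(k < i.+1)
      \sum_(l < N) \sum_(j < N) u k (i - k)%N j l <=
      \sum_(k < N) \sum_(m < N) \sum_(l < N) \sum_(j < N) u k m j l.
    apply: (convolution_le
      (u := fun k m => \sum_(l < N) \sum_(j < N) u k m j l)) => i j.
    by apply: sumr_ge0 => *; apply: sumr_ge0.
  apply: le_trans step1; apply: ler_sum => i _.
  have step2 : \sum_(k < i.+1) \sum_(j < N) \sum_(l < j.+1)
      u k (i - k)%N (j - l)%N l <=
      \sum_(k < i.+1) \sum_(l < N) \sum_(j < N) u k (i - k)%N j l.
    apply: ler_sum => k _.
    exact: (convolution_le (u := fun l j => u k (i - k)%N j l)).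
  apply: le_trans step2; rewrite exchange_big /=; apply: ler_sum => j _.
  apply: le_trans (ler_wpM2r (exprn_ge0 _ (ltW r0)) (ler_norm_sum _ _ _)) _.
  rewrite mulr_suml; apply: ler_sum => k _.
  apply: le_trans (ler_wpM2r (exprn_ge0 _ (ltW r0)) (ler_norm_sum _ _ _)) _.
  rewrite mulr_suml; apply: ler_sum => l _; rewrite /u normrM.
  rewrite mulrACA -exprD le_eqVlt; apply/orP; left; apply/eqP.
  congr (_ * r ^+ _).
  have ki : (k <= i)%N by rewrite -ltnS.
  have lj : (l <= j)%N by rewrite -ltnS.
  by rewrite addnACA !subnKC.
Qed.

HB.instance Definition _ :=
  GRing.isSubalgClosed.Build K (fps K) convergent convergent_subalg.

Record cps := Cps { cps_val :> fps K; _ : cps_val \in convergent }.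

HB.instance Definition _ := [isSub for cps_val].
HB.instance Definition _ := [Choice of cps by <:].
HB.instance Definition _ := [SubChoice_isSubComNzRing of cps by <:].
HB.instance Definition _ := [SubZmodule_isSubLmodule of cps by <:].

Let convergent_finite f n :
  (forall i j, (n <= i)%N || (n <= j)%N -> f i j = 0) -> f \in convergent.
Proof.
move=> f0; apply/asboolP; exists 1 => //.
exists (\sum_(i < n) \sum_(j < n) `|f i j|) => N.
have e m : \sum_(i < m) \sum_(j < m) `|f i j| * 1 ^+ (i + j) =
    \sum_(i < m) \sum_(j < m) `|f i j|.
  by apply: eq_bigr => i _; apply: eq_bigr => j _; rewrite expr1n mulr1.
rewrite e.
have mono a b : (a <= b)%N -> \sum_(i < a) \sum_(j < a) `|f i j| <=
    \sum_(i < b) \sum_(j < b) `|f i j|.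
  move=> ab; rewrite (big_ord_widen _ (fun i => \sum_(j < a) `|f i j|) ab).
  rewrite big_mkcond; apply: ler_sum => i _; case: ifP => _; last first.
    exact: sumr_ge0.
  rewrite (big_ord_widen _ (fun j => `|f i j|) ab) big_mkcond.
  by apply: ler_sum => j _; case: ifP.
apply: le_trans (mono _ _ (leq_maxl N n)) _.
rewrite le_eqVlt; apply/orP; left; apply/eqP.
have nM := leq_maxr N n.
rewrite [RHS](big_ord_widen _ (fun i => \sum_(j < n) `|f i j|) nM).
rewrite [RHS]big_mkcond; apply: eq_bigr => i _; case: ltnP => ni; last first.
  by rewrite big1 // => j _; rewrite f0 ?ni // normr0.
rewrite (big_ord_widen _ (fun j => `|f i j|) nM) [RHS]big_mkcond.
by apply: eq_bigr => j _; case: ltnP => // nj; rewrite f0 ?nj ?orbT ?normr0.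
Qed.

Fact fps_x_convergent : fps_x K \in convergent.
Proof. by apply: (@convergent_finite _ 2) => -[|[|i]] [|[|j]]. Qed.
Fact fps_y_convergent : fps_y K \in convergent.
Proof. by apply: (@convergent_finite _ 2) => -[|[|i]] [|[|j]]. Qed.

Definition cps_x : cps := Cps fps_x_convergent.
Definition cps_y : cps := Cps fps_y_convergent.

End ConvergentSeries.

Section Foliations.
Variable K : numClosedFieldType.

Notation X := (fps_x K).
Notation Y := (fps_y K).

(* The pair (A, B) stands for the 1-form A dx + B dy. *)
Definition form : Type := (fps K * fps K)%type.

Implicit Types (w : form) (f g : fps K) (D : seq (fps K)).

(* A and B are not asked to vanish at the origin: a regular foliation is
   allowed, as happens for d(y^p - x^q) when p = 1 or q = 1. *)
Definition foliation_form w := exists A B : cps K,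
  w = (A : fps K, B : fps K) /\ coprime_elts A B.

(* w /\ df = f h dx /\ dy *)
Definition invariant_curve w f :=
  divides f (w.1 * fps_dy f - w.2 * fps_dx f).

Definition separatrix w f := irreducible f /\ invariant_curve w f.

(* A curve is a series up to a unit. *)
Definition non_dicritical w := exists s : seq (fps K),
  forall f, separatrix w f -> exists2 g, g \in s & associated g f.

Definition singular w := w.1 0%N 0%N = 0 /\ w.2 0%N 0%N = 0.

(* Jacobian matrix at the origin of the dual vector field B d/dx - A d/dy. *)
Definition linear_part w : 'M[K]_2 := \matrix_(i < 2, j < 2)
  let h := if i == 0 then w.2 else - w.1 in
  if j == 0 then h 1%N 0%N else h 0%N 1%N.

Definition eigenvalues w (l m : K) :=
  char_poly (linear_part w) = ('X - l%:P) * ('X - m%:P).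

Definition simple w := exists l m : K,
  [/\ eigenvalues w l m, ~ (l = 0 /\ m = 0) &
      (l * m <> 0 /\ ~ (exists2 r : rat, 0 < r & l / m = ratr r))
      \/ l * m = 0].

Definition saddle_node w := singular w /\ exists l m : K,
  [/\ eigenvalues w l m, ~ (l = 0 /\ m = 0) & l * m = 0].

Definition smooth f :=
  f 0%N 0%N = 0 /\ (f 1%N 0%N <> 0 \/ f 0%N 1%N <> 0).

Definition tangent_to f (v : 'cV[K]_2) :=
  f 1%N 0%N * v 0 0 + f 0%N 1%N * v 1 0 = 0.

Definition transverse f g :=
  f 1%N 0%N * g 0%N 1%N - f 0%N 1%N * g 1%N 0%N <> 0.

Definition weak_separatrix w f := [/\ separatrix w f, smooth f &
  exists v : 'cV[K]_2, [/\ v <> 0, linear_part w *m v = 0 & tangent_to f v]].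

(* The points infinitely near to the origin. A point of the exceptional curve
   of one blow-up is a direction: [Some c] is the line y = c x and [None] is
   the line x = 0; the blown-up surface has at that point the coordinates
   (x', y') with x = x', y = x' (y' + c), resp. x = x' y', y = y'.
   A point is the list of the successive directions leading to it. *)
Definition direction : Type := option K.
Definition near_point : Type := seq direction.

(* Quotient of w by the highest power of t dividing it. *)
Definition strip (t : fps K) w : form :=
  xget w (fun w' : form => exists k : nat,
    w = (t ^+ k * w'.1, t ^+ k * w'.2) /\
    ~ (divides t w'.1 /\ divides t w'.2))%classic.

Definition strict_transform (d : direction) w : form :=
  match d with
  | Some c => let A := fps_subst_affine c w.1 in
              let B := fps_subst_affine c w.2 in
              strip X (A + (Y + c *: 1) * B, X * B)
  | None => let A := fps_subst_infty w.1 in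
            let B := fps_subst_infty w.2 in
            strip Y (Y * A, X * A + B)
  end.

(* In these coordinates every component of the exceptional divisor is a
   coordinate axis; D lists the equations of those through the point. The new
   component is x = 0, resp. y = 0, and the strict transform of y = 0 (resp.
   x = 0) passes through the direction 0 (resp. infinity) only. *)
Definition divisor_transform (d : direction) D : seq (fps K) :=
  match d with
  | Some c => X :: (if (c == 0) && (Y \in D) then [:: Y] else [::])
  | None => Y :: (if X \in D then [:: X] else [::])
  end.

Definition germ_at w (P : near_point) : form * seq (fps K) :=
  foldl (fun s d => (strict_transform d s.1, divisor_transform d s.2))
    (w, [::]) P.

(* A composition of point blow-ups is given by its set of centres. *)
Definition centres (T : seq near_point) :=
  uniq T /\ forall s d, rcons s d \in T -> s \in T.

(* The points over the origin of the surface obtained by blowing up T. *)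
Definition in_fibre (T : seq near_point) (P : near_point) :=
  P \notin T /\ forall s d, P = rcons s d -> s \in T.

(* The separatrices that are not components of the exceptional divisor. *)
Definition proper_separatrix w D f :=
  separatrix w f /\ ~ (exists2 E, E \in D & associated E f).

Definition resolved (s : form * seq (fps K)) := let: (w, D) := s in
  [/\ singular w -> simple w,
      forall f, proper_separatrix w D f ->
        [/\ smooth f, forall E, E \in D -> transverse f E & (size D <= 1)%N] &
      forall f g, proper_separatrix w D f -> proper_separatrix w D g ->
        associated f g].

Definition resolution w (T : seq near_point) :=
  centres T /\ forall P, in_fibre T P -> resolved (germ_at w P).

Definition minimal_reduction w (T : seq near_point) :=
  resolution w T /\ forall T', resolution w T' -> (size T <= size T')%N.

Definition tangent_saddle_node (s : form * seq (fps K)) :=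
  saddle_node s.1 /\ exists2 E, E \in s.2 & weak_separatrix s.1 E.

(* The minimal reduction, when it exists, is unique as a set of centres. *)
Definition second_type w := exists2 T, minimal_reduction w T &
  forall P, in_fibre T P -> ~ tangent_saddle_node (germ_at w P).

Definition same_reduction w w' :=
  exists2 T, minimal_reduction w T & minimal_reduction w' T.

Definition cusp (p q : nat) : cps K := cps_y K ^+ p - cps_x K ^+ q.

Definition d_form f : form := (fps_dx f, fps_dy f).

(* d(y^p - x^q) + Delta (p x dy - q y dx) *)
Definition cuspidal_form (p q : nat) (Delta : cps K) : form :=
  let df := d_form (cusp p q) in
  (df.1 - (Delta : fps K) * (q%:R * Y), df.2 + (Delta : fps K) * (p%:R * X)).

End Foliations.

Definition PH (p q : nat) : nat := ((p - 1) * (q - 1))%N.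

(* dim_C C{x,y}/(f,g), as the supremum of the sizes of the families of
   C{x,y} that are linearly independent modulo (f,g). *)
Definition intersection_number (R : realType) (f g : cps R[i]) : \bar R :=
  ereal_sup (fun d => exists n : nat, d = (n%:R)%:E /\
    exists h : 'I_n -> cps R[i], forall a : 'I_n -> R[i],
      in_ideal2 f g (\sum_(k < n) a k *: h k) -> forall k, a k = 0)%classic.

(* Main.v *)
From HB Require Import structures.
Require Import Defs.
From mathcomp Require Import all_boot all_order all_algebra complex.
From mathcomp Require Import boolp reals constructive_ereal ereal.
From mathcomp Require Import zify ring.

(** Give [x^i y^j] the weight [p i + q j].  The dual vector field is the sum of
    the Hamiltonian field of [y^p - x^q], quasi-homogeneous of degree
    [p q - p - q], and of [Delta] times the Euler field
    [p x d/dx + q y d/dy].  Non-dicriticity constrains [Delta] so much that each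
    of the three statements follows from it.

    If [Delta] had a monomial of weight less than [p q - p - q], the Euler field
    would dominate and the last divisor of the reduction of [y^p = x^q] would be
    transverse to the foliation, which has then infinitely many separatrices
    (lemma low_weight_dicritical).  Otherwise [Delta] only matters on the last
    divisor: at the strict transform of a branch, the ratio of the eigenvalues
    is a negative rational multiple of [1 + h_0], with [h_0] the value of the
    part of weight [p q] of [x y Delta].  If [1 + h_0] were a negative rational
    number this point would be a node with two transverse leaves, hence
    linearizable, with again infinitely many separatrices (lemma
    resonant_dicritical).  Both families of leaves are obtained as formal
    solutions [x = t^(n p), y = t^(n q) e(t)] of a regular differential
    equation.  The series that vanish on such a curve are the multiples of an
    irreducible one (lemma principal_kernel, by the Cayley-Hamilton theorem and
    Weierstrass division), which is a separatrix; finitely many separatrices do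
    not suffice as the curves are roots of monic polynomials (lemma
    integral_family_dicritical).

    Hence [Delta] has weight at least [p q - p - q] and [1 + h_0] avoids the
    negative rational numbers (lemma non_dicritical_heavy).  A count of
    monomials modulo [y^p - x^q] turns the first property into the bound on the
    intersection number (lemma independent_mod).  For the reduction, the
    transforms of the form along the Euclidean algorithm for [p] and [q] are
    explicit logarithmic forms (euclid_form) for which every infinitely near
    point of [y^p = x^q] before the last blow-up has to be blown up (lemma
    euclid_not_resolved), while all other points are regular, corners with
    eigenvalues of negative ratio, or strict transforms of branches with an
    eigenvalue along the divisor that is not zero (lemma euclid_reduction).  The
    centres do not depend on [Delta], and no saddle-node is tangent. *)

Set Implicit Arguments.
Unset Strict Implicit.
Unset Printing Implicit Defensive.

Import Order.TTheory GRing.Theory Num.Theory.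
Local Open Scope ring_scope.

(** * Coefficients, derivations and congruences of double power series *)

Section Coefficients.
Variable K : comNzRingType.
Implicit Types f g h : fps K.

Local Notation X := (fps_x K).
Local Notation Y := (fps_y K).

Lemma fcoef_Fps (F : nat -> nat -> K) i j : (Fps F) i j = F i j.
Proof. by []. Qed.
Lemma fcoef0 i j : (0 : fps K) i j = 0. Proof. by []. Qed.
Lemma fcoef1 i j : (1 : fps K) i j = ((i == 0%N) && (j == 0%N))%:R.
Proof. by []. Qed.
Lemma fcoefD f g i j : (f + g) i j = f i j + g i j. Proof. by []. Qed.
Lemma fcoefN f i j : (- f) i j = - f i j. Proof. by []. Qed.
Lemma fcoefB f g i j : (f - g) i j = f i j - g i j. Proof. by []. Qed.
Lemma fcoefZ c f i j : (c *: f) i j = c * f i j. Proof. by []. Qed.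
Lemma fcoefM f g i j :
  (f * g) i j =
  \sum_(k < i.+1) \sum_(l < j.+1) f k l * g (i - k)%N (j - l)%N.
Proof. by []. Qed.

Lemma fcoef_sum (I : Type) (r : seq I) (P : pred I) (F : I -> fps K) i j :
  (\sum_(k <- r | P k) F k) i j = \sum_(k <- r | P k) F k i j.
Proof. by elim/big_rec2: _ => [|k u v _ <-]. Qed.

Lemma fcoef00M f g : (f * g) 0%N 0%N = f 0%N 0%N * g 0%N 0%N.
Proof. by rewrite fcoefM !big_ord1. Qed.

Lemma fcoef00X f n : (f ^+ n) 0%N 0%N = f 0%N 0%N ^+ n.
Proof.
by elim: n => [|n IH]; rewrite ?expr0 ?fcoef1 // !exprS fcoef00M IH.
Qed.

Lemma fcoefXM f i j : (X * f) i j = if i is i'.+1 then f i' j else 0.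
Proof.
rewrite fcoefM; case: i => [|i].
  by rewrite big_ord1 big1 // => l _; rewrite mul0r.
rewrite big_ord_recl big1 ?add0r => [|l _]; last by rewrite mul0r.
rewrite big_ord_recl [X in _ + X]big1 ?addr0; last first.
  by move=> k _; rewrite big1 // => l _; rewrite mul0r.
rewrite big_ord_recl big1 ?addr0 => [|l _]; last by rewrite mul0r.
by rewrite mul1r /= subn1 subn0.
Qed.

Lemma fcoefYM f i j : (Y * f) i j = if j is j'.+1 then f i j' else 0.
Proof.
rewrite fcoefM big_ord_recl [X in _ + X]big1 ?addr0; last first.
  by move=> k _; rewrite big1 // => l _; rewrite mul0r.
case: j => [|j]; first by rewrite big_ord1 mul0r.
rewrite !big_ord_recl /= mul0r add0r mul1r subn1 subn0 big1 ?addr0 //.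
by move=> l _; rewrite mul0r.
Qed.

Lemma fcoefXnM n f i j :
  (X ^+ n * f) i j = if (n <= i)%N then f (i - n)%N j else 0.
Proof.
elim: n i => [|n IH] i; first by rewrite expr0 mul1r subn0.
by rewrite exprS -mulrA fcoefXM; case: i => [|i] //; rewrite IH ltnS subSS.
Qed.

Lemma fcoefYnM n f i j :
  (Y ^+ n * f) i j = if (n <= j)%N then f i (j - n)%N else 0.
Proof.
elim: n j => [|n IH] j; first by rewrite expr0 mul1r subn0.
by rewrite exprS -mulrA fcoefYM; case: j => [|j] //; rewrite IH ltnS subSS.
Qed.

Lemma fcoefXn n i j : (X ^+ n) i j = ((i == n) && (j == 0%N))%:R.
Proof.
rewrite -[X ^+ n]mulr1 fcoefXnM fcoef1; case: leqP => [h|h].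
  by rewrite subn_eq0 [(i == n)]eqn_leq h andbT.
by rewrite (ltn_eqF h).
Qed.

Lemma fcoefXnYn n m i j :
  (X ^+ n * Y ^+ m) i j = ((i == n) && (j == m))%:R.
Proof.
rewrite mulrC fcoefYnM fcoefXn; case: leqP => [h|h].
  by rewrite subn_eq0 [(j == m)]eqn_leq h andbT.
by rewrite (ltn_eqF h) andbF.
Qed.

Lemma fcoefYn m i j : (Y ^+ m) i j = ((i == 0%N) && (j == m))%:R.
Proof. by rewrite -[Y ^+ m]mul1r -(expr0 X) fcoefXnYn. Qed.

Lemma fcoefA c i j : (c%:A : fps K) i j = c * ((i == 0%N) && (j == 0%N))%:R.
Proof. by []. Qed.

Lemma fcoefAM c f i j : (c%:A * f) i j = c * f i j.
Proof. by rewrite -scalerAl mul1r. Qed.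

Lemma scaleE c f : c *: f = c%:A * f.
Proof. by rewrite -scalerAl mul1r. Qed.

Lemma algM (a b : K) : (a * b)%:A = a%:A * b%:A :> fps K.
Proof. by rewrite -scalerAl mul1r scalerA. Qed.

Lemma algXn (a : K) n : (a ^+ n)%:A = a%:A ^+ n :> fps K.
Proof.
elim: n => [|n IH]; first by rewrite !expr0 scale1r.
by rewrite !exprS algM IH.
Qed.

Lemma mulXI f g : X * f = X * g -> f = g.
Proof.
move=> e; apply: fpsP => i j.
by have := congr1 (fun h : fps K => h i.+1 j) e; rewrite !fcoefXM.
Qed.

Lemma mulYI f g : Y * f = Y * g -> f = g.
Proof.
move=> e; apply: fpsP => i j.
by have := congr1 (fun h : fps K => h i j.+1) e; rewrite !fcoefYM.
Qed.

Definition shiftx n f : fps K := Fps (fun i j => f (i + n)%N j).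
Definition shifty n f : fps K := Fps (fun i j => f i (j + n)%N).

Lemma fcoef_shiftx n f i j : shiftx n f i j = f (i + n)%N j. Proof. by []. Qed.
Lemma fcoef_shifty n f i j : shifty n f i j = f i (j + n)%N. Proof. by []. Qed.

Lemma shiftxE n f : (forall i j, (i < n)%N -> f i j = 0) ->
  f = X ^+ n * shiftx n f.
Proof.
move=> H; apply: fpsP => i j; rewrite fcoefXnM /=.
by case: leqP => h; rewrite ?subnK // H.
Qed.

Lemma shiftyE n f : (forall i j, (j < n)%N -> f i j = 0) ->
  f = Y ^+ n * shifty n f.
Proof.
move=> H; apply: fpsP => i j; rewrite fcoefYnM /=.
by case: leqP => h; rewrite ?subnK // H.
Qed.

Lemma divX f : divides X f <-> forall j, f 0%N j = 0.
Proof.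
split=> [[c -> j]|H]; first by rewrite fcoefXM.
exists (shiftx 1 f); apply: (@shiftxE 1) => -[|i] j // _; exact: H.
Qed.

Lemma divY f : divides Y f <-> forall i, f i 0%N = 0.
Proof.
split=> [[c -> j]|H]; first by rewrite fcoefYM.
exists (shifty 1 f); apply: (@shiftyE 1) => i [|j] // _; exact: H.
Qed.

Lemma fps_split f :
  exists f1 f2, f = (f 0%N 0%N)%:A + X * f1 + Y * f2.
Proof.
exists (shiftx 1 f), (Fps (fun i j => if i is 0 then f 0%N j.+1 else 0)).
apply: fpsP => i j; rewrite !fcoefD fcoefA fcoefXM fcoefYM /=.
case: i j => [|i] [|j] /=; rewrite ?mulr1 ?mulr0 ?addr0 ?add0r ?addn1 //.
Qed.

Definition vanish_below N f := forall i j, (i + j < N)%N -> f i j = 0.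

Lemma vanish_belowM N f g :
  f 0%N 0%N = 0 -> vanish_below N g -> vanish_below N.+1 (f * g).
Proof.
move=> f0 gN i j lt_ij; rewrite fcoefM big1 // => k _; rewrite big1 // => l _.
have ki : (k <= i)%N by rewrite -ltnS.
have lj : (l <= j)%N by rewrite -ltnS.
have [/eqP|kl] := eqVneq (k + l)%N 0%N.
  by rewrite addn_eq0 => /andP[/eqP-> /eqP->]; rewrite f0 mul0r.
rewrite gN ?mulr0 //; lia.
Qed.

Lemma vanish_belowD N f g :
  vanish_below N f -> vanish_below N g -> vanish_below N (f + g).
Proof. by move=> fN gN i j h; rewrite fcoefD fN // gN // addr0. Qed.

(** Series split as a constant plus multiples of [x] and [y]; iterating the
    splitting puts the values of such a map in every power of the maximal
    ideal. *)
Lemma additive_eq0 (L : fps K -> fps K) (P Q : fps K) :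
  {morph L : f g / f + g} -> (forall c, L c%:A = 0) ->
  P 0%N 0%N = 0 -> Q 0%N 0%N = 0 ->
  (forall f, L (X * f) = P * L f) -> (forall f, L (Y * f) = Q * L f) ->
  forall f, L f = 0.
Proof.
move=> LD Lc P0 Q0 LX LY f.
suff H N : forall g, vanish_below N (L g).
  by apply: fpsP => i j; apply: (H (i + j).+1).
elim: N => [|N IH] g; first by [].
have [g1 [g2 ->]] := fps_split g.
rewrite !LD Lc add0r LX LY.
by apply: vanish_belowD; apply: vanish_belowM.
Qed.

Lemma additive_ext (L M : fps K -> fps K) (P Q : fps K) :
  {morph L : f g / f + g} -> {morph M : f g / f + g} ->
  (forall c, L c%:A = M c%:A) ->
  P 0%N 0%N = 0 -> Q 0%N 0%N = 0 ->
  (forall f, L (X * f) = P * L f) -> (forall f, L (Y * f) = Q * L f) ->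
  (forall f, M (X * f) = P * M f) -> (forall f, M (Y * f) = Q * M f) ->
  forall f, L f = M f.
Proof.
move=> LD MD LM P0 Q0 LX LY MX MY f; apply/eqP; rewrite -subr_eq0; apply/eqP.
apply: (@additive_eq0 (fun f => L f - M f) P Q) => //.
- by move=> g h; rewrite LD MD; ring.
- by move=> c; rewrite LM subrr.
- by move=> g; rewrite LX MX mulrBr.
- by move=> g; rewrite LY MY mulrBr.
Qed.

Lemma dxD f g : fps_dx (f + g) = fps_dx f + fps_dx g.
Proof. by apply: fpsP => i j; rewrite /= mulrnDl. Qed.
Lemma dyD f g : fps_dy (f + g) = fps_dy f + fps_dy g.
Proof. by apply: fpsP => i j; rewrite /= mulrnDl. Qed.
Lemma dxN f : fps_dx (- f) = - fps_dx f.
Proof. by apply: fpsP => i j; rewrite /= mulNrn. Qed.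
Lemma dyN f : fps_dy (- f) = - fps_dy f.
Proof. by apply: fpsP => i j; rewrite /= mulNrn. Qed.
Lemma dxA c : fps_dx (c%:A : fps K) = 0.
Proof. by apply: fpsP => i j; rewrite /= mulr0 mul0rn. Qed.
Lemma dyA c : fps_dy (c%:A : fps K) = 0.
Proof. by apply: fpsP => i j; rewrite /= andbF mulr0 mul0rn. Qed.

Lemma fcoef_dx f i j : (fps_dx f) i j = f i.+1 j *+ i.+1. Proof. by []. Qed.
Lemma fcoef_dy f i j : (fps_dy f) i j = f i j.+1 *+ j.+1. Proof. by []. Qed.

Lemma dxXM f : fps_dx (X * f) = f + X * fps_dx f.
Proof.
by apply: fpsP => -[|i] j; rewrite fcoefD fcoef_dx !fcoefXM ?fcoef_dx ?addr0 // mulrS.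
Qed.
Lemma dxYM f : fps_dx (Y * f) = Y * fps_dx f.
Proof.
by apply: fpsP => i [|j]; rewrite fcoef_dx !fcoefYM ?fcoef_dx ?mul0rn.
Qed.
Lemma dyXM f : fps_dy (X * f) = X * fps_dy f.
Proof.
by apply: fpsP => -[|i] j; rewrite fcoef_dy !fcoefXM ?fcoef_dy ?mul0rn.
Qed.
Lemma dyYM f : fps_dy (Y * f) = f + Y * fps_dy f.
Proof.
by apply: fpsP => i [|j]; rewrite fcoefD fcoef_dy !fcoefYM ?fcoef_dy ?addr0 // mulrS.
Qed.

Lemma dxM f g : fps_dx (f * g) = fps_dx f * g + f * fps_dx g.
Proof.
apply/eqP; rewrite -subr_eq0; apply/eqP.
apply: (@additive_eq0 (fun f => fps_dx (f * g) -
  (fps_dx f * g + f * fps_dx g)) X Y) => // [u v|c|u|u].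
- by rewrite mulrDl !dxD; ring.
- rewrite dxA mul0r add0r; apply: fpsP => i j.
  by rewrite fcoefB fcoef_dx !fcoefAM fcoef_dx -mulrnAr subrr.
- by rewrite -mulrA !dxXM; ring.
- by rewrite -mulrA !dxYM; ring.
Qed.

Lemma dyM f g : fps_dy (f * g) = fps_dy f * g + f * fps_dy g.
Proof.
apply/eqP; rewrite -subr_eq0; apply/eqP.
apply: (@additive_eq0 (fun f => fps_dy (f * g) -
  (fps_dy f * g + f * fps_dy g)) X Y) => // [u v|c|u|u].
- by rewrite mulrDl !dyD; ring.
- rewrite dyA mul0r add0r; apply: fpsP => i j.
  by rewrite fcoefB fcoef_dy !fcoefAM fcoef_dy -mulrnAr subrr.
- by rewrite -mulrA !dyXM; ring.
- by rewrite -mulrA !dyYM; ring.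
Qed.

Lemma dx_exp f n : fps_dx (f ^+ n) = n%:R * f ^+ n.-1 * fps_dx f.
Proof.
elim: n => [|n IH].
  by rewrite expr0 mul0r mul0r -[1](scale1r 1) dxA.
rewrite exprS dxM IH /=; case: n IH => [|n] IH; first by rewrite expr0; ring.
by rewrite exprS -[n.+2%:R]natr1; ring.
Qed.

Lemma dy_exp f n : fps_dy (f ^+ n) = n%:R * f ^+ n.-1 * fps_dy f.
Proof.
elim: n => [|n IH].
  by rewrite expr0 mul0r mul0r -[1](scale1r 1) dyA.
rewrite exprS dyM IH /=; case: n IH => [|n] IH; first by rewrite expr0; ring.
by rewrite exprS -[n.+2%:R]natr1; ring.
Qed.

Lemma dxX : fps_dx X = 1.
Proof. by apply: fpsP => -[|i] [|j] //=; rewrite ?mul0rn. Qed.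
Lemma dxY : fps_dx Y = 0.
Proof. by apply: fpsP => i j /=; rewrite mul0rn. Qed.
Lemma dyX : fps_dy X = 0.
Proof. by apply: fpsP => i j /=; rewrite andbF mul0rn. Qed.
Lemma dyY : fps_dy Y = 1.
Proof. by apply: fpsP => -[|i] [|j] //=; rewrite ?mul0rn. Qed.

Lemma fps_natrE n : (n%:R : fps K) = (n%:R)%:A.
Proof. by rewrite scaler_nat. Qed.

Lemma fcoef_natM n f i j : (n%:R * f) i j = n%:R * f i j.
Proof. by rewrite fps_natrE fcoefAM. Qed.

(** Solving [F f = f] coefficient by coefficient, along the weight [mu]. *)
Lemma contraction_fixpoint (mu : nat -> nat -> nat) (F : fps K -> fps K) :
  (forall k f g, (forall i j, (mu i j < k)%N -> f i j = g i j) ->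
     forall i j, (mu i j < k.+1)%N -> F f i j = F g i j) ->
  exists f, F f = f.
Proof.
move=> FC.
have agree k n : (k <= n)%N ->
    forall i j, (mu i j < k)%N -> iter k F 0 i j = iter n F 0 i j.
  elim: k n => [|k IH] [|n] //= kn; apply: FC; exact: IH.
exists (Fps (fun i j => iter (mu i j).+1 F 0 i j)).
apply: fpsP => i j /=.
apply: (FC (mu i j)) => // i' j' lt_mu /=.
exact: (agree (mu i' j').+1).
Qed.

Definition congx N f g := forall i j, (i < N)%N -> f i j = g i j.

Lemma congx_refl N f : congx N f f. Proof. by []. Qed.
Lemma congx_sym N f g : congx N f g -> congx N g f.
Proof. by move=> H i j h; rewrite H. Qed.
Lemma congx_trans N f g h : congx N f g -> congx N g h -> congx N f h.
Proof. by move=> H H' i j h0; rewrite H // H'. Qed.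
Lemma congxW N M f g : (M <= N)%N -> congx N f g -> congx M f g.
Proof. by move=> h H i j hi; apply: H; apply: leq_trans hi h. Qed.
Lemma congxD N f g f' g' :
  congx N f f' -> congx N g g' -> congx N (f + g) (f' + g').
Proof. by move=> H H' i j h; rewrite !fcoefD H // H'. Qed.
Lemma congxN N f g : congx N f g -> congx N (- f) (- g).
Proof. by move=> H i j h; rewrite !fcoefN H. Qed.
Lemma congxB N f g f' g' :
  congx N f f' -> congx N g g' -> congx N (f - g) (f' - g').
Proof. by move=> H H'; apply: congxD => //; apply: congxN. Qed.
Lemma congxM N f g f' g' :
  congx N f f' -> congx N g g' -> congx N (f * g) (f' * g').
Proof.
move=> H H' i j h; rewrite !fcoefM; apply: eq_bigr => k _; apply: eq_bigr => l _.
by rewrite H ?H' //; [apply: leq_ltn_trans (leq_subr _ _) h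
  | apply: leq_ltn_trans h; rewrite -ltnS].
Qed.
Lemma congxX N n f g : congx N f g -> congx N (f ^+ n) (g ^+ n).
Proof.
by move=> H; elim: n => [|n IH]; rewrite ?expr0 // !exprS; apply: congxM.
Qed.
Lemma congxZ N c f g : congx N f g -> congx N (c *: f) (c *: g).
Proof. by move=> H i j h; rewrite !fcoefZ H. Qed.
Lemma congxXM N n f g : congx N f g -> congx (n + N) (X ^+ n * f) (X ^+ n * g).
Proof.
by move=> H i j h; rewrite !fcoefXnM; case: leqP => // h0; apply: H; rewrite ltn_subLR.
Qed.
Lemma congx0M N M f g : congx N f 0 -> congx M g 0 -> congx (N + M) (f * g) 0.
Proof.
move=> H H' i j h; rewrite fcoefM big1 // => k _; rewrite big1 // => l _.
case: (ltnP k N) => hk; first by rewrite H // mul0r.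
rewrite H' ?mulr0 //; move: (ltn_ord k) hk h; lia.
Qed.
Lemma congx0X f n : congx 1 f 0 -> congx n (f ^+ n) 0.
Proof.
move=> H; elim: n => [|n IH]; first by [].
by rewrite exprS -add1n; apply: congx0M.
Qed.
Lemma congx_sum N (I : Type) (r : seq I) (P : pred I) (F G : I -> fps K) :
  (forall i, P i -> congx N (F i) (G i)) ->
  congx N (\sum_(i <- r | P i) F i) (\sum_(i <- r | P i) G i).
Proof.
by move=> H i j h; rewrite !fcoef_sum; apply: eq_bigr => k Pk; apply: H.
Qed.
Lemma congx_eq f g : (forall N, congx N f g) -> f = g.
Proof. by move=> H; apply: fpsP => i j; apply: (H i.+1). Qed.

End Coefficients.

(** * Power series over a field form a domain; Weierstrass division *)

Section Domain.
Variable K : fieldType.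
Implicit Types f g h : fps K.

Local Notation X := (fps_x K).
Local Notation Y := (fps_y K).

Lemma invertible_coef00 f : invertible f -> f 0%N 0%N != 0.
Proof.
move=> [g /(congr1 (fun h : fps K => h 0 0)%N)].
rewrite fcoef00M fcoef1 /= => e; apply/eqP => f0.
by move/eqP: e; rewrite f0 mul0r eq_sym oner_eq0.
Qed.

Lemma coef00_invertible f : f 0%N 0%N != 0 -> invertible f.
Proof.
move=> f0; set c := f 0%N 0%N in f0.
pose F g := c^-1 *: (1 - (f - c%:A) * g).
have [|g Fg] := @contraction_fixpoint K addn F.
  move=> k g h H i j lt_ij; rewrite /F !fcoefZ !fcoefB; congr (_ * (_ - _)).
  apply/eqP; rewrite -subr_eq0 -fcoefB -mulrBr; apply/eqP.
  apply: (@vanish_belowM _ k) => //.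
    by rewrite fcoefB fcoefA /= mulr1 subrr.
  by move=> i' j' h'; rewrite fcoefB H // subrr.
exists g; rewrite -[f](subrK c%:A) mulrDl -[X in _ + _ * X]Fg /F.
by rewrite -scaleE scalerA mulfV // scale1r; ring.
Qed.

Definition fps_unit : {pred fps K} := fun f => f 0%N 0%N != 0.
Definition fps_inv f : fps K :=
  if pselect (exists g, g * f = 1) is left e then projT1 (cid e) else f.

Fact fps_mulVx : {in fps_unit, left_inverse 1 fps_inv *%R}.
Proof.
move=> f uf; rewrite /fps_inv; case: pselect => [e|[]].
  by case: (cid e).
by have [g e] := coef00_invertible uf; exists g; rewrite mulrC.
Qed.

Fact fps_unitPl f g : g * f = 1 -> fps_unit f.
Proof. by move=> e; apply: invertible_coef00; exists g; rewrite mulrC. Qed.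

Fact fps_inv_out : {in [predC fps_unit], fps_inv =1 id}.
Proof.
move=> f /negP nuf; rewrite /fps_inv; case: pselect => // e; case: nuf.
by case: e => g /fps_unitPl.
Qed.

HB.instance Definition _ := GRing.ComNzRing_hasMulInverse.Build (fps K)
  fps_mulVx fps_unitPl fps_inv_out.

Lemma fps_unitE f : (f \is a GRing.unit) = (f 0%N 0%N != 0).
Proof. by []. Qed.

Lemma coef_lowest f : f <> 0 -> exists i j, [/\ f i j != 0,
  forall i' j', (i' < i)%N -> f i' j' = 0 &
  forall j', (j' < j)%N -> f i j' = 0].
Proof.
move=> f0.
have ex : exists i, `[< exists j, f i j != 0 >].
  apply: contrapT => nex; apply: f0; apply: fpsP => i j.
  apply/eqP; apply: contrapT => /negP fij; apply: nex; exists i.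
  by apply/asboolP; exists j.
case: (ex_minnP ex) => i /asboolP exj imin.
case: (ex_minnP exj) => j fij jmin.
exists i, j; split=> // [i' j' lt_i|j' lt_j]; apply/eqP.
  apply: contraTT lt_i => fij'; rewrite -leqNgt imin //.
  by apply/asboolP; exists j'.
by apply: contraTT lt_j => fij'; rewrite -leqNgt jmin.
Qed.

Fact fps_integral : GRing.integral_domain_axiom (fps K).
Proof.
move=> f g fg0; apply: contrapT => /negP; rewrite negb_or => /andP[/eqP f0 /eqP g0].
have [i [j [fij fi fj]]] := coef_lowest f0.
have [k [l [gkl gk gl]]] := coef_lowest g0.
move: (congr1 (fun h : fps K => h (i + k)%N (j + l)%N) fg0).
have ltik : (i < (i + k).+1)%N by rewrite ltnS leq_addr.
have ltjl : (j < (j + l).+1)%N by rewrite ltnS leq_addr.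
rewrite fcoefM (bigD1 (Ordinal ltik)) //= [X in _ + X]big1 => [|a]; last first.
  rewrite -val_eqE /= => ai; rewrite big1 // => b _.
  case: (ltnP a i) => h; first by rewrite fi // mul0r.
  rewrite gk ?mulr0 //; move: (ltn_ord a) ai h; lia.
rewrite (bigD1 (Ordinal ltjl)) //= [X in _ + X + _]big1 => [|b]; last first.
  rewrite -val_eqE /= => bj.
  case: (ltnP b j) => h; first by rewrite fj // mul0r.
  rewrite [g _ _](_ : _ = 0) ?mulr0 // addKn gl //.
  move: (ltn_ord b) bj h; lia.
rewrite !addKn !addr0 => /eqP.
by rewrite mulf_eq0 (negPf fij) (negPf gkl).
Qed.

HB.instance Definition _ :=
  GRing.ComUnitRing_isIntegral.Build (fps K) fps_integral.

Lemma fps_x_neq0 : X != 0.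
Proof.
apply/eqP => /(congr1 (fun h : fps K => h 1 0)%N) /eqP.
by rewrite fcoef0 /= oner_eq0.
Qed.

Lemma fps_y_neq0 : Y != 0.
Proof.
apply/eqP => /(congr1 (fun h : fps K => h 0 1)%N) /eqP.
by rewrite fcoef0 /= oner_eq0.
Qed.

Lemma invertibleE f : invertible f <-> f 0%N 0%N != 0.
Proof. by split; [apply: invertible_coef00 | apply: coef00_invertible]. Qed.

Lemma alg_neq0 (c : K) : c != 0 -> (c%:A : fps K) != 0.
Proof.
move=> c0; apply/eqP => /(congr1 (fun h : fps K => h 0 0)%N) /eqP.
by rewrite fcoef0 fcoefA /= mulr1 (negPf c0).
Qed.

Lemma congxV N f g : congx N f g -> congx N f^-1 g^-1.
Proof.
case: N => [|N] H //.
have e0 : f 0%N 0%N = g 0%N 0%N by apply: H.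
case uf : (f \is a GRing.unit); last first.
  rewrite !invr_out //; first by rewrite fps_unitE -e0 -fps_unitE uf.
  by rewrite uf.
have ug : g \is a GRing.unit by rewrite fps_unitE -e0.
have ef : f^-1 = g^-1 * f^-1 * g by rewrite mulrAC mulVr // mul1r.
have eg : g^-1 = g^-1 * f^-1 * f by rewrite -mulrA mulVr // mulr1.
rewrite [X in congx _ X _]ef [X in congx _ _ X]eg.
by apply: congxM; [apply: congx_refl | apply: congx_sym].
Qed.

(** Let [u] be the part of [g] of degree at least [m] in [y], divided by [y^m]:
    it is a unit, and the rest of [g] is divisible by [x].  The part of degree
    at least [m] of the equation then determines [w = q u] by a contraction for
    the [x]-adic topology. *)
Lemma weierstrass_division m g h :
  g 0%N m != 0 -> (forall j, (j < m)%N -> g 0%N j = 0) ->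
  exists q r, h = q * g + r /\ forall i j, (m <= j)%N -> r i j = 0.
Proof.
move=> gm gj.
pose u := shifty m g; pose g1 := g - Y ^+ m * u.
have uu : u \is a GRing.unit by rewrite fps_unitE /= add0n.
have g1x : congx 1 g1 0.
  move=> [|//] j _; rewrite fcoefB fcoefYnM /=; case: leqP => hj.
    by rewrite subnK // subrr.
  by rewrite gj // subr0.
have [|w Fw] := @contraction_fixpoint K (fun i _ => i)
    (fun w => shifty m h - shifty m (w * (u^-1 * g1))).
  move=> k v w H i j lt_i; rewrite !fcoefB !fcoef_shifty; congr (_ - _).
  apply/eqP; rewrite -subr_eq0 -fcoefB -mulrBl; apply/eqP.
  apply: (@congx0M _ k 1 _ _ _ _ i); last by rewrite addn1.
    by move=> i' j' lt_i'; rewrite fcoefB H // subrr.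
  by rewrite -(mulr0 u^-1); apply: congxM.
exists (w * u^-1), (h - w * u^-1 * g); split; first by ring.
move=> i j le_mj; have := congr1 (fun f : fps K => f i (j - m)%N) Fw.
rewrite fcoefB !fcoef_shifty subnK // => e.
have -> : w * u^-1 * g = w * (u^-1 * g1) + Y ^+ m * w.
  by rewrite /g1 mulrA mulrBr [_ * (_ * u)]mulrCA -[w * _ * u]mulrA mulVr //; ring.
by rewrite fcoefB fcoefD fcoefYnM le_mj -e; ring.
Qed.

End Domain.

(** * Substitution of series without constant term *)

Section Substitution.
Variable K : comNzRingType.
Implicit Types f g h P Q : fps K.

Local Notation X := (fps_x K).
Local Notation Y := (fps_y K).

(** [P] without its terms free of [x]: the substitution below is then a ring
    morphism for all arguments. *)
Definition xpart P : fps K := X * shiftx 1 P.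

Lemma xpartE P : congx 1 P 0 -> xpart P = P.
Proof.
by move=> P0; rewrite /xpart; symmetry; apply: (@shiftxE _ 1) => i j h; apply: P0.
Qed.

Lemma congx_xpart P : congx 1 (xpart P) 0.
Proof. by move=> [|//] j _; rewrite fcoefXM. Qed.

Definition subst_mono P Q i j : fps K := xpart P ^+ i * xpart Q ^+ j.

Lemma congx_subst_mono P Q i j : congx (i + j) (subst_mono P Q i j) 0.
Proof. by apply: congx0M; apply: congx0X; apply: congx_xpart. Qed.

(** [f(P, Q)], for [P] and [Q] divisible by [x]. *)
Definition subst P Q f : fps K := Fps (fun a b =>
  \sum_(i < a.+1) \sum_(j < a.+1) f i j * subst_mono P Q i j a b).

Lemma fcoef_substE P Q f a b : subst P Q f a b =
  \sum_(i < a.+1) \sum_(j < a.+1) f i j * subst_mono P Q i j a b.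
Proof. by []. Qed.

Lemma fcoef_subst P Q f a b n m : (a < n)%N -> (a < m)%N ->
  subst P Q f a b = \sum_(i < n) \sum_(j < m) f i j * subst_mono P Q i j a b.
Proof.
move=> an am; rewrite fcoef_substE.
have z i j : (a < i)%N || (a < j)%N -> subst_mono P Q i j a b = 0.
  by move=> h; apply: congx_subst_mono; case/orP: h => h; lia.
rewrite (big_ord_widen _ (fun i : nat =>
  \sum_(j < a.+1) f i j * subst_mono P Q i j a b) an) big_mkcond.
apply: eq_bigr => i _; case: ltnP => hi; last first.
  by rewrite big1 // => j _; rewrite z ?mulr0 // hi.
rewrite (big_ord_widen _ (fun j : nat => f i j * subst_mono P Q i j a b) am).
rewrite big_mkcond; apply: eq_bigr => j _; case: ltnP => // hj.
by rewrite z ?mulr0 // hj orbT.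
Qed.

Lemma congx_subst_trunc P Q f N n m : (N <= n)%N -> (N <= m)%N ->
  congx N (subst P Q f)
    (\sum_(i < n) \sum_(j < m) f i j *: subst_mono P Q i j).
Proof.
move=> Nn Nm a b aN.
rewrite (@fcoef_subst P Q f a b n m); [|exact: leq_trans Nn|exact: leq_trans Nm].
by rewrite fcoef_sum; apply: eq_bigr => i _; rewrite fcoef_sum.
Qed.

Lemma substD P Q : {morph subst P Q : f g / f + g}.
Proof.
move=> f g; apply: fpsP => a b; rewrite fcoefD !fcoef_substE -big_split.
by apply: eq_bigr => i _ /=; rewrite -big_split; apply: eq_bigr => j _; rewrite mulrDl.
Qed.

Lemma substA P Q c : subst P Q c%:A = c%:A.
Proof.
apply: fpsP => a b; rewrite fcoef_substE.
have z i j : (0 < i + j)%N -> (c%:A : fps K) i j = 0.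
  by case: i j => [|i] [|j] //; rewrite fcoefA mulr0.
rewrite big_ord_recl [X in _ + X]big1 ?addr0; last first.
  by move=> i _; rewrite big1 // => j _; rewrite z ?mul0r.
rewrite big_ord_recl [X in _ + X]big1 ?addr0; last first.
  by move=> i _; rewrite z ?mul0r.
by rewrite /subst_mono !expr0 mulr1 fcoefA mulr1.
Qed.

Lemma subst_XM P Q f : subst P Q (X * f) = xpart P * subst P Q f.
Proof.
apply: congx_eq => N.
apply: (@congx_trans _ N _ _ _ (@congx_subst_trunc P Q _ N N.+2 N.+1 _ _)); try lia.
apply: congx_sym; apply: congx_trans.
  apply: congxM; first exact: congx_refl.
  exact: (@congx_subst_trunc P Q f N N.+1 N.+1).
apply: congx_sym.
move=> a b _; congr (fcoef _ a b).
rewrite big_ord_recl big1 ?add0r; last by move=> j _; rewrite fcoefXM scale0r.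
rewrite mulr_sumr; apply: eq_bigr => i _; rewrite mulr_sumr.
apply: eq_bigr => j _; rewrite fcoefXM /= [RHS]mulrC -scalerAl mulrC; congr (_ *: _).
by rewrite /subst_mono exprS mulrA.
Qed.

Lemma subst_YM P Q f : subst P Q (Y * f) = xpart Q * subst P Q f.
Proof.
apply: congx_eq => N.
apply: (@congx_trans _ N _ _ _ (@congx_subst_trunc P Q _ N N.+1 N.+2 _ _)); try lia.
apply: congx_sym; apply: congx_trans.
  apply: congxM; first exact: congx_refl.
  exact: (@congx_subst_trunc P Q f N N.+1 N.+1).
apply: congx_sym.
move=> a b _; congr (fcoef _ a b).
rewrite mulr_sumr; apply: eq_bigr => i _.
rewrite big_ord_recl fcoefYM scale0r add0r mulr_sumr.
apply: eq_bigr => j _; rewrite fcoefYM /= [RHS]mulrC -scalerAl mulrC; congr (_ *: _).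
by rewrite /subst_mono exprS mulrCA.
Qed.

Fact subst_zmod_morphism P Q : zmod_morphism (subst P Q).
Proof.
move=> f g; apply/eqP; rewrite eq_sym subr_eq -substD subrK; exact/eqP.
Qed.

Lemma xpart00 P : xpart P 0%N 0%N = 0.
Proof. exact: congx_xpart. Qed.

Fact substM P Q : {morph subst P Q : f g / f * g}.
Proof.
move=> f g; apply: (@additive_ext K (fun f => subst P Q (f * g))
  (fun f => subst P Q f * subst P Q g) (xpart P) (xpart Q))
  => [u v|u v|c|||u|u|u|u].
- by rewrite mulrDl substD.
- by rewrite substD mulrDl.
- rewrite substA; apply: fpsP => i j; rewrite fcoefAM !fcoef_substE mulr_sumr.
  apply: eq_bigr => a _; rewrite mulr_sumr; apply: eq_bigr => b _.
  by rewrite fcoefAM mulrA.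
- exact: xpart00.
- exact: xpart00.
- by rewrite -mulrA subst_XM.
- by rewrite -mulrA subst_YM.
- by rewrite subst_XM mulrA.
- by rewrite subst_YM mulrA.
Qed.

Fact subst_monoid_morphism P Q : monoid_morphism (subst P Q).
Proof. by split; [rewrite -[1](scale1r 1) substA | apply: substM]. Qed.

HB.instance Definition _ P Q := GRing.isZmodMorphism.Build _ _ (subst P Q)
  (subst_zmod_morphism P Q).
HB.instance Definition _ P Q := GRing.isMonoidMorphism.Build _ _ (subst P Q)
  (subst_monoid_morphism P Q).

Lemma subst_x P Q : congx 1 P 0 -> subst P Q X = P.
Proof. by move=> P0; rewrite -[X]mulr1 subst_XM rmorph1 mulr1 xpartE. Qed.

Lemma subst_y P Q : congx 1 Q 0 -> subst P Q Y = Q.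
Proof. by move=> Q0; rewrite -[Y]mulr1 subst_YM rmorph1 mulr1 xpartE. Qed.

Lemma substZ P Q c f : subst P Q (c *: f) = c *: subst P Q f.
Proof. by rewrite [c *: f]scaleE substM substA -scaleE. Qed.

Lemma congx_subst N P Q Q' f : congx 1 Q 0 -> congx 1 Q' 0 ->
  congx N Q Q' -> congx N (subst P Q f) (subst P Q' f).
Proof.
move=> Q0 Q0' QQ'.
apply: (congx_trans (@congx_subst_trunc P Q f N N N _ _)) => //.
apply: congx_sym; apply: (congx_trans (@congx_subst_trunc P Q' f N N N _ _)) => //.
apply: congx_sym; apply: congx_sum => i _; apply: congx_sum => j _.
apply: congxZ; rewrite /subst_mono (xpartE Q0) (xpartE Q0').
by apply: (@congxM _ N) => //; apply: congxX.
Qed.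

Lemma fcoef00_subst P Q f : subst P Q f 0%N 0%N = f 0%N 0%N.
Proof. by rewrite fcoef_substE !big_ord1 /subst_mono !expr0 !mulr1. Qed.

Lemma dx_subst P Q f : congx 1 P 0 -> congx 1 Q 0 ->
  fps_dx (subst P Q f) =
  subst P Q (fps_dx f) * fps_dx P + subst P Q (fps_dy f) * fps_dx Q.
Proof.
move=> P0 Q0.
apply/eqP; rewrite -subr_eq0; apply/eqP.
apply: (@additive_eq0 K (fun f => fps_dx (subst P Q f) -
    (subst P Q (fps_dx f) * fps_dx P + subst P Q (fps_dy f) * fps_dx Q)) P Q).
- by move=> u v; rewrite !dxD !dyD !substD dxD; ring.
- by move=> c; rewrite substA !dxA dyA rmorph0; ring.
- exact: P0.
- exact: Q0.
- move=> u; rewrite dxXM dyXM substD !subst_XM dxM (xpartE P0); ring.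
- move=> u; rewrite dxYM dyYM substD !subst_YM dxM (xpartE Q0); ring.
Qed.

End Substitution.

(** * The ideal of a parametrized curve *)

(* Simplification would unfold the products of series into sums. *)
Arguments fcoef : simpl never.

Section Kernel.
Variable K : fieldType.
Implicit Types f g h P Q : fps K.

Local Notation X := (fps_x K).
Local Notation Y := (fps_y K).

Definition x_only f := forall i j, (0 < j)%N -> f i j = 0.

Lemma congx_Xn n : (0 < n)%N -> congx 1 (X ^+ n) 0.
Proof. by case: n => [//|n] _ [|//] j _; rewrite fcoefXn. Qed.

Lemma fcoef_subst_x_only n Q g a b : (0 < n)%N -> x_only g ->
  subst (X ^+ n) Q g a b =
  if (n %| a)%N && (b == 0%N) then g (a %/ n)%N 0%N else 0.
Proof.
move=> n0 gx; rewrite (@fcoef_subst _ _ _ _ a b a.+1 a.+1) //.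
have e i : \sum_(j < a.+1) g i j * subst_mono (X ^+ n) Q i j a b =
    g i 0%N * ((a == n * i)%N && (b == 0%N))%:R.
  rewrite big_ord_recl big1 ?addr0 => [|j _]; last by rewrite gx // mul0r.
  by rewrite /subst_mono expr0 mulr1 (xpartE (congx_Xn n0)) -exprM fcoefXn.
under eq_bigr do rewrite e.
case: (boolP (n %| a)%N) => [/dvdnP[k ea]|na]; last first.
  rewrite big1 // => i _; case: eqP => [ea|_]; last by rewrite mulr0.
  by case/negP: na; rewrite ea dvdn_mulr.
have ltk : (k < a.+1)%N by rewrite ltnS ea leq_pmulr.
rewrite (bigD1 (Ordinal ltk)) //= big1 ?addr0 => [|i]; last first.
  rewrite -val_eqE /= => ik; case: eqP => [e'|_]; last by rewrite mulr0.
  by case/eqP: ik; apply/eqP; rewrite -(eqn_pmul2l n0) -e' ea mulnC.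
rewrite ea mulnK // mulnC eqxx /=.
by case: (b == 0%N); rewrite ?mulr1 ?mulr0.
Qed.

Lemma fcoef_subst_restrict_y f a b :
  subst 0 X f a b = if b == 0%N then f 0%N a else 0.
Proof.
rewrite (@fcoef_subst _ _ _ _ a b a.+1 a.+1) // big_ord_recl.
rewrite [X in _ + X]big1 ?addr0; last first.
  move=> i _; rewrite big1 // => j _.
  by rewrite /subst_mono xpartE // exprS !mul0r mulr0.
have e (j : 'I_a.+1) : true -> f 0%N j * subst_mono 0 X 0 j a b =
    if j == ord_max then (if b == 0%N then f 0%N a else 0) else 0.
  rewrite /subst_mono expr0 mul1r xpartE; last by rewrite -(expr1 X); apply: congx_Xn.
  rewrite fcoefXn -val_eqE /= eq_sym; case: eqP => [->|_] _; last by rewrite mulr0.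
  by case: (b == 0%N); rewrite ?mulr1 ?mulr0.
by rewrite (eq_bigr _ e) -big_mkcond big_pred1_eq.
Qed.

Lemma multiplication_matrix n Q : (0 < n)%N -> congx 1 Q 0 -> x_only Q ->
  exists M : 'M[fps K]_n, [/\ forall i j, x_only (M i j),
    forall i j : 'I_n, (j <= i)%N -> M i j 0%N 0%N = 0 &
    forall i : 'I_n,
      \sum_(j < n) subst (X ^+ n) Q (M i j) * X ^+ j = Q * X ^+ i].
Proof.
move=> n0 Q0 Qx.
pose F (i j : 'I_n) := Fps (fun k l =>
  if l == 0%N then (Q * X ^+ i) (n * k + j)%N 0%N else 0).
have xF i j : x_only (F i j) by move=> k [|l] // _; rewrite fcoef_Fps.
exists (\matrix_(i, j) F i j); split=> [i j|i j le_ji|i].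
- by rewrite mxE.
- rewrite mxE fcoef_Fps eqxx muln0 add0n mulrC fcoefXnM.
  by case: leqP => // h; rewrite Q0 //; lia.
apply: fpsP => a b; rewrite fcoef_sum.
have ltr : (a %% n < n)%N by rewrite ltn_mod.
have e (j : 'I_n) : true -> (subst (X ^+ n) Q ((\matrix_(i, j) F i j) i j) *
    X ^+ j) a b = if j == Ordinal ltr then (Q * X ^+ i) a b else 0.
  move=> _; rewrite mulrC fcoefXnM mxE.
  rewrite -val_eqE /=; case: eqP => [ej|nj].
    rewrite ej leq_mod fcoef_subst_x_only //.
    have -> : (a - a %% n = a %/ n * n)%N by rewrite {1}(divn_eq a n) addnK.
    rewrite dvdn_mull // mulnK // fcoef_Fps /= ej mulnC -divn_eq.
    case: eqP => [->//|]; case: b => // b _.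
    by rewrite mulrC fcoefXnM; case: leqP => // _; rewrite Qx.
  case: leqP => // ja; rewrite fcoef_subst_x_only //.
  case: (boolP (n %| a - j)%N) => //= /dvdnP[k e]; case: nj.
  by rewrite -(subnK ja) e modnMDl modn_small.
by rewrite (eq_bigr _ e) -big_mkcond big_pred1_eq.
Qed.

(** By Cayley and Hamilton a series [Q(x)] is a root of the characteristic
    polynomial of the multiplication by [Q] on the series in [x], seen as a
    module over the series in [x^n].  The polynomial [C] keeps track of the
    other series that are roots of the same equation. *)
Lemma kernel_element n Q : (0 < n)%N -> congx 1 Q 0 -> x_only Q ->
  exists (g : fps K) (C : {poly fps K}),
  [/\ subst (X ^+ n) Q g = 0, g 0%N n != 0, C \is monic &
    forall Q', congx 1 Q' 0 -> subst (X ^+ n) Q' g = C.[Q']].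
Proof.
move=> n0 Q0 Qx; have [M [xM M0 eM]] := multiplication_matrix n0 Q0 Qx.
pose N := \matrix_(i, j) subst (X ^+ n) Q (M i j).
have subst_M Q' i j : subst (X ^+ n) Q' (M i j) = subst (X ^+ n) Q (M i j).
  by apply: fpsP => a b; rewrite !fcoef_subst_x_only.
have hornerN_char R : (char_poly N).[R] = \det (R%:M - N).
  rewrite /char_poly -horner_evalE -det_map_mx; congr (\det _).
  apply/matrixP => i j; rewrite !mxE /= horner_evalE hornerD hornerN hornerC.
  by rewrite hornerMn hornerX.
have ann Q' : congx 1 Q' 0 ->
    subst (X ^+ n) Q' (\det (Y%:M - M)) = (char_poly N).[Q'].
  move=> Q'0; rewrite hornerN_char -det_map_mx.
  congr (\det _); apply/matrixP => i j.
  by rewrite !mxE rmorphB rmorphMn /= subst_M subst_y.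
exists (\det (Y%:M - M)), (char_poly N); split=> //; last 1 first.
- exact: char_poly_monic.
- rewrite ann // hornerN_char.
  pose v : 'cV[fps K]_n := \col_(j < n) X ^+ j.
  have ev : (Q%:M - N) *m v = 0.
    rewrite mulmxBl mul_scalar_mx; apply/eqP; rewrite subr_eq0; apply/eqP.
    apply/matrixP => i j; rewrite !mxE -eM; apply: eq_bigr => k _.
    by rewrite !mxE.
  have := congr1 (mulmx (\adj (Q%:M - N))) ev.
  rewrite mulmxA mul_adj_mx mulmx0 mul_scalar_mx => /matrixP /(_ (Ordinal n0) 0).
  by rewrite !mxE expr0 mulr1.
(* At [x = 0] the matrix is strictly triangular. *)
suff : subst 0 X (\det (Y%:M - M)) = X ^+ n.
  move/(congr1 (fun f : fps K => f n 0%N)).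
  by rewrite fcoef_subst_restrict_y /= => ->; rewrite fcoefXn !eqxx oner_neq0.
have X0 : congx 1 X 0 by rewrite -(expr1 X); apply: congx_Xn.
have rM (i j : 'I_n) : (j <= i)%N -> subst 0 X (M i j) = 0.
  move=> ji; apply: fpsP => a b; rewrite fcoef_subst_restrict_y fcoef0.
  by case: eqP => // _; case: a => [|a]; [rewrite M0 | rewrite xM].
rewrite -det_map_mx -det_tr det_trig; last first.
  apply/is_trig_mxP => i j ij; rewrite !mxE rmorphB rmorphMn /=.
  by rewrite -val_eqE /= gtn_eqF // mulr0n sub0r rM ?oppr0 // ltnW.
rewrite (eq_bigr (fun=> X)) => [|i _]; last first.
  by rewrite !mxE rmorphB rmorphMn /= eqxx mulr1n subst_y // rM ?subr0.
by rewrite prodr_const card_ord.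
Qed.

(** The kernel of [f |-> f(x^n, Q(x))] is prime; an element of it of minimal
    order on [x = 0] divides all the others by Weierstrass division. *)
Lemma principal_kernel n Q : (0 < n)%N -> congx 1 Q 0 -> x_only Q ->
  exists (f : fps K) (C : {poly fps K}), [/\ irreducible f,
    forall h, subst (X ^+ n) Q h = 0 <-> divides f h, C \is monic &
    forall Q', congx 1 Q' 0 -> subst (X ^+ n) Q' f = 0 -> root C Q'].
Proof.
move=> n0 Q0 Qx; have [g [C [gker gn Cmonic gC]]] := kernel_element n0 Q0 Qx.
pose ker h := subst (X ^+ n) Q h = 0.
have ex : exists m, `[< exists h, ker h /\ h 0%N m != 0 >].
  by exists n; apply/asboolP; exists g.
case: (ex_minnP ex) => m /asboolP[f [fker fm]] mmin.
have min h j : ker h -> (j < m)%N -> h 0%N j = 0.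
  move=> hker lt_jm; apply/eqP; apply: contraTT lt_jm => hj; rewrite -leqNgt.
  by apply: mmin; apply/asboolP; exists h.
have f0 : f != 0 by apply: contraNneq fm => ->.
have kerP h : ker h <-> divides f h.
  split=> [hker|[c ->]]; last by rewrite /ker rmorphM /= fker mul0r.
  have [q [r [eh rm]]] := @weierstrass_division K m f h fm (fun j => @min f j fker).
  suff r0 : r = 0 by exists q; rewrite eh r0 addr0 mulrC.
  have rker : ker r.
    have -> : r = h - q * f by rewrite eh; ring.
    by rewrite /ker rmorphB rmorphM /= hker fker mulr0 subrr.
  apply: contrapT => /coef_lowest[i [j [rij ri _]]].
  have er := shiftxE ri.
  have ltjm : (j < m)%N.
    by rewrite ltnNge; apply: contraNN rij => mj; rewrite rm.
  suff k0 : ker (shiftx i r).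
    move: (min _ _ k0 ltjm); rewrite fcoef_shiftx add0n => e.
    by rewrite e eqxx in rij.
  move: rker; rewrite /ker {1}er rmorphM rmorphXn /= subst_x; last exact: congx_Xn.
  move/eqP; rewrite mulf_eq0 -exprM expf_eq0 (negPf (fps_x_neq0 K)) andbF.
  by move/eqP.
exists f, C; split=> //.
- split=> [/eqP||a b eab]; first by rewrite (negPf f0).
    move=> [c fc]; have : subst (X ^+ n) Q (f * c) = 1 by rewrite fc rmorph1.
    by rewrite rmorphM /= fker mul0r => /eqP; rewrite eq_sym oner_eq0.
  have half a' b' : f = a' * b' -> ker a' -> invertible b'.
    move=> e /kerP[c ea]; exists c.
    have : f * (b' * c - 1) = 0.
      by rewrite mulrBr mulr1 mulrA [f * b' * c]mulrAC -ea -e subrr.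
    by move/eqP; rewrite mulf_eq0 (negPf f0) subr_eq0 => /eqP.
  have /eqP := fker; rewrite eab rmorphM mulf_eq0.
  case/orP=> /eqP h; first by right; apply: half eab h.
  by left; apply: half h; rewrite mulrC.
- move=> Q' Q'0 fQ'; rewrite /root -gC //.
  by have [c ->] := (kerP g).1 gker; rewrite rmorphM /= fQ' mul0r.
Qed.

End Kernel.

(** * Separatrices from parametrized integral curves *)

Section Parametrized.
Variable K : numClosedFieldType.
Implicit Types (f g h P Q : fps K) (w : Defs.form K).

Local Notation X := (fps_x K).
Local Notation Y := (fps_y K).

Lemma natr_fps_neq0 n : (0 < n)%N -> (n%:R : fps K) != 0.
Proof. by move=> n0; rewrite fps_natrE alg_neq0 // pnatr_eq0 -lt0n. Qed.

Lemma dx_Xn_neq0 n : (0 < n)%N -> fps_dx (X ^+ n) != 0.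
Proof.
move=> n0; rewrite dx_exp dxX mulr1 mulf_neq0 ?natr_fps_neq0 //.
by rewrite expf_neq0 // fps_x_neq0.
Qed.

(** Differentiating [f(x^n, Q) = 0] shows that [df] and [w] are proportional
    along an integral curve, so that the coefficient of [w /\ df] vanishes
    there. *)
Lemma parametrized_separatrix w n Q :
  (0 < n)%N -> congx 1 Q 0 -> x_only Q ->
  subst (X ^+ n) Q w.1 * fps_dx (X ^+ n) + subst (X ^+ n) Q w.2 * fps_dx Q = 0 ->
  exists (f : fps K) (C : {poly fps K}), [/\ separatrix w f,
    subst (X ^+ n) Q f = 0, C \is monic &
    forall Q', congx 1 Q' 0 -> subst (X ^+ n) Q' f = 0 -> root C Q'].
Proof.
move=> n0 Q0 Qx wQ.
have [f [C [firr fker Cm CQ]]] := principal_kernel n0 Q0 Qx.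
have f0 : subst (X ^+ n) Q f = 0 by apply/fker; exists 1; rewrite mulr1.
exists f, C; split=> //; split=> //; apply/fker.
have := dx_subst f (congx_Xn K n0) Q0.
rewrite f0 -[in LHS](scale0r 1) dxA => df.
apply: (mulIf (dx_Xn_neq0 n0)); rewrite mul0r rmorphB !rmorphM /= mulrBl.
set A := subst _ _ w.1 in wQ *; set B := subst _ _ w.2 in wQ *.
set fx := subst _ _ (fps_dx f) in df *; set fy := subst _ _ (fps_dy f) in df *.
set P' := fps_dx (X ^+ n) in df wQ *; set Q' := fps_dx Q in df wQ *.
have -> : A * fy * P' - B * fx * P' =
    fy * (A * P' + B * Q') - B * (fx * P' + fy * Q') by ring.
by rewrite wQ -df !mulr0 subrr.
Qed.

(** Only finitely many of infinitely many parametrized curves lie on each of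
    finitely many curves, as they are roots of a polynomial. *)
Lemma integral_family_dicritical w n (Q : nat -> fps K) :
  (0 < n)%N -> injective Q ->
  (forall k, [/\ congx 1 (Q k) 0, x_only (Q k) &
    subst (X ^+ n) (Q k) w.1 * fps_dx (X ^+ n) +
    subst (X ^+ n) (Q k) w.2 * fps_dx (Q k) = 0]) ->
  ~ non_dicritical w.
Proof.
move=> n0 Qinj HQ [s Hs].
pose good g (C : {poly fps K}) := C \is monic /\
  forall Q', congx 1 Q' 0 -> subst (X ^+ n) Q' g = 0 -> root C Q'.
pose C g : {poly fps K} :=
  if pselect (exists D, good g D) is left e then projT1 (cid e) else 1.
have CP g : C g \is monic /\ ((exists D, good g D) -> good g (C g)).
  rewrite /C; case: pselect => [e|ne]; last by split; [exact: monic1|].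
  by case: (cid e) => D gD; split=> //; case: gD.
pose Pi := \prod_(g <- s) C g.
have Pim : Pi \is monic by apply: monic_prod => g _; case: (CP g).
have rootPi k : root Pi (Q k).
  have [Q0 Qx wQ] := HQ k.
  have [f [D [fsep fk Dm DQ]]] := parametrized_separatrix n0 Q0 Qx wQ.
  have [g gs [u [v uv] efg]] := Hs f fsep.
  have gD : good g D.
    split; first exact: Dm.
    move=> Q' Q'0 gQ'; apply: (DQ Q' Q'0).
    by rewrite efg rmorphM /= gQ' mulr0.
  have [_ CQ] : good g (C g) by case: (CP g) => _; apply; exists D.
  have : root (C g) (Q k).
    apply: CQ => //; have -> : g = v * f by rewrite efg mulrA [v * u]mulrC uv mul1r.
    by rewrite rmorphM /= fk mulr0.
  by rewrite /Pi (big_rem g gs) /= rootM => ->.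
have := @max_poly_roots _ Pi (map Q (iota 0 (size Pi))) (monic_neq0 Pim).
rewrite map_inj_uniq // iota_uniq size_map size_iota ltnn => H.
suff : false by []; apply: H => //.
by apply/allP => _ /mapP[k _ ->].
Qed.

End Parametrized.

(** * Formal differential equations and weights *)

Section Dicritical.
Variable K : numClosedFieldType.
Implicit Types (f g h P Q D : fps K) (w : Defs.form K).

Local Notation X := (fps_x K).
Local Notation Y := (fps_y K).

Definition nonexpansive (F : fps K -> fps K) :=
  forall N f g, congx N f g -> congx N (F f) (F g).

Lemma congx_alg_x N (c : K) f g :
  congx N f g -> congx N.+1 (c%:A + X * f) (c%:A + X * g).
Proof.
move=> H; apply: congxD; first exact: congx_refl.
by rewrite -add1n -(expr1 X); apply: congxXM.
Qed.

(** The integral equation of [z' = F(z)] is contracting when [F] does not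
    increase [x]-adic distances. *)
Lemma formal_ode (F : fps K -> fps K) (c : K) : nonexpansive F ->
  exists z, congx 1 z c%:A /\ fps_dx z = F z.
Proof.
move=> FN.
pose I f : fps K := Fps (fun i j => f i j / i.+1%:R).
have [|u Fu] := @contraction_fixpoint K (fun i _ => i)
    (fun u => I (F (c%:A + X * u))).
  move=> k f g H i j lt_i; rewrite !fcoef_Fps; congr (_ / _).
  by apply: (FN k.+1) => //; apply: congx_alg_x => i' j'; apply: H.
exists (c%:A + X * u); split.
  rewrite -[X in congx _ _ X]addr0 -[X in congx _ _ (_ + X)](mulr0 X).
  exact: congx_alg_x.
apply: fpsP => i j; rewrite fcoef_dx fcoefD fcoefA mulr0 add0r fcoefXM.
have <- : (I (F (c%:A + X * u))) i j = u i j by rewrite Fu.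
by rewrite fcoef_Fps -[LHS]mulr_natr divfK // pnatr_eq0.
Qed.

(** The coefficient of [t^N] in [f(x0 t^m, y0 t^n)]: the value at [(x0, y0)]
    of the part of [f] that is quasi-homogeneous of degree [N]. *)
Definition quasi_part (m n N : nat) f (x0 y0 : K) : K :=
  subst (x0%:A * X ^+ m) (y0%:A * X ^+ n) f N 0%N.

Lemma congx_AXn (c : K) n : (0 < n)%N -> congx 1 (c%:A * X ^+ n) 0.
Proof.
move=> n0; rewrite -(mulr0 c%:A); apply: congxM; first exact: congx_refl.
exact: congx_Xn.
Qed.

Lemma subst_mono_AXn m n (x0 y0 : K) i j : (0 < m)%N -> (0 < n)%N ->
  subst_mono (x0%:A * X ^+ m) (y0%:A * X ^+ n) i j =
  (x0 ^+ i * y0 ^+ j)%:A * X ^+ (m * i + n * j).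
Proof.
move=> m0 n0; rewrite /subst_mono !xpartE; try exact: congx_AXn.
by rewrite !exprMn -!algXn algM exprD !exprM; ring.
Qed.

Lemma quasi_partE m n N f x0 y0 : (0 < m)%N -> (0 < n)%N ->
  quasi_part m n N f x0 y0 = \sum_(i < N.+1) \sum_(j < N.+1)
    f i j * (if (m * i + n * j == N)%N then x0 ^+ i * y0 ^+ j else 0).
Proof.
move=> m0 n0; rewrite /quasi_part fcoef_substE.
apply: eq_bigr => i _; apply: eq_bigr => j _; congr (_ * _).
rewrite subst_mono_AXn // fcoefAM fcoefXn andbT eq_sym.
by case: eqP; rewrite ?mulr1 ?mulr0.
Qed.

Section WeightedDivision.
Variables (p q n k : nat) (D : fps K).
Hypotheses (p0 : (0 < p)%N) (q0 : (0 < q)%N) (n0 : (0 < n)%N).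
Hypothesis Dk : forall i j, (p * i + q * j < k)%N -> D i j = 0.

Let D1 := shiftx k.+1 D.
Let D2 : fps K := Fps (fun i j => if (i < k.+1)%N then D i (j + k.+1)%N else 0).

Let DE : D = \sum_(i < k.+1) \sum_(j < k.+1) D i j *: (X ^+ i * Y ^+ j)
  + X ^+ k.+1 * D1 + Y ^+ k.+1 * D2.
Proof.
apply: fpsP => a b; rewrite !fcoefD fcoefXnM fcoefYnM !fcoef_Fps fcoef_sum.
have e (i : 'I_k.+1) : true ->
    (\sum_(j < k.+1) D i j *: (X ^+ i * Y ^+ j)) a b =
    if a == i then (if (b < k.+1)%N then D a b else 0) else 0.
  move=> _; rewrite fcoef_sum; case: eqP => [ai|/eqP ai]; last first.
    by rewrite big1 // => j _; rewrite fcoefZ fcoefXnYn (negPf ai) mulr0.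
  case: ltnP => hb; last first.
    rewrite big1 // => j _; rewrite fcoefZ fcoefXnYn (gtn_eqF (leq_trans _ hb)) //.
    by rewrite andbF mulr0.
  rewrite (bigD1 (Ordinal hb)) //= big1 ?addr0 => [|j].
    by rewrite fcoefZ fcoefXnYn ai !eqxx mulr1.
  rewrite -val_eqE /= => jb; rewrite fcoefZ fcoefXnYn eq_sym.
  by rewrite [b == _]eq_sym (negPf jb) andbF mulr0.
rewrite (eq_bigr _ e); case: (ltnP a k.+1) => ha; last first.
  rewrite big1 ?add0r => [|i _]; last by rewrite (gtn_eqF (leq_trans _ ha)).
  by rewrite /= subnK //; case: ifP; rewrite addr0.
rewrite (bigD1 (Ordinal ha)) //= eqxx big1 ?addr0 => [|i]; last first.
  by rewrite -val_eqE /= eq_sym => /negPf->.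
rewrite /= ?addr0.
by case: ltnP => hb; rewrite ?addr0 ?add0r // ?subnK.
Qed.

(** Once the monomials [x^i y^j] with [i, j <= k] are split off, [t^(n k)] can
    be divided out of [D(t^(n p), t^(n q) e)] term by term, which loses no
    precision in [e]. *)
Lemma weighted_division : exists E : fps K -> fps K, [/\ nonexpansive E,
  forall e, X ^+ (n * k) * E e = subst (X ^+ (n * p)) (X ^+ (n * q) * e) D &
  forall c : K, congx 1 (E c%:A) (quasi_part p q k D 1 c)%:A].
Proof.
have np0 : (0 < n * p)%N by rewrite muln_gt0 n0.
have nq0 : (0 < n * q)%N by rewrite muln_gt0 n0.
have Qe e : congx 1 (X ^+ (n * q) * e) 0.
  by rewrite -(mul0r e); apply: congxM; [exact: congx_Xn | exact: congx_refl].
pose S e := subst (X ^+ (n * p)) (X ^+ (n * q) * e).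
pose E e := \sum_(i < k.+1) \sum_(j < k.+1)
    D i j *: (X ^+ (n * (p * i + q * j - k)) * e ^+ j)
  + X ^+ (n * (p * k.+1 - k)) * S e D1
  + X ^+ (n * (q * k.+1 - k)) * e ^+ k.+1 * S e D2.
exists E; split.
- move=> N e e' ee'.
  have SS f : congx N (S e f) (S e' f).
    by apply: congx_subst => //; apply: congxM => //; apply: congx_refl.
  apply: congxD; first apply: congxD.
  + apply: congx_sum => i _; apply: congx_sum => j _.
    by apply: congxZ; apply: congxM; [exact: congx_refl | exact: congxX].
  + by apply: congxM; [exact: congx_refl | exact: SS].
  + apply: congxM; last exact: SS.
    by apply: congxM; [exact: congx_refl | exact: congxX].
- move=> e; rewrite -/(S e D) [in RHS]DE /S !rmorphD !rmorphM !rmorphXn /=.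
  rewrite (subst_x _ (congx_Xn K np0)) (subst_y _ (Qe e)).
  rewrite -/(S e D1) -/(S e D2) /E !mulrDr; congr (_ + _ + _).
  + rewrite rmorph_sum mulr_sumr; apply: eq_bigr => i _.
    rewrite rmorph_sum mulr_sumr; apply: eq_bigr => j _.
    rewrite [RHS]substZ mulrC -scalerAl mulrC rmorphM !rmorphXn /=.
    rewrite (subst_x _ (congx_Xn K np0)) (subst_y _ (Qe e)).
    case: (ltnP (p * i + q * j) k) => h; first by rewrite Dk // !scale0r.
    congr (_ *: _); rewrite mulrA -exprD exprMn -!exprM mulrA -exprD.
    congr (X ^+ _ * _); rewrite -mulnDr subnKC // mulnDr; lia.
  + rewrite mulrA -exprD -exprM; congr (X ^+ _ * _).
    by rewrite -mulnDr subnKC ?mulnA // ltnW // leq_pmull.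
  + rewrite !mulrA -exprD exprMn -exprM; congr (X ^+ _ * _ * _).
    by rewrite -mulnDr subnKC ?mulnA // ltnW // leq_pmull.
- move=> c.
  have z m f : (k < m)%N -> congx 1 (X ^+ (n * (m - k)) * f) 0.
    move=> km; rewrite -(mul0r f); apply: congxM; last exact: congx_refl.
    by apply: congx_Xn; rewrite muln_gt0 n0 subn_gt0.
  rewrite -[X in congx _ _ X]addr0 -[X in congx _ _ X]addr0.
  apply: congxD; first apply: congxD.
  + rewrite quasi_partE // => -[|//] b _; rewrite fcoefA mulr_suml !fcoef_sum.
    apply: eq_bigr => i _; rewrite fcoef_sum mulr_suml; apply: eq_bigr => j _.
    rewrite fcoefZ -mulrA; case: (ltnP (p * i + q * j) k) => h.
      by rewrite Dk // !mul0r.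
    congr (_ * _); rewrite mulrC -algXn fcoefAM fcoefXn expr1n mul1r eqxx /=.
    have -> : (0 == n * (p * i + q * j - k))%N = (p * i + q * j == k)%N.
      by rewrite eq_sym muln_eq0 subn_eq0 [(_ == k)]eqn_leq h andbT (gtn_eqF n0).
    by case: eqP => _; rewrite ?mul0r ?mulr0.
  + by apply: z; rewrite leq_pmull.
  + by rewrite -mulrA; apply: z; rewrite leq_pmull.
Qed.

End WeightedDivision.

End Dicritical.

(** * Families of integral curves of the cuspidal foliations *)

Section Families.
Variable K : numClosedFieldType.
Implicit Types (f g h P Q D e z : fps K) (w : Defs.form K).

Local Notation X := (fps_x K).
Local Notation Y := (fps_y K).

Definition cusp_form (p q : nat) D : Defs.form K :=
  (- (q%:R * (X ^+ q.-1 + Y * D)), p%:R * (Y ^+ p.-1 + X * D)).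

Definition restrict_x f : fps K := subst X 0 f.

Let X0 : congx 1 X 0. Proof. by rewrite -(expr1 X); apply: congx_Xn. Qed.
Let O0 : congx 1 (0 : fps K) 0. Proof. by []. Qed.

Lemma restrict_x0 : restrict_x 0 = 0. Proof. exact: rmorph0. Qed.
Lemma restrict_xD : {morph restrict_x : f g / f + g}.
Proof. exact: rmorphD. Qed.
Lemma restrict_xM : {morph restrict_x : f g / f * g}.
Proof. exact: rmorphM. Qed.

Lemma fcoef_restrict_x f i j :
  restrict_x f i j = if j == 0%N then f i 0%N else 0.
Proof.
rewrite /restrict_x (@fcoef_subst _ _ _ _ i j i.+1 i.+1) //.
have e (k : 'I_i.+1) : true ->
    \sum_(l < i.+1) f k l * subst_mono X 0 k l i j =
    if k == ord_max then (if j == 0%N then f i 0%N else 0) else 0.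
  move=> _; rewrite big_ord_recl big1 ?addr0 => [|l _]; last first.
    by rewrite /subst_mono [xpart 0]xpartE // exprS mul0r !mulr0.
  rewrite /subst_mono expr0 mulr1 xpartE // fcoefXn -val_eqE /= eq_sym.
  by case: eqP => [->|_]; case: (j == 0%N); rewrite ?mulr1 ?mulr0.
by rewrite (eq_bigr _ e) -big_mkcond big_pred1_eq.
Qed.

Lemma dx_restrict_x f : fps_dx (restrict_x f) = restrict_x (fps_dx f).
Proof.
apply: fpsP => i j; rewrite fcoef_dx !fcoef_restrict_x fcoef_dx.
by case: eqP => // _; rewrite mul0rn.
Qed.

Lemma restrict_x_Xn n : restrict_x (X ^+ n) = X ^+ n.
Proof. by rewrite /restrict_x rmorphXn /= subst_x. Qed.

Lemma congx_restrict_x f : congx 1 f 0 -> congx 1 (restrict_x f) 0.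
Proof.
by move=> f0 i j i0; rewrite fcoef_restrict_x fcoef0 f0 //; case: ifP.
Qed.

Lemma restrict_x_subst P Q f : congx 1 P 0 -> congx 1 Q 0 ->
  restrict_x (subst P Q f) = subst (restrict_x P) (restrict_x Q) f.
Proof.
move=> P0 Q0; have RP := congx_restrict_x P0; have RQ := congx_restrict_x Q0.
apply: (@additive_ext K (fun f => restrict_x (subst P Q f))
  (subst (restrict_x P) (restrict_x Q)) (restrict_x P) (restrict_x Q))
  => [u v|u v|c|||u|u|u|u].
- by rewrite /restrict_x !rmorphD.
- by rewrite rmorphD.
- by rewrite /restrict_x !substA.
- exact: RP.
- exact: RQ.
- by rewrite subst_XM xpartE // /restrict_x rmorphM.
- by rewrite subst_YM xpartE // /restrict_x rmorphM.
- by rewrite subst_XM xpartE.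
- by rewrite subst_YM xpartE.
Qed.

(** On a curve [x = t^(n p), y = t^(n q) e(t)] the form
    [d(y^p - x^q) + D (p x dy - q y dx)] is a multiple of the left-hand side of
    this equation. *)
Lemma cusp_form_integral p q n D e : (0 < p)%N -> (0 < q)%N -> (0 < n)%N ->
  (n * q)%:R * (X ^+ (n * p * q) * (e ^+ p - 1)) + X * fps_dx e *
    (X ^+ (n * p * q) * e ^+ p.-1 + X ^+ (n * (p + q)) *
      subst (X ^+ (n * p)) (X ^+ (n * q) * e) D) = 0 ->
  subst (X ^+ (n * p)) (X ^+ (n * q) * e) (cusp_form p q D).1
    * fps_dx (X ^+ (n * p)) +
  subst (X ^+ (n * p)) (X ^+ (n * q) * e) (cusp_form p q D).2
    * fps_dx (X ^+ (n * q) * e) = 0.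
Proof.
move=> p0 q0 n0 He; apply: (mulfI (fps_x_neq0 K)); rewrite mulr0.
have np0 : (0 < n * p)%N by rewrite muln_gt0 n0.
have nq0 : (0 < n * q)%N by rewrite muln_gt0 n0.
have Qe : congx 1 (X ^+ (n * q) * e) 0.
  by rewrite -(mul0r e); apply: congxM; [exact: congx_Xn | exact: congx_refl].
rewrite /cusp_form /= !(rmorphN, rmorphM, rmorphD, rmorphXn, rmorph_nat) /=.
rewrite !(subst_x _ (congx_Xn K np0)) !(subst_y _ Qe).
set S := subst _ _ D in He *; rewrite dxM !dx_exp dxX mulr1.
have XE m : (0 < m)%N -> X ^+ m = X * X ^+ m.-1 by case: m => // m _; rewrite exprS.
move: He; have -> : X ^+ (n * (p + q)) = X ^+ (n * p) * X ^+ (n * q).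
  by rewrite -exprD mulnDr.
have -> : X ^+ (n * p * q) = (X ^+ (n * p)) ^+ q.-1 * X ^+ (n * p).
  by rewrite -exprSr prednK // -exprM.
have -> : e ^+ p = e * e ^+ p.-1 by rewrite -exprS prednK.
rewrite exprMn.
have epq : X ^+ (n * q) ^+ p.-1 * X ^+ (n * q) = X ^+ (n * p) ^+ q.-1 * X ^+ (n * p).
  by rewrite -!exprSr !prednK // -!exprM; congr (X ^+ _); lia.
move/(congr1 (fun g => X * g)): epq.
rewrite (XE _ np0) (XE _ nq0).
set u := X ^+ (n * p).-1; set v := X ^+ (n * q).-1.
set a := (X * u) ^+ q.-1; set b := (X * v) ^+ p.-1.
set r := e ^+ p.-1; rewrite !natrM => /mulXI epq He.
transitivity (p%:R * (n%:R * q%:R * (a * (X * u) * (e * r - 1)) +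
    X * fps_dx e * (a * (X * u) * r + X * u * (X * v) * S)) +
  p%:R * r * (n%:R * q%:R * e + X * fps_dx e) * (b * (X * v) - a * (X * u))).
  ring.
by rewrite He epq subrr !mulr0 addr0.
Qed.

Lemma natr_notin_seq (s : seq K) : exists B, forall k, (B <= k)%N -> k%:R \notin s.
Proof.
elim: s => [|r s [B HB]]; first by exists 0%N.
case: (pselect (exists n, r = n%:R)) => [[n ->]|nr].
  exists (maxn B n.+1) => k; rewrite geq_max => /andP[Bk nk].
  by rewrite inE negb_or eqr_nat HB // gtn_eqF.
exists B => k Bk; rewrite inE negb_or HB // andbT.
by apply/eqP => e; apply: nr; exists k.
Qed.

Lemma natr_nonroot (L : {poly K}) : L != 0 ->
  exists B, forall k, (B <= k)%N -> L.[k%:R] != 0.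
Proof.
move=> L0; have [r eL] := closed_field_poly_normal L.
have [B HB] := natr_notin_seq r; exists B => k Bk.
rewrite eL hornerZ mulf_neq0 ?lead_coef_eq0 //.
rewrite -/(root _ _) root_prod_XsubC.
exact: HB.
Qed.

Lemma quasi_part_natr_neq0 p q k D : (0 < p)%N -> (0 < q)%N ->
  (exists i j, (p * i + q * j = k)%N /\ D i j != 0) ->
  exists B, forall c, (B <= c)%N -> quasi_part p q k D 1 c%:R != 0.
Proof.
move=> p0 q0 [i0 [j0 [e0 D0]]].
pose L : {poly K} := \poly_(j < k.+1) \sum_(i < k.+1)
  (if (p * i + q * j == k)%N then D i j else 0).
have ik : (i0 < k.+1)%N by move: e0 p0; clear; nia.
have jk : (j0 < k.+1)%N by move: e0 q0; clear; nia.
have [|B HB] := @natr_nonroot L.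
  apply: contraNneq D0 => /(congr1 (fun L : {poly K} => L`_j0)).
  rewrite coef0 coef_poly jk (bigD1 (Ordinal ik)) //= e0 eqxx big1 ?addr0 => [->//|].
  move=> i; rewrite -val_eqE /= => ii; case: eqP => // e.
  by case/eqP: ii; apply/eqP; rewrite -(eqn_pmul2l p0) -(eqn_add2r (q * j0)) e e0.
exists B => c Bc; have := HB c Bc; congr (_ != _).
rewrite horner_poly quasi_partE // exchange_big /=; apply: eq_bigr => j _.
rewrite mulr_suml; apply: eq_bigr => i _.
by rewrite expr1n mul1r; case: eqP; rewrite ?mulr0 ?mul0r.
Qed.

(** The curves [x = t^(n p), y = t^(n q) e_k(t)] are told apart by the
    coefficient of order [m] of [e_k].  The [e_k] may involve the second
    variable, which is set to zero in their equations. *)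
Lemma cusp_family_dicritical p q n D m B (e : nat -> fps K) :
  (0 < p)%N -> (0 < q)%N -> (0 < n)%N ->
  (forall k, (B <= k)%N ->
    (n * q)%:R * (X ^+ (n * p * q) * (e k ^+ p - 1)) + X * fps_dx (e k) *
    (X ^+ (n * p * q) * e k ^+ p.-1 + X ^+ (n * (p + q)) *
      subst (X ^+ (n * p)) (X ^+ (n * q) * e k) D) = 0) ->
  (exists c, forall k, (B <= k)%N -> e k m 0%N = c + k%:R) ->
  ~ non_dicritical (cusp_form p q D).
Proof.
move=> p0 q0 n0 He [c ec].
have np0 : (0 < n * p)%N by rewrite muln_gt0 n0.
have nq0 : (0 < n * q)%N by rewrite muln_gt0 n0.
have Qe k : congx 1 (X ^+ (n * q) * e k) 0.
  by rewrite -(mul0r (e k)); apply: congxM; [exact: congx_Xn | exact: congx_refl].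
pose Q k := restrict_x (X ^+ (n * q) * e (B + k)%N).
apply: (@integral_family_dicritical K _ (n * p) Q) => // [k l|k].
  move=> /(congr1 (fun f : fps K => f (m + n * q)%N 0%N)).
  rewrite /Q !fcoef_restrict_x /= !fcoefXnM !leq_addl !addnK !ec ?leq_addr //.
  by move/addrI/eqP; rewrite eqr_nat eqn_add2l => /eqP.
split.
- exact: congx_restrict_x.
- by move=> i [|j] // _; rewrite fcoef_restrict_x.
have := cusp_form_integral p0 q0 n0 (He (B + k)%N (leq_addr _ _)).
move/(congr1 restrict_x).
rewrite restrict_x0 restrict_xD !restrict_xM !restrict_x_subst //; try exact: congx_Xn.
by rewrite -!dx_restrict_x restrict_x_Xn.
Qed.

(** When [D] has a monomial of weight less than that of [d(y^p - x^q)], the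
    radial part dominates: the curves [y^p = c x^q + ...] are integral for
    all but finitely many [c]. *)
Lemma low_weight_dicritical p q D : (1 < p)%N -> (1 < q)%N ->
  (exists i j, (p * i + q * j < p * q - p - q)%N /\ D i j != 0) ->
  ~ non_dicritical (cusp_form p q D).
Proof.
move=> p1 q1 low.
have p0 : (0 < p)%N by exact: ltnW.
have q0 : (0 < q)%N by exact: ltnW.
have ex : exists k, `[< exists i j, (p * i + q * j = k)%N /\ D i j != 0 >].
  by have [i [j [_ Dij]]] := low; exists (p * i + q * j)%N; apply/asboolP; exists i, j.
case: (ex_minnP ex) => k /asboolP lead kmin.
have ltk : (k < p * q - p - q)%N.
  have [i [j [lt_ij Dij]]] := low; apply: leq_ltn_trans lt_ij; apply: kmin.
  by apply/asboolP; exists i, j.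
have Dk i j : (p * i + q * j < k)%N -> D i j = 0.
  move=> h; apply/eqP; apply: contraTT h => Dij; rewrite -leqNgt; apply: kmin.
  by apply/asboolP; exists i, j.
have [E [EN ED E0]] := weighted_division p0 q0 (ltn0Sn 0) Dk.
have [B HB] := quasi_part_natr_neq0 p0 q0 lead.
(* [N + 1] is the difference of the weights of the two terms of the form. *)
pose N := (p * q - p - q - k).-1.
pose U e := E e + X ^+ N.+1 * e ^+ p.-1.
pose F e := - (q%:R * X ^+ N * (e ^+ p - 1)) / U e.
have UN : nonexpansive U.
  move=> M f g H; apply: congxD; first exact: EN.
  by apply: congxM; [exact: congx_refl | exact: congxX].
have FN : nonexpansive F.
  move=> M f g H; apply: congxM; last by apply: congxV; apply: UN.
  apply: congxN; apply: congxM; first exact: congx_refl.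
  by apply: congxB; [exact: congxX | exact: congx_refl].
have [e He] : exists e : nat -> fps K,
    forall k, congx 1 (e k) k%:R%:A /\ fps_dx (e k) = F (e k).
  pose e k := projT1 (cid (formal_ode k%:R FN)).
  by exists e => l; rewrite /e; case: (cid _).
apply: (@cusp_family_dicritical p q 1 D 0 B e) => //; last first.
  by exists 0 => l _; have [-> //] := He l; rewrite fcoefA mulr1 add0r.
move=> l Bl; have [el0 el] := He l.
have Uu : U (e l) \is a GRing.unit.
  rewrite fps_unitE fcoefD fcoefXnM addr0.
  rewrite (EN 1%N _ _ el0) // (E0 _ 0%N) // fcoefA mulr1.
  exact: HB.
rewrite -ED !mul1n el /F.
have -> : X ^+ (p * q) = X ^+ (p + q) * X ^+ k * X ^+ N.+1.
  by rewrite -!exprD; congr (X ^+ _); rewrite /N; lia.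
rewrite exprS; set a := X ^+ (p + q); set b := X ^+ k; set c := X ^+ N.
set u := e l ^+ p.-1.
have -> : a * b * (X * c) * u + a * (b * E (e l)) = a * b * U (e l).
  by rewrite /U exprS -/c -/u; ring.
set r := q%:R * c * (e l ^+ p - 1).
have -> : X * (- r / U (e l)) * (a * b * U (e l)) =
  - (X * a * b * r) * (U (e l))^-1 * U (e l) by ring.
rewrite mulrVK // /r; ring.
Qed.

(** On the last divisor, at the strict transform of a branch with a negative
    rational exponent [- b / a], the foliation is a node: the curves
    [e = e0 + c t^(p q b) + ...], [x = t^(a p)], are integral. *)
Lemma resonant_dicritical p q D (e0 : K) a b :
  (1 < p)%N -> (1 < q)%N -> (0 < a)%N -> (0 < b)%N ->
  (forall i j, (p * i + q * j < p * q - p - q)%N -> D i j = 0) ->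
  e0 ^+ p = 1 ->
  b%:R * (1 + e0 * quasi_part p q (p * q - p - q) D 1 e0) + a%:R = 0 ->
  ~ non_dicritical (cusp_form p q D).
Proof.
move=> p1 q1 a0 b0 Dk e0p res.
have p0 : (0 < p)%N by exact: ltnW.
have q0 : (0 < q)%N by exact: ltnW.
set k := (p * q - p - q)%N in Dk res.
have [E [EN ED E0]] := weighted_division p0 q0 a0 Dk.
set H := quasi_part p q k D 1 e0 in res.
(* The node has the first integral [z / t^B], up to higher order terms, where
   [e = e0 + z] and [t^a] is the equation of the divisor. *)
pose B := (p * q * b)%N.
have B0 : (0 < B)%N by rewrite !muln_gt0 p0 q0.
pose eta z := e0%:A + X ^+ B * z.
pose U z := E (eta z) + eta z ^+ p.-1.
pose G z := \sum_(i < p) eta z ^+ (p.-1 - i) * e0%:A ^+ i.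
pose M z := - ((a * q)%:R * G z + B%:R * U z).
pose F z := z * shiftx 1 (M z) / U z.
have etaN N f g : congx N f g -> congx N.+1 (eta f) (eta g).
  move=> fg; apply: congxD; first exact: congx_refl.
  by apply: (@congxW _ (B + N)); [rewrite -add1n leq_add2r | exact: congxXM].
have UN N f g : congx N f g -> congx N.+1 (U f) (U g).
  move=> /etaN fg; apply: congxD; [exact: EN | exact: congxX].
have GN N f g : congx N f g -> congx N.+1 (G f) (G g).
  move=> /etaN fg; apply: congx_sum => i _.
  by apply: congxM; [exact: congxX | exact: congx_refl].
have MN N f g : congx N f g -> congx N.+1 (M f) (M g).
  move=> fg; apply: congxN; apply: congxD; (apply: congxM; first exact: congx_refl).
    exact: GN.
  exact: UN.
have FN : nonexpansive F.
  move=> N f g fg; apply: congxM; last first.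
    by apply: congxV; apply: congxW (UN _ _ _ fg).
  apply: congxM; first exact: fg.
  by move=> i j iN; apply: (MN N f g fg); rewrite addn1.
have eta0 z : congx 1 (eta z) e0%:A.
  rewrite -[X in congx _ _ X]addr0; apply: congxD; first exact: congx_refl.
  by rewrite -(mul0r z); apply: congxM; [exact: congx_Xn | exact: congx_refl].
have U0 z : congx 1 (U z) (H + e0 ^+ p.-1)%:A.
  rewrite scalerDl algXn; apply: congxD; last exact: congxX.
  by apply: congx_trans (E0 e0); apply: EN.
have G0 z : congx 1 (G z) (p%:R * e0 ^+ p.-1)%:A.
  have -> : (p%:R * e0 ^+ p.-1)%:A =
      \sum_(i < p) e0%:A ^+ (p.-1 - i) * e0%:A ^+ i :> fps K.
    rewrite algM -fps_natrE algXn (eq_bigr (fun=> e0%:A ^+ p.-1)) => [|i _].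
      by rewrite sumr_const card_ord mulr_natl.
    by rewrite -exprD subnK // -ltnS prednK.
  by apply: congx_sum => i _; apply: congxM; [exact: congxX | exact: congx_refl].
have e00 : e0 != 0.
  apply/eqP => e; move/eqP: e0p; rewrite e expr0n gtn_eqF // mulr0n.
  by rewrite eq_sym oner_eq0.
have lam : e0 * (H + e0 ^+ p.-1) = 1 + e0 * H.
  by rewrite mulrDr -exprS prednK // e0p addrC.
have aK : (a%:R : K) != 0 by rewrite pnatr_eq0 -lt0n.
(* This is the resonance relation: it makes the division by [t] possible. *)
have M0 z : congx 1 (M z) 0.
  have -> : 0 = - ((a * q)%:R * (p%:R * e0 ^+ p.-1)%:A
      + B%:R * (H + e0 ^+ p.-1)%:A) :> fps K.
    rewrite !fps_natrE -!algM -scalerDl -scaleNr.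
    suff -> : - ((a * q)%:R * (p%:R * e0 ^+ p.-1) + B%:R * (H + e0 ^+ p.-1)) = 0 :> K.
      by rewrite scale0r.
    apply: (mulfI e00); rewrite mulr0.
    have -> : e0 * - ((a * q)%:R * (p%:R * e0 ^+ p.-1) + B%:R * (H + e0 ^+ p.-1)) =
      - ((a * q)%:R * p%:R * (e0 * e0 ^+ p.-1) + B%:R * (e0 * (H + e0 ^+ p.-1))) by ring.
    rewrite lam -exprS prednK // e0p /B !natrM.
    rewrite -[RHS](mulr0 (- (p%:R * q%:R))) -res; ring.
  apply: congxN; apply: congxD; (apply: congxM; first exact: congx_refl).
    exact: G0.
  exact: U0.
have [z Hz] : exists z : nat -> fps K,
    forall k, congx 1 (z k) k%:R%:A /\ fps_dx (z k) = F (z k).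
  pose z k := projT1 (cid (formal_ode k%:R FN)).
  by exists z => l; rewrite /z; case: (cid _).
apply: (@cusp_family_dicritical p q a D B 0 (fun k => eta (z k))) => //; last first.
  exists 0 => l _; have [zl _] := Hz l.
  rewrite fcoefD fcoefA gtn_eqF // mulr0 add0r fcoefXnM leqnn subnn.
  by rewrite zl // fcoefA mulr1 add0r.
move=> l _; have [zl0 zl] := Hz l; rewrite -ED.
have Uu : U (z l) \is a GRing.unit.
  rewrite fps_unitE (U0 _ 0%N) // fcoefA mulr1.
  apply: contraNneq aK => e; move: res; rewrite -lam e mulr0 mulr0 add0r => ->.
  by [].
have -> : X * fps_dx (eta (z l)) = X ^+ B * (B%:R * z l + X * F (z l)).
  rewrite /eta dxD dxA add0r dxM dx_exp dxX zl mulr1.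
  have -> : X ^+ B = X * X ^+ B.-1 by rewrite -exprS prednK.
  ring.
have -> : eta (z l) ^+ p - 1 = X ^+ B * z l * G (z l).
  have -> : 1 = e0%:A ^+ p :> fps K by rewrite -algXn e0p scale1r.
  by rewrite subrXX -/(G (z l)); congr (_ * _); rewrite /eta; ring.
have -> : X * F (z l) = z l * M (z l) / U (z l).
  rewrite /F; have {2}-> : M (z l) = X * shiftx 1 (M (z l)).
    by apply: (@shiftxE _ 1) => i j i1; apply: M0.
  ring.
have -> : X ^+ (a * (p + q)) * (X ^+ (a * k) * E (eta (z l))) =
    X ^+ (a * p * q) * E (eta (z l)).
  rewrite mulrA -exprD; congr (X ^+ _ * _); rewrite /k.
  have : (p + q <= p * q)%N by nia.
  by move=> h; rewrite -mulnDr -mulnA; congr (a * _)%N; lia.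
have -> : X ^+ (a * p * q) * eta (z l) ^+ p.-1 + X ^+ (a * p * q) * E (eta (z l))
  = X ^+ (a * p * q) * U (z l) by rewrite /U; ring.
set A := X ^+ (a * p * q); set C := X ^+ B.
have -> : C * (B%:R * z l + z l * M (z l) / U (z l)) * (A * U (z l)) =
  C * A * z l * B%:R * U (z l) + C * A * z l * M (z l) * ((U (z l))^-1 * U (z l)).
  ring.
rewrite mulVr // mulr1 /M; ring.
Qed.

End Families.

(** * What non-dicriticity says about weights *)

Section NonDicritical.
Variable K : numClosedFieldType.
Implicit Types (f g h D : fps K) (w : Defs.form K).

Local Notation X := (fps_x K).
Local Notation Y := (fps_y K).

Definition heavy (m n : nat) h :=
  forall i j, (m * i + n * j < m * n)%N -> h i j = 0.

(** Up to the factor [y0 ^ m], the eigenvalue [y0 ^ m + h_0(x0, y0)] transverse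
    to the last divisor is not a negative rational number. *)
Definition nonresonant (m n : nat) h := forall x0 y0 : K,
  x0 != 0 -> y0 != 0 -> y0 ^+ m = x0 ^+ n -> forall a b, (0 < a)%N -> (0 < b)%N ->
  b%:R * (y0 ^+ m + quasi_part m n (m * n) h x0 y0) + a%:R * y0 ^+ m != 0.

Lemma quasi_part_XY m n k D (x0 y0 : K) : (0 < m)%N -> (0 < n)%N ->
  quasi_part m n (m + n + k) (X * Y * D) x0 y0 =
  x0 * y0 * quasi_part m n k D x0 y0.
Proof.
move=> m0 n0; rewrite /quasi_part -mulrA subst_XM subst_YM.
rewrite !xpartE; try exact: congx_AXn.
set S := subst _ _ D.
have -> : x0%:A * X ^+ m * (y0%:A * X ^+ n * S) = (x0 * y0)%:A * (X ^+ (m + n) * S).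
  by rewrite algM exprD; ring.
by rewrite fcoefAM fcoefXnM leq_addr addKn.
Qed.

Lemma quasi_part_scale m n k D (t e : K) : (0 < m)%N -> (0 < n)%N ->
  quasi_part m n k D (t ^+ m) (t ^+ n * e) = t ^+ k * quasi_part m n k D 1 e.
Proof.
move=> m0 n0; rewrite !quasi_partE // mulr_sumr; apply: eq_bigr => i _.
rewrite mulr_sumr; apply: eq_bigr => j _; case: eqP => [ek|_]; last by rewrite !mulr0.
have -> : t ^+ k = t ^+ (m * i + n * j) by rewrite ek.
by rewrite expr1n exprD !exprM exprMn; ring.
Qed.

(** A point [(x0, y0)] of [y^p = x^q] is brought to [x0 = 1] by the weighted
    homotheties, under which both terms of the eigenvalue are homogeneous. *)
Lemma non_dicritical_heavy p q D : (1 < p)%N -> (1 < q)%N ->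
  non_dicritical (cusp_form p q D) ->
  heavy p q (X * Y * D) /\ nonresonant p q (X * Y * D).
Proof.
move=> p1 q1 nd.
have p0 : (0 < p)%N by exact: ltnW.
have q0 : (0 < q)%N by exact: ltnW.
have lepq : (p + q <= p * q)%N by nia.
have D0 i j : (p * i + q * j < p * q - p - q)%N -> D i j = 0.
  move=> lt_ij; apply/eqP; apply: contrapT => /negP Dij.
  by apply: (low_weight_dicritical p1 q1 _ nd); exists i, j.
split=> [i j|x0 y0 x00 y00 e a b a0 b0].
  rewrite -mulrA fcoefXM; case: i => [//|i]; rewrite fcoefYM; case: j => [//|j] h.
  by apply: D0; lia.
apply/eqP => res.
pose t := p.-root x0; have et : t ^+ p = x0 by rewrite rootCK.
have t0 : t != 0 by apply: contraNneq x00 => t0; rewrite -et t0 expr0n gtn_eqF.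
pose e0 := y0 / t ^+ q; have ey : y0 = t ^+ q * e0.
  by rewrite mulrC divfK // expf_neq0.
have e0p : e0 ^+ p = 1.
  by rewrite expr_div_n e -et -!exprM mulnC divff // expf_neq0.
have qE : quasi_part p q (p * q) (X * Y * D) x0 y0 =
    t ^+ (p * q) * (e0 * quasi_part p q (p * q - p - q) D 1 e0).
  have epq : (p * q = p + q + (p * q - p - q))%N by lia.
  rewrite {1}epq quasi_part_XY // -et ey quasi_part_scale // et.
  by rewrite {3}epq !exprD et; ring.
have yE : y0 ^+ p = t ^+ (p * q) by rewrite ey exprMn e0p mulr1 -exprM mulnC.
apply: (resonant_dicritical p1 q1 a0 b0 D0 e0p _ nd).
by apply: (mulfI (expf_neq0 (p * q) t0)); rewrite mulr0 -[RHS]res qE yE; ring.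
Qed.

End NonDicritical.

(** * The intersection number with the cusp *)

Section ConvergentValues.
Variable K : numFieldType.
Implicit Types f g : cps K.

Lemma cps_valD f g : cps_val (f + g) = (f : fps K) + g.
Proof. first [reflexivity | exact: (raddfD (val : cps K -> fps K))]. Qed.
Lemma cps_valB f g : cps_val (f - g) = (f : fps K) - (g : fps K).
Proof. first [reflexivity | exact: (raddfB (val : cps K -> fps K))]. Qed.
Lemma cps_valM f g : cps_val (f * g) = (f : fps K) * g.
Proof. first [reflexivity | exact: (rmorphM (val : cps K -> fps K))]. Qed.
Lemma cps_valXn f n : cps_val (f ^+ n) = (f : fps K) ^+ n.
Proof. first [exact: (rmorphXn (val : cps K -> fps K))]. Qed.
Lemma cps_valZ c f : cps_val (c *: f) = c *: (f : fps K).
Proof. first [reflexivity | exact: (linearZ (val : cps K -> fps K))]. Qed.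
Lemma cps_val_sum (I : Type) (r : seq I) (P : pred I) (F : I -> cps K)  : cps_val (\sum_(i <- r | P i) F i) = \sum_(i <- r | P i) (F i : fps K).
Proof. exact: (raddf_sum (val : cps K -> fps K)). Qed.

End ConvergentValues.

Section Intersection.
Variable K : numClosedFieldType.
Implicit Types (f g h : fps K) (D : cps K).

Local Notation X := (fps_x K).
Local Notation Y := (fps_y K).

Definition cusp_series p q : fps K := Y ^+ p - X ^+ q.

Lemma cuspE p q : (cusp K p q : fps K) = cusp_series p q.
Proof. by rewrite /cusp cps_valB !cps_valXn. Qed.

Lemma fcoef_cuspM p q g i j : (cusp_series p q * g) i j =
  (if (p <= j)%N then g i (j - p)%N else 0) -
  (if (q <= i)%N then g (i - q)%N j else 0).
Proof. by rewrite mulrBl fcoefB fcoefXnM fcoefYnM. Qed.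

(** The coefficient of [x^i y^j] in the remainder of [g] by [y^p - x^q],
    obtained by replacing [y^p] by [x^q]. *)
Definition cusp_rem p q (i j : nat) g : K :=
  \sum_(m < i.+1) if (q * m <= i)%N then g (i - q * m)%N (j + p * m)%N else 0.

Lemma cusp_remD p q i j g h :
  cusp_rem p q i j (g + h) = cusp_rem p q i j g + cusp_rem p q i j h.
Proof.
rewrite /cusp_rem -big_split; apply: eq_bigr => m _ /=.
by case: ifP => _; rewrite ?fcoefD ?addr0.
Qed.

Lemma cusp_remZ p q i j c g :
  cusp_rem p q i j (c *: g) = c * cusp_rem p q i j g.
Proof.
rewrite /cusp_rem mulr_sumr; apply: eq_bigr => m _ /=.
by case: ifP => _; rewrite ?fcoefZ ?mulr0.
Qed.

Lemma cusp_rem_sum p q i j (I : Type) (r : seq I) (P : pred I) (F : I -> fps K) :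
  cusp_rem p q i j (\sum_(k <- r | P k) F k) =
  \sum_(k <- r | P k) cusp_rem p q i j (F k).
Proof.
elim/big_rec2: _ => [|k u v _ <-]; last by rewrite cusp_remD.
by rewrite /cusp_rem big1 // => m _; case: ifP.
Qed.

Lemma cusp_rem_cuspM p q i j g : (0 < q)%N -> (j < p)%N ->
  cusp_rem p q i j (cusp_series p q * g) = 0.
Proof.
move=> q0 jp.
pose S m := if (0 < m)%N && (q * m <= i)%N
  then g (i - q * m)%N (j + p * m.-1)%N else 0.
transitivity (\sum_(0 <= m < i.+1) - (S m.+1 - S m)).
  rewrite big_mkord; apply: eq_bigr => m _; rewrite opprB /S /=.
  case: (leqP (q * m) i) => h; last first.
    by rewrite andbF [(q * m.+1 <= i)%N](_ : _ = false) ?subr0 //; lia.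
  rewrite andbT fcoef_cuspM; congr (_ - _).
    case: (nat_of_ord m) => [|k]; first by rewrite muln0 addn0 leqNgt jp.
    rewrite [(p <= _)%N](_ : _ = true); last lia.
    by congr (g _ _); rewrite /=; lia.
  rewrite [(q <= _)%N](_ : _ = (q * m.+1 <= i)%N); last lia.
  by case: ifP => // _; congr (g _ _); lia.
rewrite sumrN telescope_sumr // /S /= [(q * i.+1 <= i)%N](_ : _ = false) ?subr0 ?oppr0 //.
nia.
Qed.

Lemma cusp_rem_low p q i j g : (j < p)%N ->
  (forall a b, (p <= b)%N -> g a b = 0) -> cusp_rem p q i j g = g i j.
Proof.
move=> jp gp; rewrite /cusp_rem big_ord_recl muln0 muln0 subn0 addn0 /=.
rewrite big1 ?addr0 // => m _; case: ifP => // _; rewrite gp //.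
rewrite /bump /=; nia.
Qed.

Section Staircase.
Variables (p : nat) (c : nat -> nat).

Definition staircase : finType := {j : 'I_p & 'I_(c j)}.
Definition xexp (s : staircase) : nat := tagged s.
Definition yexp (s : staircase) : nat := tag s.

Lemma card_staircase : #|{: staircase}| = (\sum_(j < p) c j)%N.
Proof.
rewrite card_tagged sumnE big_map big_enum /=.
by apply: eq_bigr => j _; rewrite card_ord.
Qed.

Lemma staircase_inj s t : xexp s = xexp t -> yexp s = yexp t -> s = t.
Proof.
case: s t => [j i] [j' i']; rewrite /xexp /yexp /= => ei /val_inj ej.
by subst j'; congr Tagged; apply: val_inj.
Qed.

Lemma staircase_ex i j : (j < p)%N -> (i < c j)%N ->
  exists s : staircase, xexp s = i /\ yexp s = j.
Proof.
move=> jp ic.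
by exists (@Tagged _ (Ordinal jp) (fun j : 'I_p => 'I_(c j)) (Ordinal ic)).
Qed.

Lemma fcoef_staircase_sum (a : staircase -> K) i j :
  (\sum_s a s *: (X ^+ xexp s * Y ^+ yexp s)) i j =
  \sum_(s | (xexp s == i) && (yexp s == j)) a s.
Proof.
rewrite fcoef_sum [RHS]big_mkcond; apply: eq_bigr => s _.
rewrite fcoefZ fcoefXnYn [(i == _)]eq_sym [(j == _)]eq_sym.
by case: ifP => _; rewrite ?mulr1 ?mulr0.
Qed.

Lemma fcoef_staircase_sum_at (a : staircase -> K) s :
  (\sum_s a s *: (X ^+ xexp s * Y ^+ yexp s)) (xexp s) (yexp s) = a s.
Proof.
rewrite fcoef_staircase_sum (bigD1 s) ?eqxx //= big1 ?addr0 // => t.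
by case/andP => /andP[/eqP ex /eqP ey] /eqP[]; apply: staircase_inj.
Qed.

Lemma yexp_lt s : (yexp s < p)%N. Proof. exact: ltn_ord. Qed.
Lemma xexp_lt s : (xexp s < c (yexp s))%N. Proof. exact: ltn_ord. Qed.

End Staircase.

(** The series modulo [y^p - x^q] have the basis [x^i y^j], [j < p].  The
    monomials of weight at least [p q] are sent by the multiplication by [D]
    to weights at least [2 p q - p - q], so that the quotient has at least as
    many dimensions as there are basis monomials in the second staircase below
    minus those in the first one. *)
Definition low_stair p q j := (q - q * j %/ p)%N.
Definition high_stair p q j := (2 * q - 1 - q * j.+1 %/ p)%N.

(** The integral parts telescope: the two sums of them are shifted by one. *)
Lemma sum_stairs p q : (0 < p)%N -> (0 < q)%N ->
  (\sum_(j < p) high_stair p q j = \sum_(j < p) low_stair p q j + p * q - p - q)%N.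
Proof.
move=> p0 q0.
have fl j : (j <= p)%N -> (q * j %/ p <= q)%N.
  by move=> jp; rewrite -[leqRHS](mulnK q p0); apply: leq_div2r; rewrite leq_mul2l jp orbT.
pose F := (\sum_(j < p) q * j %/ p)%N.
have eL : (\sum_(j < p) low_stair p q j + F = p * q)%N.
  rewrite /F -big_split /= (eq_bigr (fun=> q)) => [|j _].
    by rewrite sum_nat_const card_ord.
  by rewrite /low_stair subnK // fl // ltnW.
have eF : (\sum_(j < p) q * j.+1 %/ p = F + q)%N.
  have e : (\sum_(j < p.+1) q * j %/ p = F + q)%N.
    by rewrite big_ord_recr /= mulnK.
  by rewrite -e big_ord_recl muln0 div0n add0n; apply: eq_bigr => j _.
have eH : (\sum_(j < p) high_stair p q j + (F + q) = p * (2 * q - 1))%N.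
  rewrite -eF -big_split /= (eq_bigr (fun=> 2 * q - 1)%N) => [|j _].
    by rewrite sum_nat_const card_ord.
  rewrite /high_stair subnK //; have := fl j.+1 (ltn_ord j); lia.
have : (p * (2 * q - 1) + p = 2 * (p * q))%N by rewrite mulnBr muln1; nia.
lia.
Qed.

Lemma low_stair_weight p q i j : (0 < p)%N -> (low_stair p q j <= i)%N ->
  (p * q <= p * i + q * j)%N.
Proof.
rewrite /low_stair => p0 h; have := leq_trunc_div (q * j) p; nia.
Qed.

Lemma high_stair_weight p q i j : (0 < p)%N -> (i < high_stair p q j)%N ->
  (p * i + q * j < 2 * (p * q) - p - q)%N.
Proof.
rewrite /high_stair => p0 h.
have := divn_eq (q * j.+1) p; have := ltn_pmod (q * j.+1) p0.
set a := (_ %/ _)%N in h *; set b := (_ %% _)%N; move=> hb e.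
have : (i.+1 + a <= 2 * q - 1)%N by lia.
move=> h1; have : (p * (i.+1 + a) <= p * (2 * q - 1))%N by rewrite leq_mul2l h1 orbT.
rewrite mulnDr mulnBr muln1 !mulnS; nia.
Qed.

(** The remainders of the multiples of [D] span a space of dimension at most
    the size of the low staircase, and a basis of a complement of it among the
    remainders supported in the high one is independent modulo the ideal. *)
Lemma independent_mod p q D : (1 < p)%N -> (1 < q)%N ->
  heavy p q (X * Y * (D : fps K)) ->
  exists n (h : 'I_n -> cps K), (p * q - p - q <= n)%N /\
    forall a : 'I_n -> K, in_ideal2 D (cusp K p q) (\sum_(k < n) a k *: h k) ->
      forall k, a k = 0.
Proof.
move=> p1 q1 Dh.
have p0 : (0 < p)%N by exact: ltnW.
have q0 : (0 < q)%N by exact: ltnW.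
have D0 i j : (p * i + q * j < p * q - p - q)%N -> (D : fps K) i j = 0.
  by move=> h; have := @Dh i.+1 j.+1; rewrite -mulrA fcoefXM fcoefYM; apply; nia.
pose S := staircase p (low_stair p q); pose B := staircase p (high_stair p q).
pose mon i j : fps K := X ^+ i * Y ^+ j.
pose Phi (g : fps K) : 'rV[K]_#|{: B}| :=
  \row_k cusp_rem p q (xexp (enum_val k)) (yexp (enum_val k)) g.
have PhiD g h : Phi (g + h) = Phi g + Phi h.
  by apply/rowP => k; rewrite !mxE cusp_remD.
have PhiZ c g : Phi (c *: g) = c *: Phi g.
  by apply/rowP => k; rewrite !mxE cusp_remZ.
have Phi_sum (I : finType) (F : I -> fps K) : Phi (\sum_i F i) = \sum_i Phi (F i).
  apply/rowP => k; rewrite mxE cusp_rem_sum summxE.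
  by apply: eq_bigr => i _; rewrite mxE.
have Phi_cusp g : Phi (cusp_series p q * g) = 0.
  by apply/rowP => k; rewrite !mxE cusp_rem_cuspM // yexp_lt.
have Phi_heavy g h : (forall i j, (p * i + q * j < p * q)%N -> g i j = 0) ->
    (forall i j, (p * i + q * j < p * q - p - q)%N -> h i j = 0) ->
    Phi (g * h) = 0.
  move=> gh hh; apply/rowP => k; rewrite !mxE.
  have := high_stair_weight p0 (xexp_lt (enum_val k)).
  set i := xexp _; set j := yexp _ => lt_ij.
  rewrite /cusp_rem big1 // => m _; case: ifP => // le_m.
  rewrite fcoefM big1 // => a _; rewrite big1 // => b _.
  have [la lb] := (ltn_ord a, ltn_ord b).
  case: (ltnP (p * a + q * b) (p * q)) => hab; first by rewrite gh // mul0r.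
  rewrite [h _ _]hh ?mulr0 // !mulnBr; nia.
pose M := \matrix_(k < #|{: S}|) Phi (mon (xexp (enum_val k)) (yexp (enum_val k))
   * (D : fps K)).
have Phi_D (u : fps K) : (Phi (u * (D : fps K))%R <= M)%MS.
  have [||w [r [eu rp]]] := @weierstrass_division K p (cusp_series p q) u.
  - by rewrite fcoefB fcoefXn fcoefYn !eqxx (gtn_eqF p0) andbF subr0 oner_neq0.
  - move=> j jp; rewrite fcoefB fcoefXn fcoefYn (ltn_eqF jp) andbF.
    by rewrite [(0 == q)%N]ltn_eqF // subr0.
  pose r1 := \sum_(s : S) r (xexp s) (yexp s) *: mon (xexp s) (yexp s).
  have -> : u * (D : fps K) = cusp_series p q * (w * (D : fps K)) +
      (r - r1) * (D : fps K) + r1 * (D : fps K) by rewrite eu; ring.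
  rewrite !PhiD Phi_cusp add0r Phi_heavy ?add0r //; last first.
    move=> i j lt_ij; rewrite fcoefB; apply/eqP; rewrite subr_eq0; apply/eqP.
    case: (ltnP j p) => jp; last first.
      rewrite rp // /r1 fcoef_staircase_sum big1 // => s /andP[_ /eqP sj].
      by move: (yexp_lt s); rewrite sj ltnNge jp.
    have ic : (i < low_stair p q j)%N.
      by rewrite ltnNge; apply: contraTN lt_ij => h; rewrite -leqNgt low_stair_weight.
    have [s [<- <-]] := staircase_ex jp ic.
    by rewrite /r1 fcoef_staircase_sum_at.
  rewrite /r1 mulr_suml Phi_sum; apply: summx_sub => s _.
  rewrite -scalerAl PhiZ scalemx_sub //.
  have -> : Phi (mon (xexp s) (yexp s) * (D : fps K)) = row (enum_rank s) M.
    by rewrite rowK enum_rankK.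
  exact: row_sub.
pose C := row_base (M^C)%MS.
pose h (k : 'I_(\rank (M^C)%MS)) : cps K := \sum_(b : B)
   C k (enum_rank b) *: (cps_x K ^+ xexp b * cps_y K ^+ yexp b).
have hE k : (h k : fps K) = \sum_(b : B) C k (enum_rank b) *: mon (xexp b) (yexp b).
  rewrite /h cps_val_sum; apply: eq_bigr => b _.
  by rewrite cps_valZ cps_valM !cps_valXn.
have Phi_h k : Phi (h k) = row k C.
  apply/rowP => l; rewrite mxE [RHS]mxE cusp_rem_low ?yexp_lt // => [|a b pb].
    by rewrite hE fcoef_staircase_sum_at enum_valK.
  rewrite hE fcoef_staircase_sum big1 // => s /andP[_ /eqP sb].
  by move: (yexp_lt s); rewrite sb ltnNge pb.
exists (\rank (M^C)%MS), h; split=> [|a [u [v e]] k].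
  have := rank_leq_row M; rewrite mxrank_compl [leqRHS]card_staircase.
  set rM := \rank M; rewrite [#|_|]card_staircase sum_stairs //; lia.
pose A := \row_k a k.
suff : A *m C == 0.
  rewrite mulmx_free_eq0 ?row_base_free // => /eqP /rowP /(_ k).
  by rewrite !mxE.
rewrite -submx0 -(capmx_compl M) sub_capmx.
have -> : A *m C = Phi ((\sum_(k < \rank (M^C)%MS) a k *: h k : cps K) : fps K).
  rewrite cps_val_sum Phi_sum mulmx_sum_row; apply: eq_bigr => l _.
  by rewrite mxE cps_valZ PhiZ Phi_h.
apply/andP; split.
  rewrite e cps_valD !cps_valM cuspE [(v : fps K) * _]mulrC PhiD Phi_cusp addr0.
  exact: Phi_D.
rewrite cps_val_sum Phi_sum; apply: summx_sub => l _.
rewrite cps_valZ PhiZ scalemx_sub // Phi_h.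
by apply: (submx_trans (row_sub _ _)); rewrite eq_row_base.
Qed.

End Intersection.

(** * Separatrices at a resolved point *)

Section Local.
Variable K : numClosedFieldType.
Implicit Types (f g h A B D : fps K) (w : Defs.form K) (E : seq (fps K)).

Local Notation X := (fps_x K).
Local Notation Y := (fps_y K).

Lemma strip_eq (t : fps K) w w' k : t != 0 ->
  w = (t ^+ k * w'.1, t ^+ k * w'.2) ->
  ~ (divides t w'.1 /\ divides t w'.2) -> strip t w = w'.
Proof.
move=> t0 ew nd; rewrite /strip.
have key a b (u v : Defs.form K) : (a < b)%N ->
    (t ^+ a * u.1, t ^+ a * u.2) = (t ^+ b * v.1, t ^+ b * v.2) ->
    divides t u.1 /\ divides t u.2.
  move=> ab e; have e1 : t ^+ a * u.1 = t ^+ b * v.1 := congr1 fst e.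
  have e2 : t ^+ a * u.2 = t ^+ b * v.2 := congr1 snd e; have tb : t ^+ b = t ^+ a * (t * t ^+ (b - a).-1).
    by rewrite -exprS -exprD prednK ?subn_gt0 // subnKC // ltnW.
  split.
    exists (t ^+ (b - a).-1 * v.1); apply: (mulfI (expf_neq0 a t0)).
    by rewrite e1 tb; ring.
  exists (t ^+ (b - a).-1 * v.2); apply: (mulfI (expf_neq0 a t0)).
  by rewrite e2 tb; ring.
set P := (fun w'' : Defs.form K => _).
have [|l [el nl]] := @classical_sets.xgetPex _ w P; first by exists w'; exists k.
set v := classical_sets.xget w P in el nl *.
have e : (t ^+ k * w'.1, t ^+ k * w'.2) = (t ^+ l * v.1, t ^+ l * v.2).
  by rewrite -ew.
case: (ltngtP k l) => kl.
- by case: nd; apply: key kl e.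
- by case: nl; apply: key kl (esym e).
rewrite kl in e.
have e1 := mulfI (expf_neq0 l t0) (congr1 fst e : t ^+ l * w'.1 = t ^+ l * v.1).
have e2 := mulfI (expf_neq0 l t0) (congr1 snd e : t ^+ l * w'.2 = t ^+ l * v.2).
by rewrite (surjective_pairing v) (surjective_pairing w') e1 e2.
Qed.

Lemma fcoefM_row0 f g b : (forall l, (l < b)%N -> f 0%N l = 0) ->
  (f * g) 0%N b = f 0%N b * g 0%N 0%N.
Proof.
move=> fb; rewrite fcoefM big_ord1 big_ord_recr /= big1 ?add0r ?subnn //.
by move=> l _; rewrite fb // mul0r.
Qed.

Lemma fcoefM_col0 f g a : (forall k, (k < a)%N -> f k 0%N = 0) ->
  (f * g) a 0%N = f a 0%N * g 0%N 0%N.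
Proof.
move=> fa; rewrite fcoefM big_ord_recr /= big_ord1 subnn big1 ?add0r //.
by move=> k _; rewrite big_ord1 fa // mul0r.
Qed.

Lemma row0_order f : irreducible f -> ~ divides X f ->
  exists b, f 0%N b.+1 != 0 /\ forall l, (l < b.+1)%N -> f 0%N l = 0.
Proof.
move=> [_ nuf _] nX.
have ex : exists b, f 0%N b != 0.
  apply: contrapT => nex; apply: nX; apply/divX => j; apply/eqP.
  by apply: contrapT => /negP fj; apply: nex; exists j.
case: (ex_minnP ex) => -[|b] fb bmin; first by case: nuf; apply/invertibleE.
exists b; split=> // l lb; apply/eqP; apply: contraTT lb => fl.
by rewrite -leqNgt bmin.
Qed.

Lemma col0_order f : irreducible f -> ~ divides Y f ->
  exists a, f a.+1 0%N != 0 /\ forall l, (l < a.+1)%N -> f l 0%N = 0.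
Proof.
move=> [_ nuf _] nY.
have ex : exists b, f b 0%N != 0.
  apply: contrapT => nex; apply: nY; apply/divY => j; apply/eqP.
  by apply: contrapT => /negP fj; apply: nex; exists j.
case: (ex_minnP ex) => -[|b] fb bmin; first by case: nuf; apply/invertibleE.
exists b; split=> // l lb; apply/eqP; apply: contraTT lb => fl.
by rewrite -leqNgt bmin.
Qed.

Lemma not_invertible00 f : f 0%N 0%N = 0 -> ~ invertible f.
Proof. by move=> f0 /invertibleE; rewrite f0 eqxx. Qed.

Lemma irreducible_divides f g :
  irreducible f -> divides g f -> ~ invertible g -> associated g f.
Proof.
move=> [_ _ firr] [c e] ng; case: (firr _ _ e) => // uc.
by exists c; rewrite // e mulrC.
Qed.

Lemma coef00X : X 0%N 0%N = 0. Proof. by []. Qed.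
Lemma coef00Y : Y 0%N 0%N = 0. Proof. by []. Qed.

(** Let [b] be the order on [x = 0] of a leaf other than this line: on it the
    right-hand side of the invariance equation has order at least [b], and the
    left-hand side has order [b - 1]. *)
Lemma regular_separatrix_x w f : w.1 0%N 0%N != 0 -> divides X w.2 ->
  separatrix w f -> associated X f.
Proof.
move=> A0 [c ec] [firr [g eg]]; case: (pselect (divides X f)) => [dX|nX].
  by apply: irreducible_divides => //; apply: not_invertible00.
have [b [fb fl]] := row0_order firr nX.
have := congr1 (fun u : fps K => u 0%N b) eg; rewrite fcoefB ec.
rewrite -mulrA fcoefXM subr0 mulrC !fcoefM_row0; last 2 first.
- by move=> l lb; rewrite fl // ltnS ltnW.
- by move=> l lb; rewrite fcoef_dy fl ?mul0rn.
rewrite fcoef_dy (fl b (ltnSn b)) mul0r => /eqP.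
by rewrite -mulr_natr !mulf_eq0 (negPf fb) (negPf A0) pnatr_eq0.
Qed.

Lemma regular_separatrix_y w f : w.2 0%N 0%N != 0 -> divides Y w.1 ->
  separatrix w f -> associated Y f.
Proof.
move=> B0 [c ec] [firr [g eg]]; case: (pselect (divides Y f)) => [dY|nY].
  by apply: irreducible_divides => //; apply: not_invertible00.
have [b [fb fl]] := col0_order firr nY.
have := congr1 (fun u : fps K => u b 0%N) eg; rewrite fcoefB ec.
rewrite -mulrA fcoefYM sub0r mulrC !fcoefM_col0; last 2 first.
- by move=> l lb; rewrite fl // ltnS ltnW.
- by move=> l lb; rewrite fcoef_dx fl ?mul0rn.
rewrite fcoef_dx (fl b (ltnSn b)) mul0r => /eqP.
by rewrite oppr_eq0 -mulr_natr !mulf_eq0 (negPf fb) (negPf B0) pnatr_eq0.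
Qed.

(** The lowest terms on each axis of an invariant curve that is not an axis
    give its cofactor two values at the origin, [(b + 1) A(0)] and
    [- (a + 1) B(0)]. *)
Lemma axes_separatrix A B f :
  (forall a b, (0 < a)%N -> (0 < b)%N ->
     b%:R * A 0%N 0%N + a%:R * B 0%N 0%N != 0) ->
  separatrix (Y * A, X * B) f -> associated X f \/ associated Y f.
Proof.
move=> nr [firr [g eg]].
case: (pselect (divides X f)) => [dX|nX].
  by left; apply: irreducible_divides => //; apply: not_invertible00.
case: (pselect (divides Y f)) => [dY|nY].
  by right; apply: irreducible_divides => //; apply: not_invertible00.
have [b [fb fbl]] := row0_order firr nX.
have [a [fa fal]] := col0_order firr nY.
have := congr1 (fun u : fps K => u 0%N b.+1) eg; rewrite fcoefB /=.
rewrite -!mulrA fcoefXM subr0 fcoefYM mulrC !fcoefM_row0 //; last first.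
  by move=> l lb; rewrite fcoef_dy fbl ?mul0rn.
rewrite fcoef_dy -mulr_natr -mulrA => /(mulfI fb) eA.
have := congr1 (fun u : fps K => u a.+1 0%N) eg; rewrite fcoefB /=.
rewrite -!mulrA fcoefYM sub0r fcoefXM mulrC !fcoefM_col0 //; last first.
  by move=> l lb; rewrite fcoef_dx fal ?mul0rn.
rewrite fcoef_dx -mulr_natr -mulrA -mulrN => /(mulfI fa) eB.
have := nr a.+1 b.+1 isT isT; rewrite eA -eB addrC subrr.
by rewrite eqxx.
Qed.

Lemma associated_sym f g : associated f g -> associated g f.
Proof.
move=> [u [v uv] e]; exists v; first by exists u; rewrite mulrC.
by rewrite e mulrA [v * u]mulrC uv mul1r.
Qed.

Lemma associated_trans f g h :
  associated f g -> associated g h -> associated f h.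
Proof.
move=> [u [u' eu] ->] [v [v' ev] ->]; exists (v * u); last by rewrite mulrA.
by exists (u' * v'); rewrite -[1]mul1r -{1}eu -ev; ring.
Qed.

Lemma associated_coef10 f g : f 0%N 0%N = 0 -> associated f g ->
  exists2 c : K, c != 0 & g 1%N 0%N = c * f 1%N 0%N /\ g 0%N 1%N = c * f 0%N 1%N.
Proof.
move=> f0 [u /invertibleE u0 ->]; exists (u 0%N 0%N) => //.
split; rewrite mulrC [RHS]mulrC.
  by rewrite fcoefM_col0 // => -[].
by rewrite fcoefM_row0 // => -[].
Qed.

Definition settled (s : Defs.form K * seq (fps K)) :=
  resolved s /\ ~ tangent_saddle_node s.

Lemma settled_regular_x w : w.1 0%N 0%N != 0 -> divides X w.2 -> settled (w, [:: X]).
Proof.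
move=> A0 dX; have nsing : ~ singular w by case=> /eqP; rewrite (negPf A0).
have noproper f : ~ proper_separatrix w [:: X] f.
  case=> sep; apply; exists X; first by rewrite inE.
  exact: regular_separatrix_x sep.
split; last by case=> -[].
by split=> [//|f /noproper|f g /noproper].
Qed.

Lemma settled_regular_y w : w.2 0%N 0%N != 0 -> divides Y w.1 -> settled (w, [:: Y]).
Proof.
move=> B0 dY; have nsing : ~ singular w by case=> _ /eqP; rewrite (negPf B0).
have noproper f : ~ proper_separatrix w [:: Y] f.
  case=> sep; apply; exists Y; first by rewrite inE.
  exact: regular_separatrix_y sep.
split; last by case=> -[].
by split=> [//|f /noproper|f g /noproper].
Qed.

Lemma linear_part_axes A B : linear_part (Y * A, X * B) =
  \matrix_(i < 2, j < 2) (if i == j then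
    if i == 0 then B 0%N 0%N else - A 0%N 0%N else 0).
Proof.
apply/matrixP => i j; rewrite !mxE /=.
case: i j => [[|[|//]] ?] [[|[|//]] ?]; rewrite -!val_eqE /=;
  by rewrite ?fcoefN ?fcoefXM ?fcoefYM ?oppr0.
Qed.

Lemma axes_char_poly A B :
  eigenvalues (Y * A, X * B) (B 0%N 0%N) (- A 0%N 0%N).
Proof.
rewrite /eigenvalues linear_part_axes char_poly_trig.
  by rewrite big_ord_recl big_ord1 !mxE /=.
apply/is_trig_mxP => i j ij; rewrite mxE.
by case: eqP ij => // ->; rewrite ltnn.
Qed.

(** Germs [y A dx + x B dy] with non-resonant eigenvalues: at a corner, or at
    a point of the divisor [x = 0] only. *)
Lemma settled_axes A B E : A 0%N 0%N != 0 ->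
  (forall a b, (0 < a)%N -> (0 < b)%N ->
     b%:R * A 0%N 0%N + a%:R * B 0%N 0%N != 0) ->
  [\/ E = [:: X], B 0%N 0%N != 0 /\ E = [:: X; Y] |
      B 0%N 0%N != 0 /\ E = [:: Y; X]] ->
  settled ((Y * A, X * B), E).
Proof.
move=> A0 nr hE; set w := (Y * A, X * B).
have XE : X \in E by case: hE => [->|[_ ->]|[_ ->]]; rewrite !inE ?eqxx ?orbT.
have proper_y f : proper_separatrix w E f -> associated Y f /\ E = [:: X].
  move=> [sep nE]; have [fX|fY] := axes_separatrix nr sep.
    by case: nE; exists X.
  split=> //; case: hE => // -[_ eE]; case: nE; exists Y => //;
    by rewrite eE !inE ?eqxx ?orbT.
split; last first.
  move=> [_ [e eE [_ _ [v [v0 lv tv]]]]]; apply: v0.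
  move: lv tv; rewrite linear_part_axes => /matrixP lv tv.
  have := lv 0 0; have := lv 1 0; rewrite !mxE !big_ord_recl !big_ord0 !mxE /=.
  have -> : lift ord0 ord0 = 1 :> 'I_2 by apply: val_inj.
  have -> : ord0 = 0 :> 'I_2 by apply: val_inj.
  rewrite !mul0r !addr0 add0r => /eqP; rewrite mulf_eq0 oppr_eq0 (negPf A0).
  move=> /eqP v1 /eqP Bv.
  have v00 : v 0 0 = 0.
    have [B0|B0] := eqVneq (B 0%N 0%N) 0; last first.
      by move: Bv; rewrite mulf_eq0 (negPf B0) => /eqP.
    have e1 : E = [:: X] by case: hE => // -[]; rewrite B0 eqxx.
    move: tv eE; rewrite e1 inE => tv /eqP eX; move: tv.
    by rewrite /tangent_to eX /= mul1r mul0r addr0.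
  apply/colP => -[[|[|//]] lt_i]; rewrite mxE.
    by rewrite -[RHS]v00; congr (v _ _); apply: val_inj.
  by rewrite -[RHS]v1; congr (v _ _); apply: val_inj.
split.
- move=> _; exists (B 0%N 0%N), (- A 0%N 0%N); split.
  + exact: axes_char_poly.
  + by case=> _ /eqP; rewrite oppr_eq0 (negPf A0).
  have [B0|B0] := eqVneq (B 0%N 0%N) 0; first by right; rewrite B0 mul0r.
  left; split.
    by apply/eqP; rewrite mulf_neq0 // oppr_eq0.
  move=> [x x0 ex].
  have [a a0 [b b0 ab]] : exists2 a, (0 < a)%N & exists2 b, (0 < b)%N &
      x = a%:R / b%:R.
    exists `|numq x|%N; first by rewrite absz_gt0 numq_eq0 gt_eqF.
    exists `|denq x|%N; first by rewrite absz_gt0 denq_eq0.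
    rewrite -{1}[x]divq_num_den; congr (_ / _).
      by rewrite natr_absz gtr0_norm // numq_gt0.
    by rewrite natr_absz gtr0_norm // denq_gt0.
  have bK : (b%:R : K) != 0 by rewrite pnatr_eq0 -lt0n.
  case/eqP: (nr b a b0 a0).
  have -> : B 0%N 0%N = - A 0%N 0%N * (a%:R / b%:R).
    rewrite -[B _ _](divfK (_ : - A 0%N 0%N != 0)) ?oppr_eq0 // ex ab.
    by rewrite fmorph_div !rmorph_nat mulrC.
  by field.
- move=> f /proper_y[fY eE].
  have [c c0 [f1 f2]] := associated_coef10 coef00Y fY.
  have [u _ ef] := fY.
  split; rewrite ?eE //.
    split; first by rewrite ef fcoef00M coef00Y mulr0.
    by right; rewrite f2 /= mulr1; apply/eqP.
  move=> e; rewrite inE => /eqP ->; rewrite /transverse f1 f2 /= mulr1 !mulr0 sub0r.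
  by rewrite mulr1; apply/eqP; rewrite oppr_eq0.
- move=> f g /proper_y[fY _] /proper_y[gY _].
  by apply: associated_trans gY; apply: associated_sym.
Qed.

End Local.

(** * Branches of the cusp, and the germs met along the Euclidean algorithm *)

Section Branches.
Variable K : numClosedFieldType.
Implicit Types (f g h A B D : fps K) (w : Defs.form K) (E : seq (fps K)).

Local Notation X := (fps_x K).
Local Notation Y := (fps_y K).

Definition branch (a b : nat) (z : K) : fps K := Y ^+ a - z%:A * X ^+ b.

Lemma fcoef_branch a b z i j : (branch a b z) i j =
  ((i == 0%N) && (j == a))%:R - z * ((i == b) && (j == 0%N))%:R.
Proof. by rewrite fcoefB fcoefAM fcoefXn fcoefYn. Qed.

Lemma branch_x_only (c : K) b : x_only (c%:A * X ^+ b).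
Proof. by move=> i [|j] // _; rewrite fcoefAM fcoefXn andbF mulr0. Qed.

(** As [a] and [b] are coprime, a monomial [y^j] with [j < a] is the only one of
    its weight.  Hence the generator of the ideal of the curve [x = t^a],
    [y = c t^b] has order at least [a] on [x = 0], as the branch has. *)
Lemma branch_kernel a b (c : K) : (0 < a)%N -> (0 < b)%N -> coprime a b ->
  c != 0 -> irreducible (branch a b (c ^+ a)) /\
  forall h, subst (X ^+ a) (c%:A * X ^+ b) h = 0 ->
    divides (branch a b (c ^+ a)) h.
Proof.
move=> a0 b0 ab c0; have Q0 := congx_AXn c b0.
have [f [_ [firr fker _ _]]] := principal_kernel a0 Q0 (@branch_x_only c b).
have low j : (j < a)%N -> f 0%N j = 0.
  move=> ja; have /fker f0 : divides f f by exists 1; rewrite mulr1.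
  have := congr1 (fun u : fps K => u (b * j)%N 0%N) f0.
  have -> : subst (X ^+ a) = subst (1%:A * X ^+ a) by rewrite scale1r mul1r.
  rewrite fcoef0.
  rewrite (@fcoef_subst _ _ _ _ _ _ (b * j).+1 (b * j).+1) //.
  have jb : (j < (b * j).+1)%N by rewrite ltnS leq_pmull.
  rewrite big_ord_recl [X in _ + X]big1 ?addr0 => [|i _]; last first.
    rewrite big1 // => k _; rewrite subst_mono_AXn // fcoefAM fcoefXn andbT.
    case: eqP => [e|_]; last by rewrite !mulr0.
    have : (b %| a * (lift ord0 i : nat))%N.
      by rewrite -(dvdn_addl _ (dvdn_mulr k (dvdnn b))) -e dvdn_mulr.
    rewrite Gauss_dvdr 1?coprime_sym // => /dvdnP[s es].
    have s0 : (0 < s)%N by case: s es.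
    have : (b * a <= b * j)%N.
      by rewrite e es mulnA [(b * a)%N]mulnC; apply: (leq_trans _ (leq_addr _ _));
        rewrite mulnAC leq_pmulr.
    by rewrite leq_pmul2l // leqNgt ja.
  rewrite (bigD1 (Ordinal jb)) //= big1 ?addr0 => [|k kj]; last first.
    rewrite subst_mono_AXn // fcoefAM fcoefXn andbT muln0 add0n eqn_pmul2l //.
    by move: kj; rewrite -val_eqE /= eq_sym => /negPf->; rewrite !mulr0.
  rewrite subst_mono_AXn // fcoefAM fcoefXn muln0 add0n !eqxx mulr1 => /eqP.
  by rewrite mulf_eq0 expr0 mul1r expf_eq0 (negPf c0) andbF orbF => /eqP.
have [u eu] : divides f (branch a b (c ^+ a)).
  apply/fker; rewrite /branch rmorphB rmorphM !rmorphXn /= substA.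
  rewrite (subst_x _ (congx_Xn K a0)) (subst_y _ Q0) exprMn -algXn.
  by rewrite -!exprM mulnC subrr.
have u0 : u 0%N 0%N != 0.
  have := congr1 (fun v : fps K => v 0%N a) eu.
  rewrite fcoefM_row0 // fcoef_branch !eqxx (gtn_eqF a0) andbF mulr0 subr0 => e.
  by apply/eqP => u0; move/eqP: e; rewrite u0 mulr0 oner_eq0.
have [v uv] := coef00_invertible u0.
have ef : f = branch a b (c ^+ a) * v by rewrite eu -mulrA uv mulr1.
have [f0 nuf irr] := firr.
split; last first.
  by move=> h /fker[k ->]; exists (v * k); rewrite ef mulrA.
split.
- by move=> e; apply: f0; rewrite ef e mul0r.
- move=> [k]; rewrite eu -mulrA => e; apply: nuf; by exists (u * k).
- move=> g h e; have : f = g * (h * v) by rewrite ef e mulrA.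
  case/irr; first by left.
  move=> [k ek]; right; exists (v * k); by rewrite mulrA.
Qed.

Lemma branch_irreducible a b (z : K) : (0 < a)%N -> (0 < b)%N -> coprime a b ->
  z != 0 -> irreducible (branch a b z).
Proof.
move=> a0 b0 ab z0; have <- : a.-root z ^+ a = z by rewrite rootCK.
apply: (branch_kernel a0 b0 ab _).1.
by apply: contraNneq z0 => e; rewrite -[z](rootCK a0) e expr0n gtn_eqF.
Qed.

Lemma prime_x f g : divides X (f * g) -> divides X f \/ divides X g.
Proof.
have key u : divides X u <-> subst 0 X u = 0.
  rewrite divX; split=> [H|H j].
    by apply: fpsP => i j; rewrite fcoef_subst_restrict_y H; case: eqP.
  by rewrite -[RHS](fcoef0 K j 0%N) -H fcoef_subst_restrict_y.
rewrite !key rmorphM => /eqP; rewrite mulf_eq0.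
by case/orP=> /eqP; [left | right].
Qed.

Lemma prime_y f g : divides Y (f * g) -> divides Y f \/ divides Y g.
Proof.
have key u : divides Y u <-> restrict_x u = 0.
  rewrite divY; split=> [H|H i].
    by apply: fpsP => i j; rewrite fcoef_restrict_x H; case: eqP.
  by rewrite -[RHS](fcoef0 K i 0%N) -H fcoef_restrict_x.
rewrite !key restrict_xM => /eqP; rewrite mulf_eq0.
by case/orP=> /eqP; [left | right].
Qed.

Lemma branch_not_x a b z : (0 < a)%N -> ~ divides X (branch a b z).
Proof.
move=> a0 /divX /(_ a) /eqP; rewrite fcoef_branch !eqxx (gtn_eqF a0) andbF.
by rewrite mulr0 subr0 oner_eq0.
Qed.

Lemma branch_not_y a b z : (0 < a)%N -> (0 < b)%N -> z != 0 ->
  ~ divides Y (branch a b z).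
Proof.
move=> a0 b0 z0 /divY /(_ b) /eqP; rewrite fcoef_branch !eqxx (gtn_eqF b0).
by rewrite sub0r mulr1 oppr_eq0 (negPf z0).
Qed.

Lemma branch_associated a b z z' : (0 < a)%N -> (0 < b)%N ->
  associated (branch a b z) (branch a b z') -> z = z'.
Proof.
move=> a0 b0 [u _ e].
have := congr1 (fun v : fps K => v 0%N a) e.
rewrite mulrC fcoefM_row0 => [|l la]; last first.
  by rewrite fcoef_branch (ltn_eqF la) andbF (ltn_eqF b0) mulr0 subrr.
rewrite !fcoef_branch !eqxx (gtn_eqF a0) andbF !mulr0 !subr0 mul1r => eu.
have := congr1 (fun v : fps K => v b 0%N) e.
rewrite mulrC fcoefM_col0 => [|l lb]; last first.
  by rewrite fcoef_branch (ltn_eqF lb) (ltn_eqF a0) andbF mulr0 subrr.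
rewrite !fcoef_branch !eqxx (gtn_eqF b0) !sub0r !mulr1 -eu mulr1.
by move/oppr_inj.
Qed.

Lemma nontrivial_root_of_unity d : (1 < d)%N ->
  exists2 z : K, z != 1 & z ^+ d = 1.
Proof.
move=> d1; pose P : {poly K} := \poly_(i < d) 1.
have szP : size P = d by rewrite size_poly_eq // oner_neq0.
have [z /eqP Pz] : exists z, root P z.
  by apply/closed_rootP; rewrite szP gtn_eqF.
have ez : \sum_(i < d) z ^+ i = 0.
  rewrite -[RHS]Pz /P horner_poly; apply: eq_bigr => i _; by rewrite mul1r.
exists z; last by apply/eqP; rewrite -subr_eq0 subrX1 ez mulr0.
apply/eqP => z1; move/eqP: ez; rewrite z1 (eq_bigr (fun=> 1)) => [|i _].
  by rewrite sumr_const card_ord pnatr_eq0 gtn_eqF // ltnW.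
by rewrite expr1n.
Qed.

(** The transforms of [d(y^p - x^q) + D (p x dy - q y dx)] along the Euclidean
    algorithm, up to the powers of [x] and [y] they are stripped of: with
    [f = y^m - x^n], the logarithmic form
    [f d log(x^r y^s) + m y^m d log y - n x^n d log x
     + x y D (m d log y - n d log x)]
    multiplied by the equation of the divisor. *)
Definition euclid_form (m n r s : nat) D : Defs.form K :=
  (Y ^+ (0 < s) * (if r == 0%N then - (n%:R * (X ^+ n.-1 + Y * D))
     else r%:R * Y ^+ m - (r + n)%:R * X ^+ n - n%:R * (X * Y * D)),
   X ^+ (0 < r) * (if s == 0%N then m%:R * (Y ^+ m.-1 + X * D)
     else (s + m)%:R * Y ^+ m - s%:R * X ^+ n + m%:R * (X * Y * D))).

(** The coefficients of [d log x] and of [d log y] in that form,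
    with [h] for [x y D]. *)
Definition log_x (m n r : nat) h : fps K :=
  r%:R * Y ^+ m - (r + n)%:R * X ^+ n - n%:R * h.
Definition log_y (m n s : nat) h : fps K :=
  (s + m)%:R * Y ^+ m - s%:R * X ^+ n + m%:R * h.

Lemma euclid_formE m n r s D : (0 < m)%N -> (0 < n)%N ->
  X ^+ (r == 0%N) * Y ^+ (s == 0%N) * (euclid_form m n r s D).1 =
    Y * log_x m n r (X * Y * D) /\
  X ^+ (r == 0%N) * Y ^+ (s == 0%N) * (euclid_form m n r s D).2 =
    X * log_y m n s (X * Y * D).
Proof.
move=> m0 n0; rewrite /euclid_form /log_x /log_y.
have Xn : X ^+ n = X * X ^+ n.-1 by rewrite -exprS prednK.
have Ym : Y ^+ m = Y * Y ^+ m.-1 by rewrite -exprS prednK.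
case: r s => [|r] [|s] /=; rewrite !(expr0, expr1, add0n); split;
  rewrite ?Xn ?Ym; ring.
Qed.

Lemma euclid_form0 m n D : euclid_form m n 0 0 D = cusp_form m n D.
Proof. by rewrite /euclid_form /cusp_form /= !expr0 !mul1r. Qed.

Definition divisor_at (r s : nat) E := [/\ (X \in E) = (0 < r)%N,
  (Y \in E) = (0 < s)%N & forall e, e \in E -> e = X \/ e = Y].

Lemma fps_x_neq_y : X != Y.
Proof.
apply/eqP => /(congr1 (fun f : fps K => f 1 0)%N) /eqP.
by rewrite /= oner_eq0.
Qed.

(** The powers of [x] and [y] cleared from the logarithmic form are prime to
    the branch, and the rest of the form vanishes on [y^a = z x^b]. *)
Lemma branch_invariant a b d z r s D : (0 < a)%N -> (0 < b)%N -> (0 < d)%N ->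
  z != 0 -> z ^+ d = 1 ->
  invariant_curve (euclid_form (d * a) (d * b) r s D) (branch a b z).
Proof.
move=> a0 b0 d0 z0 zd; set w := euclid_form _ _ _ _ _; set g := branch a b z.
have m0 : (0 < d * a)%N by rewrite muln_gt0 d0.
have n0 : (0 < d * b)%N by rewrite muln_gt0 d0.
have [] := euclid_formE r s D m0 n0; rewrite -/w => e1 e2.
set u := w.1 * fps_dy g - w.2 * fps_dx g.
have Yg : Y * fps_dy g = a%:R * Y ^+ a.
  rewrite /g /branch dyD dyN dyM dyA !dy_exp dyX dyY.
  have -> : Y ^+ a = Y * Y ^+ a.-1 by rewrite -exprS prednK.
  ring.
have Xg : X * fps_dx g = - (b%:R * z%:A * X ^+ b).
  rewrite /g /branch dxD dxN dxM dxA !dx_exp dxX dxY.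
  have -> : X ^+ b = X * X ^+ b.-1 by rewrite -exprS prednK.
  ring.
have : divides g (X ^+ (r == 0%N) * Y ^+ (s == 0%N) * u).
  have -> : X ^+ (r == 0%N) * Y ^+ (s == 0%N) * u =
    log_x (d * a) (d * b) r (X * Y * D) * (Y * fps_dy g) -
    log_y (d * a) (d * b) s (X * Y * D) * (X * fps_dx g).
    transitivity (X ^+ (r == 0%N) * Y ^+ (s == 0%N) * w.1 * fps_dy g -
      X ^+ (r == 0%N) * Y ^+ (s == 0%N) * w.2 * fps_dx g); first by rewrite /u; ring.
    by rewrite e1 e2; ring.
  rewrite Yg Xg /log_x /log_y.
  set T := \sum_(i < d) (Y ^+ a) ^+ (d.-1 - i) * (z%:A * X ^+ b) ^+ i.
  have eT : Y ^+ (d * a) = X ^+ (d * b) + g * T.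
    rewrite /g /branch -subrXX exprMn -algXn zd scale1r mul1r.
    by rewrite -!exprM [(a * d)%N]mulnC [(b * d)%N]mulnC; ring.
  exists (- (d%:R * a%:R * b%:R) * X ^+ (d * b) +
    T * (a%:R * r%:R * Y ^+ a + b%:R * (s + d * a)%:R * (z%:A * X ^+ b)) -
    d%:R * a%:R * b%:R * (X * Y * D)).
  rewrite eT !natrD !natrM; rewrite /g /branch; ring.
have cancel_x k v : divides g (X ^+ k * v) -> divides g v.
  elim: k v => [|k IH] v; first by rewrite expr0 mul1r.
  rewrite exprSr -mulrA => /IH [c e].
  have [/(branch_not_x a0) //|[c' ec]] : divides X g \/ divides X c.
    by apply: prime_x; exists v.
  by exists c'; apply: (@mulXI K); rewrite e ec; ring.
have cancel_y k v : divides g (Y ^+ k * v) -> divides g v.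
  elim: k v => [|k IH] v; first by rewrite expr0 mul1r.
  rewrite exprSr -mulrA => /IH [c e].
  have [/(branch_not_y a0 b0 z0) //|[c' ec]] : divides Y g \/ divides Y c.
    by apply: prime_y; exists v.
  by exists c'; apply: (@mulYI K); rewrite e ec; ring.
by rewrite -mulrA => /cancel_x /cancel_y.
Qed.

(** The branches of [y^m = x^n] are separatrices; they are in the position
    asked for only when there is one, smooth, at a point of a single
    component that it crosses. *)
Lemma euclid_not_resolved m n r s D E : (0 < m)%N -> (0 < n)%N ->
  (0 < s)%N || (1 < m)%N -> (0 < r)%N || (1 < n)%N -> divisor_at r s E ->
  ~ resolved (euclid_form m n r s D, E).
Proof.
move=> m0 n0 sm rn [XE YE EXY] [_ H2 H3].
pose d := gcdn m n; have d0 : (0 < d)%N by rewrite gcdn_gt0 m0.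
pose a := (m %/ d)%N; pose b := (n %/ d)%N.
have em : m = (d * a)%N by rewrite mulnC divnK // dvdn_gcdl.
have en : n = (d * b)%N by rewrite mulnC divnK // dvdn_gcdr.
have a0 : (0 < a)%N by move: m0; rewrite {1}em muln_gt0 => /andP[].
have b0 : (0 < b)%N by move: n0; rewrite {1}en muln_gt0 => /andP[].
have ab : coprime a b.
  by rewrite /coprime -(eqn_pmul2l d0) muln1 muln_gcdr -em -en.
have sep z : z != 0 -> z ^+ d = 1 ->
    proper_separatrix (euclid_form m n r s D) E (branch a b z).
  move=> z0 zd; split.
    split; first exact: branch_irreducible.
    by rewrite em en; apply: branch_invariant.
  move=> [e eE [u _ eu]]; case: (EXY e eE) => ee; rewrite ee in eu.
    by apply: (@branch_not_x a b z a0); exists u; rewrite eu mulrC.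
  by apply: (branch_not_y a0 b0 z0); exists u; rewrite eu mulrC.
have sep1 : proper_separatrix (euclid_form m n r s D) E (branch a b 1).
  by apply: sep; rewrite ?oner_neq0 ?expr1n.
have d1 : d = 1%N.
  apply/eqP; rewrite eqn_leq d0 andbT leqNgt; apply/negP => /nontrivial_root_of_unity.
  move=> [z z1 zd]; have z0 : z != 0.
    apply: contraNneq (oner_neq0 K) => ez; by rewrite -zd ez expr0n gtn_eqF.
  have := H3 _ _ sep1 (sep z z0 zd).
  by move/(branch_associated a0 b0) => e; rewrite e eqxx in z1.
have {em} em : m = a by rewrite em d1 mul1n.
have {en} en : n = b by rewrite en d1 mul1n.
rewrite -em -en in sep1.
have [[_ g1] tr szE] := H2 _ sep1.
have g10 : (branch m n 1) 1%N 0%N = - (1%N == n)%:R.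
  by rewrite fcoef_branch /= mul1r andbT sub0r.
have g01 : (branch m n 1) 0%N 1%N = (1%N == m)%:R.
  by rewrite fcoef_branch andbF mulr0 subr0.
have two : (0 < r)%N -> (0 < s)%N -> False.
  rewrite -XE -YE => xE yE; suff : (1 < size E)%N by rewrite ltnNge szE.
  have : {subset [:: X; Y] <= E} by move=> e; rewrite !inE => /orP[] /eqP->.
  move/uniq_leq_size; apply; by rewrite /= inE fps_x_neq_y.
have m_1 : (1 = m)%N -> (0 < s)%N by move=> e; move: sm; rewrite -e orbF.
have n_1 : (1 = n)%N -> (0 < r)%N by move=> e; move: rn; rewrite -e orbF.
have both : (1 = m)%N -> (1 = n)%N -> False by move=> /m_1 ? /n_1 ?; apply: two.
case: g1; rewrite ?g10 ?g01.
  case: eqP => [e _|_]; last by rewrite oppr0.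
  have := tr X; rewrite XE (n_1 e) => /(_ isT); rewrite /transverse g01 /=.
  rewrite mulr0 sub0r mulr1; case: eqP => [e' _|_]; last by rewrite oppr0.
  exact: both e' e.
case: eqP => [e _|//].
have := tr Y; rewrite YE (m_1 e) => /(_ isT); rewrite /transverse g10 /=.
rewrite mulr0 subr0 mulr1; case: eqP => [e' _|_]; last by rewrite oppr0.
exact: both e e'.
Qed.

Lemma fcoefM_lowest f g i j : (forall i', (i' < i)%N -> forall j', f i' j' = 0) ->
  (forall j', (j' < j)%N -> f i j' = 0) -> (f * g) i j = f i j * g 0%N 0%N.
Proof.
move=> fi fj; rewrite fcoefM big_ord_recr /= big1 ?add0r; last first.
  by move=> k _; rewrite big1 // => l _; rewrite fi // mul0r.
rewrite subnn big_ord_recr /= big1 ?add0r ?subnn // => l _.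
by rewrite fj // mul0r.
Qed.

(** When [p = 1] or [q = 1] the foliation is regular, and its leaf through the
    origin is [y^p = x^q]: the restriction [f(t^p, t^q)] of any other invariant
    curve would vanish to the same order as its derivative. *)
Lemma settled_regular_cusp p q D : (0 < p)%N -> (0 < q)%N ->
  (p == 1%N) || (q == 1%N) -> settled (cusp_form p q D, [::]).
Proof.
move=> p0 q0 pq1; set w := cusp_form p q D.
have pq : coprime p q by case/orP: pq1 => /eqP->; rewrite ?coprime1n ?coprimen1.
have nsing : ~ singular w.
  case=> /eqP A0 /eqP B0; case/orP: pq1 => /eqP e; move: A0 B0; rewrite /w e.
    rewrite /cusp_form /= fcoef_natM fcoefD fcoef00M coef00X mul0r addr0 mulr1.
    by rewrite oner_eq0.
  rewrite /cusp_form /= fcoefN fcoef_natM fcoefD fcoef00M coef00Y mul0r addr0.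
  by rewrite mulr1 oppr_eq0 oner_eq0.
have [Firr Fker] := branch_kernel p0 q0 pq (oner_neq0 K).
rewrite expr1n in Firr Fker.
have uniq_sep f : separatrix w f -> associated (branch p q 1) f.
  move=> [firr [g eg]]; apply: irreducible_divides => //; last by case: Firr.
  apply: Fker; rewrite scale1r mul1r.
  have Q0 := congx_Xn K q0; have P0 := congx_Xn K p0.
  set S := subst (X ^+ p) (X ^+ q).
  apply: contrapT => /coef_lowest [i [j [phij phi0 phij0]]].
  case: i phij phi0 phij0 => [|i] phij phi0 phij0.
    case: firr => _ nuf _; apply: nuf; apply/invertibleE.
    apply: contraNneq phij => f00.
    by rewrite /S fcoef_substE !big_ord1 f00 mul0r.
  have e : S w.1 * S (fps_dy f) - S w.2 * S (fps_dx f) = S f * S g.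
    by rewrite /S -!substM -eg rmorphB.
  pose U := X ^+ ((p - 1) * (q - 1)) + X * S D.
  have eA : S w.1 = - (q%:R * X ^+ q.-1 * U).
    rewrite /w /cusp_form /S /= !(rmorphN, rmorphM, rmorphD, rmorphXn, rmorph_nat) /=.
    rewrite (subst_x _ P0) (subst_y _ Q0) -/S /U.
    have -> : (X ^+ p) ^+ q.-1 = X ^+ q.-1 * X ^+ ((p - 1) * (q - 1)).
      by rewrite -exprM -exprD; congr (X ^+ _); nia.
    have -> : X ^+ q = X * X ^+ q.-1 by rewrite -exprS prednK.
    ring.
  have eB : S w.2 = p%:R * X ^+ p.-1 * U.
    rewrite /w /cusp_form /S /= !(rmorphM, rmorphD, rmorphXn, rmorph_nat) /=.
    rewrite (subst_x _ P0) (subst_y _ Q0) -/S /U.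
    have -> : (X ^+ q) ^+ p.-1 = X ^+ p.-1 * X ^+ ((p - 1) * (q - 1)).
      by rewrite -exprM -exprD; congr (X ^+ _); nia.
    have -> : X ^+ p = X * X ^+ p.-1 by rewrite -exprS prednK.
    ring.
  have := dx_subst f P0 Q0; rewrite !dx_exp dxX !mulr1 -/S => dphi.
  have : fps_dx (S f) * - U = S f * S g by rewrite -e dphi eA eB; ring.
  move/(congr1 (fun u : fps K => u i j)).
  rewrite [LHS]fcoefM_lowest; first last.
  - by move=> j' jj'; rewrite fcoef_dx phij0 ?mul0rn.
  - by move=> i' ii' j'; rewrite fcoef_dx phi0 ?mul0rn // ltnS.
  rewrite [RHS]fcoefM_lowest; first last.
  - by move=> j' jj'; rewrite phi0.
  - by move=> i' ii' j'; rewrite phi0 // ltnS ltnW.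
  rewrite fcoef_dx (phi0 i j (ltnSn i)) mul0r => /eqP.
  rewrite -mulr_natr !mulf_eq0 (negPf phij) pnatr_eq0 /= fcoefN oppr_eq0.
  rewrite fcoefD fcoefXn fcoefXM addr0 eqxx andbT.
  have -> : ((p - 1) * (q - 1) = 0)%N by case/orP: pq1 => /eqP->; rewrite ?muln0.
  by rewrite oner_eq0.
split; last by case=> -[].
split=> // [f [fsep _]|f g [fsep _] [gsep _]]; last first.
  exact: associated_trans (associated_sym (uniq_sep _ fsep)) (uniq_sep _ gsep).
have [|c c0 [f1 f2]] := @associated_coef10 _ _ f _ (uniq_sep f fsep).
  by rewrite fcoef_branch (ltn_eqF p0) (ltn_eqF q0) mulr0 subr0.
split=> //; split.
  have [u _ ->] := uniq_sep f fsep.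
  by rewrite fcoef00M fcoef_branch (ltn_eqF p0) (ltn_eqF q0) mulr0 subr0 mulr0.
case/orP: pq1 => /eqP e; [right; rewrite f2 | left; rewrite f1]; apply/eqP;
  rewrite mulf_neq0 // fcoef_branch e /=.
  by rewrite andbF mulr0 subr0 oner_neq0.
by rewrite sub0r mul1r oppr_eq0 oner_neq0.
Qed.

End Branches.

(** * The charts of a blow-up *)

Section BlowupCharts.
Variable K : comNzRingType.
Implicit Types (f g h : fps K) (c : K).

Local Notation X := (fps_x K).
Local Notation Y := (fps_y K).

Lemma fcoef_affine c f a b : fps_subst_affine c f a b =
  \sum_(j < a.+1) f (a - j)%N j * (c ^+ (j - b) *+ 'C(j, b)).
Proof. by []. Qed.

Lemma fcoef_infty f a b : fps_subst_infty f a b =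
  if (a <= b)%N then f a (b - a)%N else 0.
Proof. by []. Qed.

Lemma affineD c : {morph fps_subst_affine c : f g / f + g}.
Proof.
move=> f g; apply: fpsP => a b; rewrite fcoefD !fcoef_affine -big_split.
by apply: eq_bigr => j _; rewrite fcoefD mulrDl.
Qed.

Lemma affineZ c k f : fps_subst_affine c (k *: f) = k *: fps_subst_affine c f.
Proof.
apply: fpsP => a b; rewrite fcoefZ !fcoef_affine mulr_sumr.
by apply: eq_bigr => j _; rewrite fcoefZ mulrA.
Qed.

Lemma affine1 c : fps_subst_affine c 1 = 1.
Proof.
apply: fpsP => a b; rewrite fcoef_affine big_ord_recl big1 ?addr0 => [|j _].
  rewrite subn0 sub0n bin0n fcoef1 andbT expr0 mulr_natr.
  by rewrite fcoef1; case: (a == 0%N); case: (b == 0%N).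
by rewrite fcoef1 lift0 andbF mul0r.
Qed.

Lemma affine_XM c f :
  fps_subst_affine c (X * f) = X * fps_subst_affine c f.
Proof.
apply: fpsP => a b; rewrite fcoefXM fcoef_affine; case: a => [|a].
  by rewrite big_ord1 fcoefXM mul0r.
rewrite big_ord_recr /= subnn [(X * f) 0%N _]fcoefXM mul0r addr0 fcoef_affine.
by apply: eq_bigr => j _; rewrite fcoefXM subSn // -ltnS.
Qed.

Lemma affine_YM c f :
  fps_subst_affine c (Y * f) = X * ((Y + c%:A) * fps_subst_affine c f).
Proof.
apply: fpsP => a b; rewrite fcoefXM fcoef_affine.
case: a => [|a]; first by rewrite big_ord1 fcoefYM mul0r.
rewrite big_ord_recl fcoefYM mul0r add0r mulrDl fcoefD fcoefYM fcoefAM.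
rewrite fcoef_affine mulr_sumr; case: b => [|b].
  rewrite add0r; apply: eq_bigr => j _; rewrite fcoefYM lift0 subSS.
  by rewrite !bin0 !subn0 exprS; ring.
rewrite fcoef_affine -big_split; apply: eq_bigr => j _.
rewrite fcoefYM lift0 !subSS binS mulrnDr mulrDr addrC; congr (_ + _).
case: (ltnP j b.+1) => jb; first by rewrite bin_small // !mulr0n !mulr0.
have -> : (j - b = (j - b.+1).+1)%N by lia.
by rewrite exprS -mulrnAr mulrCA.
Qed.

Lemma inftyD : {morph @fps_subst_infty K : f g / f + g}.
Proof.
move=> f g; apply: fpsP => a b; rewrite fcoefD !fcoef_infty.
by case: ifP => _; rewrite ?addr0.
Qed.

Lemma inftyZ k f : fps_subst_infty (k *: f) = k *: fps_subst_infty f.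
Proof.
apply: fpsP => a b; rewrite fcoefZ !fcoef_infty.
by case: ifP => _; rewrite ?mulr0.
Qed.

Lemma infty1 : fps_subst_infty (1 : fps K) = 1.
Proof.
apply: fpsP => a b; rewrite fcoef_infty !fcoef1.
case: a b => [|a] [|b] //; by case: ifP.
Qed.

Lemma infty_XM f : fps_subst_infty (X * f) = X * (Y * fps_subst_infty f).
Proof.
apply: fpsP => a b; rewrite fcoefXM fcoef_infty.
case: a => [|a]; first by rewrite fcoefXM.
rewrite fcoefXM fcoefYM; case: b => [//|b].
by rewrite fcoef_infty ltnS subSS.
Qed.

Lemma infty_YM f : fps_subst_infty (Y * f) = Y * fps_subst_infty f.
Proof.
apply: fpsP => a b; rewrite fcoefYM fcoef_infty fcoefYM.
case: b => [|b]; first by rewrite sub0n; case: ifP.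
rewrite fcoef_infty; case: (ltngtP a b.+1) => [ab|ab|->].
- by rewrite ltnS in ab; rewrite ab subSn.
- by rewrite leqNgt (ltn_trans _ ab).
- by rewrite subnn ltnn.
Qed.

End BlowupCharts.

(** * One step of the Euclidean algorithm *)

Section EuclidStep.
Variable K : numClosedFieldType.
Implicit Types (f g h A B D P Q : fps K) (w : Defs.form K) (E : seq (fps K)).

Local Notation X := (fps_x K).
Local Notation Y := (fps_y K).
Local Notation Z c := (Y + c *: 1).

Lemma affine_XnM (c : K) n f :
  fps_subst_affine c (X ^+ n * f) = X ^+ n * fps_subst_affine c f.
Proof.
by elim: n f => [|n IH] f; rewrite ?expr0 ?mul1r // !exprSr -!mulrA IH affine_XM.
Qed.

Lemma affine_YnM (c : K) n f :
  fps_subst_affine c (Y ^+ n * f) = X ^+ n * Z c ^+ n * fps_subst_affine c f.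
Proof.
elim: n f => [|n IH] f; first by rewrite !expr0 !mul1r.
by rewrite !exprSr -mulrA IH affine_YM; ring.
Qed.

Lemma infty_XnM n f :
  fps_subst_infty (X ^+ n * f) = X ^+ n * Y ^+ n * fps_subst_infty f.
Proof.
elim: n f => [|n IH] f; first by rewrite !expr0 !mul1r.
by rewrite !exprSr -mulrA IH infty_XM; ring.
Qed.

Lemma infty_YnM n f :
  fps_subst_infty (Y ^+ n * f) = Y ^+ n * fps_subst_infty f.
Proof.
by elim: n f => [|n IH] f; rewrite ?expr0 ?mul1r // !exprSr -!mulrA IH infty_YM.
Qed.

Lemma subst_affine P Q (c : K) f : congx 1 P 0 -> congx 1 Q 0 ->
  subst P Q (fps_subst_affine c f) = subst P (P * (Q + c%:A)) f.
Proof.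
move=> P0 Q0; have PQ0 : congx 1 (P * (Q + c%:A)) 0.
  by rewrite -(mul0r (Q + c%:A)); apply: congxM; [exact: P0 | exact: congx_refl].
apply: (@additive_ext K (fun f => subst P Q (fps_subst_affine c f))
  (subst P (P * (Q + c%:A))) P (P * (Q + c%:A))) => [u v|u v|k|||u|u|u|u].
- by rewrite affineD rmorphD.
- by rewrite rmorphD.
- by rewrite affineZ affine1 !substA.
- exact: P0.
- exact: PQ0.
- by rewrite affine_XM subst_XM xpartE.
- rewrite affine_YM subst_XM xpartE // rmorphM rmorphD /= substA subst_y //.
  by rewrite mulrA.
- by rewrite subst_XM xpartE.
- by rewrite subst_YM xpartE.
Qed.

Lemma subst_infty P Q f : congx 1 P 0 -> congx 1 Q 0 ->
  subst P Q (fps_subst_infty f) = subst (P * Q) Q f.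
Proof.
move=> P0 Q0; have PQ0 : congx 1 (P * Q) 0.
  by rewrite -(mul0r Q); apply: congxM; [exact: P0 | exact: congx_refl].
apply: (@additive_ext K (fun f => subst P Q (fps_subst_infty f))
  (subst (P * Q) Q) (P * Q) Q) => [u v|u v|k|||u|u|u|u].
- by rewrite inftyD rmorphD.
- by rewrite rmorphD.
- by rewrite inftyZ infty1 !substA.
- exact: PQ0.
- exact: Q0.
- by rewrite infty_XM subst_XM subst_YM !xpartE // mulrA.
- by rewrite infty_YM subst_YM xpartE.
- by rewrite subst_XM xpartE.
- by rewrite subst_YM xpartE.
Qed.

(** The weight condition on [h = x y D] makes its transforms divisible by the
    power [l] of the new divisor, by which [y^m - x^n] is divisible too. *)
Section Step.
Variables (m n r s : nat) (D : fps K) (E : seq (fps K)).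
Hypotheses (m0 : (0 < m)%N) (n0 : (0 < n)%N).
Let h := X * Y * D.
Let l := minn m n.
Hypotheses (hh : heavy m n h) (hE : divisor_at r s E).

Let l0 : (0 < l)%N. Proof. by rewrite leq_min m0. Qed.

Let h_low i j : (i + j < l)%N -> h i j = 0.
Proof. by move=> lt_ij; apply: hh; move: lt_ij; rewrite /l leq_min; nia. Qed.

Let h_edge i j : m != n -> (i + j <= l)%N -> h i j = 0.
Proof.
move=> mn le_ij; rewrite /h -mulrA fcoefXM; case: i le_ij => [//|i].
rewrite fcoefYM; case: j => [//|j] le_ij.
have := @hh i.+1 j.+1; rewrite /h -mulrA fcoefXM fcoefYM; apply.
move: le_ij mn; rewrite /l /minn; case: ltngtP => // ? ? _; nia.
Qed.

Definition affine_rest c := shiftx l (fps_subst_affine c h).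
Definition infty_rest := shifty l (fps_subst_infty h).

Let affine_h c : fps_subst_affine c h = X ^+ l * affine_rest c.
Proof.
apply: shiftxE => a b lt_a; rewrite fcoef_affine big1 // => j _.
by rewrite h_low ?mul0r // subnK // -ltnS.
Qed.

Let infty_h : fps_subst_infty h = Y ^+ l * infty_rest.
Proof.
apply: shiftyE => a b lt_b; rewrite fcoef_infty; case: ifP => // ab.
by rewrite h_low // subnKC.
Qed.

Let affine_rest_x c : m != n -> divides X (affine_rest c).
Proof.
move=> mn; apply/divX => j; rewrite fcoef_shiftx add0n fcoef_affine.
by rewrite big1 // => i _; rewrite h_edge ?mul0r // subnK // -ltnS.
Qed.

Let infty_rest_y : m != n -> divides Y infty_rest.
Proof.
move=> mn; apply/divY => i; rewrite fcoef_shifty add0n fcoef_infty.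
by case: ifP => // ab; rewrite h_edge // subnKC.
Qed.

Let affine_rest_y : divides Y (affine_rest 0).
Proof.
have [|/divY /(_ l) /eqP|//] := @prime_y K (X ^+ l) (affine_rest 0).
  rewrite -affine_h /h [X * Y]mulrC -mulrA affine_YM scale0r addr0.
  by exists (X * fps_subst_affine 0 (X * D)); ring.
by rewrite fcoefXn !eqxx oner_eq0.
Qed.

Let infty_rest_x : divides X infty_rest.
Proof.
have [|/divX /(_ l) /eqP|//] := @prime_x K (Y ^+ l) infty_rest.
  rewrite -infty_h /h -mulrA infty_XM.
  by exists (Y * fps_subst_infty (Y * D)); ring.
by rewrite fcoefYn !eqxx oner_eq0.
Qed.

Let w := euclid_form m n r s D.
Let e1 : nat := (r == 0%N).
Let e2 : nat := (s == 0%N).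

Let e12 : (e1 + e2 <= l.+1)%N.
Proof. by apply: (@leq_trans 2); rewrite ?ltnS // /e1 /e2; do 2!case: eqP. Qed.

(** The coefficients of [d log x] and [d log (y + c)], divided by [x^l], in the
    chart [y -> x (y + c)]. *)
Definition affine_a c : fps K := (r + s + m)%:R * (X ^+ (m - l) * Z c ^+ m)
  - (r + s + n)%:R * X ^+ (n - l) + (m%:R - n%:R) * affine_rest c.
Definition affine_b c : fps K := (s + m)%:R * (X ^+ (m - l) * Z c ^+ m)
  - s%:R * X ^+ (n - l) + m%:R * affine_rest c.
(** Those of [d log x] and [d log y], divided by [y^l], in the chart
    [x -> x y]. *)
Definition infty_a : fps K := r%:R * Y ^+ (m - l)
  - (r + n)%:R * (X ^+ n * Y ^+ (n - l)) - n%:R * infty_rest.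
Definition infty_b : fps K := (r + s + m)%:R * Y ^+ (m - l)
  - (r + s + n)%:R * (X ^+ n * Y ^+ (n - l)) + (m%:R - n%:R) * infty_rest.

Let affine_nat c k f :
  fps_subst_affine c (k%:R * f) = k%:R * fps_subst_affine c f.
Proof. by rewrite fps_natrE -scaleE affineZ scaleE. Qed.

Let infty_nat k f : fps_subst_infty (k%:R * f) = k%:R * fps_subst_infty f.
Proof. by rewrite fps_natrE -scaleE inftyZ scaleE. Qed.

Let affineN c f : fps_subst_affine c (- f) = - fps_subst_affine c f.
Proof. by rewrite -scaleN1r affineZ scaleN1r. Qed.

Let inftyN f : fps_subst_infty (- f) = - fps_subst_infty f.
Proof. by rewrite -scaleN1r inftyZ scaleN1r. Qed.

Let ml : (l <= m)%N. Proof. exact: geq_minl. Qed.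
Let nl : (l <= n)%N. Proof. exact: geq_minr. Qed.

Let expl k (u : fps K) : (l <= k)%N -> u ^+ k = u ^+ l * u ^+ (k - l).
Proof. by move=> lk; rewrite -exprD subnKC. Qed.

Let affine_log_x c : fps_subst_affine c (log_x m n r h) =
  X ^+ l * (r%:R * (X ^+ (m - l) * Z c ^+ m) - (r + n)%:R * X ^+ (n - l)
    - n%:R * affine_rest c).
Proof.
rewrite /log_x !(affineD, affineN, affine_nat) affine_h.
rewrite -[Y ^+ m]mulr1 -[X ^+ n]mulr1 affine_YnM affine_XnM affine1.
by rewrite (expl X ml) (expl X nl); ring.
Qed.

Let affine_log_y c : fps_subst_affine c (log_y m n s h) =
  X ^+ l * affine_b c.
Proof.
rewrite /log_y /affine_b !(affineD, affineN, affine_nat) affine_h.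
rewrite -[Y ^+ m]mulr1 -[X ^+ n]mulr1 affine_YnM affine_XnM affine1.
by rewrite (expl X ml) (expl X nl); ring.
Qed.

Let infty_log_x : fps_subst_infty (log_x m n r h) = Y ^+ l * infty_a.
Proof.
rewrite /log_x /infty_a !(inftyD, inftyN, infty_nat) infty_h.
rewrite -[Y ^+ m]mulr1 -[X ^+ n]mulr1 infty_YnM infty_XnM infty1.
by rewrite (expl Y ml) (expl Y nl); ring.
Qed.

Let infty_log_y : fps_subst_infty (log_y m n s h) =
  Y ^+ l * ((s + m)%:R * Y ^+ (m - l) - s%:R * (X ^+ n * Y ^+ (n - l))
    + m%:R * infty_rest).
Proof.
rewrite /log_y !(inftyD, inftyN, infty_nat) infty_h.
rewrite -[Y ^+ m]mulr1 -[X ^+ n]mulr1 infty_YnM infty_XnM infty1.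
by rewrite (expl Y ml) (expl Y nl); ring.
Qed.

Lemma affine_pullback c :
  let A := fps_subst_affine c w.1 in let B := fps_subst_affine c w.2 in
  X ^+ (e1 + e2) * Z c ^+ e2 * (A + Z c * B) = X ^+ l.+1 * (Z c * affine_a c) /\
  X ^+ (e1 + e2) * Z c ^+ e2 * (X * B) = X ^+ l.+1 * (X * affine_b c).
Proof.
move=> A B; have [] := euclid_formE r s D m0 n0; rewrite -/w -/h -/e1 -/e2 => eA eB.
have {}eA : X ^+ e1 * (X ^+ e2 * Z c ^+ e2 * A) =
    X * (Z c * fps_subst_affine c (log_x m n r h)).
  by rewrite -affine_YM -eA -[X ^+ e1 * Y ^+ e2 * _]mulrA affine_XnM affine_YnM.
have {}eB : X ^+ e1 * (X ^+ e2 * Z c ^+ e2 * B) =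
    X * fps_subst_affine c (log_y m n s h).
  by rewrite -affine_XM -eB -[X ^+ e1 * Y ^+ e2 * _]mulrA affine_XnM affine_YnM.
rewrite affine_log_x in eA; rewrite affine_log_y in eB.
rewrite exprD; split.
  transitivity (X ^+ e1 * (X ^+ e2 * Z c ^+ e2 * A) +
    Z c * (X ^+ e1 * (X ^+ e2 * Z c ^+ e2 * B))); first by ring.
  by rewrite eA eB exprS /affine_a /affine_b !natrD; ring.
transitivity (X * (X ^+ e1 * (X ^+ e2 * Z c ^+ e2 * B))); first by ring.
by rewrite eB exprS; ring.
Qed.

Lemma infty_pullback :
  let A := fps_subst_infty w.1 in let B := fps_subst_infty w.2 in
  X ^+ e1 * Y ^+ (e1 + e2) * (Y * A) = Y ^+ l.+1 * (Y * infty_a) /\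
  X ^+ e1 * Y ^+ (e1 + e2) * (X * A + B) = Y ^+ l.+1 * (X * infty_b).
Proof.
move=> A B; have [] := euclid_formE r s D m0 n0; rewrite -/w -/h -/e1 -/e2 => eA eB.
have {}eA : X ^+ e1 * Y ^+ e1 * (Y ^+ e2 * A) =
    Y * fps_subst_infty (log_x m n r h).
  by rewrite -infty_YM -eA -[X ^+ e1 * Y ^+ e2 * _]mulrA infty_XnM infty_YnM.
have {}eB : X ^+ e1 * Y ^+ e1 * (Y ^+ e2 * B) =
    X * (Y * fps_subst_infty (log_y m n s h)).
  by rewrite -infty_XM -eB -[X ^+ e1 * Y ^+ e2 * _]mulrA infty_XnM infty_YnM.
rewrite infty_log_x in eA; rewrite infty_log_y in eB.
rewrite exprD; split.
  transitivity (Y * (X ^+ e1 * Y ^+ e1 * (Y ^+ e2 * A))); first by ring.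
  by rewrite eA exprS; ring.
transitivity (X * (X ^+ e1 * Y ^+ e1 * (Y ^+ e2 * A)) +
    X ^+ e1 * Y ^+ e1 * (Y ^+ e2 * B)); first by ring.
by rewrite eA eB exprS /infty_a /infty_b !natrD; ring.
Qed.

Let cancel (t V A f : fps K) e L : t != 0 -> V != 0 -> (e <= L)%N ->
  t ^+ e * V * A = t ^+ L * (V * f) -> A = t ^+ (L - e) * f.
Proof.
move=> t0 V0 eL H; apply: (@mulfI _ (t ^+ e * V)).
  by rewrite mulf_neq0 // expf_neq0.
by rewrite H -{1}(subnKC eL) exprD; ring.
Qed.

Let fcoef_Z c i : (Z c) 0%N i = if i == 0%N then c else (i == 1%N)%:R.
Proof.
by rewrite fcoefD fcoefA; case: i => [|i]; rewrite ?mulr1 ?mulr0 ?add0r ?addr0.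
Qed.

Let Z_neq0 c : Z c != 0.
Proof.
apply/eqP => /(congr1 (fun f : fps K => f 0 1)%N) /eqP.
by rewrite fcoef_Z fcoef0 oner_eq0.
Qed.

Lemma affine_strict c w' :
  Z c ^+ e2 * w'.1 = Z c * affine_a c -> Z c ^+ e2 * w'.2 = X * affine_b c ->
  ~ divides X w'.1 -> strict_transform (Some c) w = w'.
Proof.
move=> ea eb nX; have [HA HB] := affine_pullback c.
apply: (@strip_eq K X _ w' (l.+1 - (e1 + e2))); first exact: fps_x_neq0.
- congr pair; apply: (cancel (fps_x_neq0 K) (expf_neq0 e2 (Z_neq0 c)) e12).
    by rewrite HA ea.
  by rewrite HB eb.
- by case.
Qed.

Lemma infty_strict w' :
  X ^+ e1 * w'.1 = Y * infty_a -> X ^+ e1 * w'.2 = X * infty_b ->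
  ~ divides Y w'.2 -> strict_transform None w = w'.
Proof.
move=> ea eb nY; have [HA HB] := infty_pullback.
have X0 := expf_neq0 e1 (fps_x_neq0 K).
apply: (@strip_eq K Y _ w' (l.+1 - (e1 + e2))); first exact: fps_y_neq0.
- congr pair; apply: (cancel (fps_y_neq0 K) X0 e12).
    by rewrite [Y ^+ _ * _]mulrC HA ea.
  by rewrite [Y ^+ _ * _]mulrC HB eb.
- by case.
Qed.

Let not_divX f j : f 0%N j != 0 -> ~ divides X f.
Proof. by move=> fj /divX e; rewrite e eqxx in fj. Qed.
Let not_divY f i : f i 0%N != 0 -> ~ divides Y f.
Proof. by move=> fi /divY e; rewrite e eqxx in fi. Qed.

Let natr_neq0 k : (0 < k)%N -> (k%:R : K) != 0.
Proof. by rewrite pnatr_eq0 lt0n. Qed.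

Let coef00_nat k f : (k%:R * f) 0%N 0%N = k%:R * f 0%N 0%N.
Proof. exact: fcoef_natM. Qed.

Let affine_a00 c : affine_a c 0%N 0%N = (r + s + m)%:R * ((m == l)%:R * c ^+ m)
  - (r + s + n)%:R * (n == l)%:R + (m%:R - n%:R) * affine_rest c 0%N 0%N.
Proof.
rewrite /affine_a !(fcoefD, fcoefN, coef00_nat, fcoef00M, fcoef00X).
rewrite !fps_natrE !fcoefA !mulr1 coef00X coef00Y add0r !expr0n !subn_eq0.
by rewrite [(m == l)]eqn_leq [(n == l)]eqn_leq ml nl !andbT.
Qed.

Let affine_b00 c : affine_b c 0%N 0%N = (s + m)%:R * ((m == l)%:R * c ^+ m)
  - s%:R * (n == l)%:R + m%:R * affine_rest c 0%N 0%N.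
Proof.
rewrite /affine_b !(fcoefD, fcoefN, coef00_nat, fcoef00M, fcoef00X).
rewrite fcoefA mulr1 coef00X coef00Y add0r !expr0n !subn_eq0.
by rewrite [(m == l)]eqn_leq [(n == l)]eqn_leq ml nl !andbT.
Qed.

Let divisor_affine_neq0 c : c != 0 -> divisor_transform (Some c) E = [:: X].
Proof. by rewrite /divisor_transform => /negPf->. Qed.

Let divisor_affine0 : divisor_transform (Some 0) E =
  if (0 < s)%N then [:: X; Y] else [:: X].
Proof. by rewrite /divisor_transform eqxx; case: hE => _ -> _; case: (0 < s)%N. Qed.

Let divisor_infty : divisor_transform None E =
  if (0 < r)%N then [:: Y; X] else [:: Y].
Proof. by rewrite /divisor_transform; case: hE => -> _ _; case: (0 < r)%N. Qed.

Let Z00 c : (Z c) 0%N 0%N = c. Proof. exact: fcoef_Z. Qed.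

Lemma affine_settled c : c != 0 -> affine_a c 0%N 0%N != 0 ->
  settled (strict_transform (Some c) w, divisor_transform (Some c) E).
Proof.
move=> c0 a0; rewrite divisor_affine_neq0 //.
have Zu : Z c \is a GRing.unit by rewrite fps_unitE Z00.
have Ze : Z c ^+ e2 * (Z c)^-1 ^+ e2 = 1 by rewrite -exprMn mulrV // expr1n.
have Z'0 : ((Z c)^-1 ^+ e2) 0%N 0%N != 0 by rewrite -fps_unitE rpredX // unitrV.
have a'0 : ((Z c)^-1 ^+ e2 * (Z c * affine_a c)) 0%N 0%N != 0.
  by rewrite !fcoef00M Z00 !mulf_neq0.
rewrite (@affine_strict c ((Z c)^-1 ^+ e2 * (Z c * affine_a c),
  X * ((Z c)^-1 ^+ e2 * affine_b c))) /=.
- apply: settled_regular_x => //=; by exists ((Z c)^-1 ^+ e2 * affine_b c).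
- by rewrite mulrA Ze mul1r.
- by rewrite mulrCA [Z c ^+ e2 * _]mulrA Ze mul1r.
- exact: not_divX a'0.
Qed.

(** For [m <> n] the Newton polygon of [h] meets the line [i + j = l] only on
    the axes, where [h] has no monomials: it does not contribute on the new
    divisor. *)
Lemma affine_settled_edge c : c != 0 -> m != n ->
  settled (strict_transform (Some c) w, divisor_transform (Some c) E).
Proof.
move=> c0 mn; apply: affine_settled => //; rewrite affine_a00.
rewrite (divX _).1 ?mulr0 ?addr0; last exact: affine_rest_x.
case: (ltngtP m n) mn => // lt_mn _.
  have -> : (m == l) by rewrite /l /minn lt_mn.
  have -> : (n == l) = false by rewrite /l /minn lt_mn gtn_eqF.
  rewrite mulr0 subr0 mul1r mulf_neq0 ?expf_neq0 // natr_neq0 //.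
  by rewrite addn_gt0 m0 orbT.
have -> : (m == l) = false by rewrite /l /minn ltnNge ltnW //= gtn_eqF.
have -> : (n == l) by rewrite /l /minn ltnNge ltnW.
rewrite mul0r mulr0 sub0r mulr1 oppr_eq0 natr_neq0 //.
by rewrite addn_gt0 n0 orbT.
Qed.

Let affine_rest0 : affine_rest 0 0%N 0%N = 0.
Proof. exact: (divY _).1 affine_rest_y 0%N. Qed.

Let infty_rest0 : infty_rest 0%N 0%N = 0.
Proof. exact: (divX _).1 infty_rest_x 0%N. Qed.

(** The point is a corner with two eigenvalues of opposite signs when [s > 0],
    and a regular point of the divisor when [s = 0]. *)
Lemma affine_settled_origin : (n <= m)%N ->
  settled (strict_transform (Some 0) w, divisor_transform (Some 0) E).
Proof.
move=> nm; rewrite divisor_affine0.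
have ln : n == l by rewrite /l /minn ltnNge nm.
have Z0 : Z 0 = Y by rewrite scale0r addr0.
have a0 : affine_a 0 0%N 0%N = - (r + s + n)%:R.
  by rewrite affine_a00 affine_rest0 ln expr0n (gtn_eqF m0) !mulr0 sub0r addr0 mulr1.
have a00 : affine_a 0 0%N 0%N != 0.
  by rewrite a0 oppr_eq0 natr_neq0 // addn_gt0 n0 orbT.
case: (posnP s) => [s0|s0].
  have e2E : e2 = 1%N by rewrite /e2 s0.
  have [b' eb] : divides Y (affine_b 0).
    rewrite /affine_b s0 mul0r subr0 Z0; have [c ->] := affine_rest_y.
    have -> : Y ^+ m = Y * Y ^+ m.-1 by rewrite -exprS prednK.
    by exists ((0 + m)%:R * (X ^+ (m - l) * Y ^+ m.-1) + m%:R * c); ring.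
  rewrite (@affine_strict 0 (affine_a 0, X * b')) /=.
  - by apply: settled_regular_x => //; exists b'.
  - by rewrite e2E expr1.
  - by rewrite e2E expr1 eb Z0; ring.
  - exact: not_divX a00.
have e2E : e2 = 0%N by rewrite /e2 gtn_eqF.
have b0 : affine_b 0 0%N 0%N = - s%:R.
  by rewrite affine_b00 affine_rest0 ln expr0n (gtn_eqF m0) !mulr0 sub0r addr0 mulr1.
rewrite (@affine_strict 0 (Y * affine_a 0, X * affine_b 0)) /=.
- apply: settled_axes => // [a b ap bp|]; last first.
    by apply: Or32; rewrite b0 oppr_eq0 natr_neq0.
  rewrite a0 b0 !mulrN -opprD oppr_eq0 -!natrM -natrD natr_neq0 //.
  by rewrite addn_gt0 !muln_gt0 ap s0 orbT.
- by rewrite e2E expr0 mul1r Z0.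
- by rewrite e2E expr0 mul1r.
- by apply: (@not_divX _ 1%N); rewrite fcoefYM.
Qed.

Lemma infty_settled : (m <= n)%N ->
  settled (strict_transform None w, divisor_transform None E).
Proof.
move=> mn; rewrite divisor_infty.
have lm : l = m by rewrite /l; apply/minn_idPl.
have Xn0 i : (X ^+ n * Y ^+ i) 0%N 0%N = 0.
  by rewrite fcoef00M fcoef00X coef00X expr0n gtn_eqF // mul0r.
have b0 : infty_b 0%N 0%N = (r + s + m)%:R.
  rewrite /infty_b fcoefD fcoefB !coef00_nat Xn0 fcoef00M infty_rest0 !mulr0.
  by rewrite subr0 addr0 lm subnn expr0 fcoef1 mulr1.
have b00 : infty_b 0%N 0%N != 0 by rewrite b0 natr_neq0 // addn_gt0 m0 orbT.
case: (posnP r) => [r0|r0].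
  have e1E : e1 = 1%N by rewrite /e1 r0.
  have [a' ea] : divides X infty_a.
    rewrite /infty_a r0 mul0r sub0r; have [c ->] := infty_rest_x.
    have -> : X ^+ n = X * X ^+ n.-1 by rewrite -exprS prednK.
    by exists (- ((0 + n)%:R * (X ^+ n.-1 * Y ^+ (n - l))) - n%:R * c); ring.
  rewrite (@infty_strict (Y * a', infty_b)) /=.
  - by apply: settled_regular_y => //; exists a'.
  - by rewrite e1E expr1 ea; ring.
  - by rewrite e1E expr1.
  - exact: not_divY b00.
have e1E : e1 = 0%N by rewrite /e1 gtn_eqF.
have a0 : infty_a 0%N 0%N = r%:R.
  rewrite /infty_a !fcoefB !coef00_nat Xn0 infty_rest0 !mulr0 !subr0.
  by rewrite lm subnn expr0 fcoef1 mulr1.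
rewrite (@infty_strict (Y * infty_a, X * infty_b)) /=.
- apply: settled_axes => // [|a b ap bp|]; last by apply: Or33.
    by rewrite a0 natr_neq0.
  rewrite a0 b0 -!natrM -natrD natr_neq0 //.
  by rewrite addn_gt0 !muln_gt0 bp r0.
- by rewrite e1E expr0 mul1r.
- by rewrite e1E expr0 mul1r.
- by apply: (@not_divY _ 1%N); rewrite fcoefXM.
Qed.

Lemma affine_settled_diagonal c : m = n -> c != 0 -> c ^+ m != 1 ->
  settled (strict_transform (Some c) w, divisor_transform (Some c) E).
Proof.
move=> mn c0 cm; apply: affine_settled => //.
have lm : l = m by rewrite /l -mn minnn.
rewrite affine_a00 lm -mn eqxx subrr mul0r addr0 mul1r -mulrBr.
by rewrite mulf_neq0 ?subr_eq0 // natr_neq0 // addn_gt0 m0 orbT.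
Qed.

(** At the strict transform of a branch, after the last blow-up, both the
    divisor and the branch are coordinate axes.  The eigenvalue along the
    divisor is not zero, so that a saddle-node has its weak separatrix
    transverse to the divisor. *)
Lemma affine_settled_root c : m = n -> c ^+ m = 1 -> nonresonant m n h ->
  settled (strict_transform (Some c) w, divisor_transform (Some c) E).
Proof.
move=> mn cm nr.
have c0 : c != 0.
  apply/eqP => c0; move/eqP: cm; rewrite c0 expr0n gtn_eqF //.
  by rewrite eq_sym oner_eq0.
have lm : l = m by rewrite /l -mn minnn.
rewrite divisor_affine_neq0 //.
have Zu : Z c \is a GRing.unit by rewrite fps_unitE Z00.
have Ze : Z c ^+ e2 * (Z c)^-1 ^+ e2 = 1 by rewrite -exprMn mulrV // expr1n.
set V := (Z c)^-1 ^+ e2 in Ze.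
have V0 : V 0%N 0%N != 0 by rewrite /V -fps_unitE rpredX // unitrV.
pose G := \sum_(i < m) Z c ^+ (m.-1 - i) * (c%:A : fps K) ^+ i.
have G00 : G 0%N 0%N = m%:R * c ^+ m.-1.
  rewrite /G fcoef_sum (eq_bigr (fun=> c ^+ m.-1)) => [|i _].
    by rewrite sumr_const card_ord mulr_natl.
  rewrite fcoef00M !fcoef00X Z00 fcoefA mulr1 -exprD subnK //.
  by rewrite -ltnS prednK.
have ea : affine_a c = Y * ((r + s + m)%:R * G).
  have YG : Y * G = Z c ^+ m - 1.
    transitivity (Z c ^+ m - (c%:A : fps K) ^+ m); first by rewrite subrXX addrK.
    by rewrite -algXn cm scale1r.
  rewrite /affine_a -mn lm subnn subrr mul0r addr0 expr0.
  transitivity ((r + s + m)%:R * (Y * G)); last by ring.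
  by rewrite YG; ring.
pose A := V * (Z c * ((r + s + m)%:R * G)); pose B := V * affine_b c.
have A00 : A 0%N 0%N = V 0%N 0%N * ((r + s + m)%:R * m%:R).
  rewrite /A !fcoef00M Z00 G00 fps_natrE fcoefA mulr1.
  have -> : c * ((r + s + m)%:R * (m%:R * c ^+ m.-1)) =
    (r + s + m)%:R * m%:R * (c * c ^+ m.-1) by ring.
  by rewrite -exprS prednK // cm mulr1.
have B00 : B 0%N 0%N = V 0%N 0%N * (m%:R * (1 + affine_rest c 0%N 0%N)).
  rewrite /B fcoef00M affine_b00 lm -mn eqxx cm !mulr1 natrD; ring.
have rsm : (0 < r + s + m)%N by rewrite addn_gt0 m0 orbT.
have A0 : A 0%N 0%N != 0 by rewrite A00 !mulf_neq0 ?natr_neq0.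
have quasi : quasi_part m n (m * n) h 1 c = affine_rest c 0%N 0%N.
  have Xm := congx_Xn K m0; have O0 : congx 1 (0 : fps K) 0 by [].
  rewrite /quasi_part -mn scale1r mul1r.
  have -> : c%:A * X ^+ m = X ^+ m * (0 + c%:A) by rewrite add0r mulrC.
  rewrite -subst_affine // affine_h rmorphM rmorphXn /= subst_x // lm -exprM.
  by rewrite fcoefXnM leqnn subnn fcoef00_subst.
rewrite (@affine_strict c (Y * A, X * B)) /=.
- apply: settled_axes => // [a b ap bp|]; last by apply: Or31.
  have := nr 1 c (oner_neq0 K) c0; rewrite cm expr1n quasi => /(_ erefl).
  have bp' : (0 < b * (r + s + m))%N by rewrite muln_gt0 bp.
  move=> /(_ (b * (r + s + m))%N a bp' ap); apply: contraNneq.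
  rewrite A00 B00 => e; apply/eqP.
  apply: (mulfI (mulf_neq0 V0 (natr_neq0 m0))); rewrite mulr0 -e natrM.
  ring.
- rewrite /A ea.
  have -> : Z c ^+ e2 * (Y * (V * (Z c * ((r + s + m)%:R * G)))) =
    (Z c ^+ e2 * V) * (Z c * (Y * ((r + s + m)%:R * G))) by ring.
  by rewrite Ze mul1r.
- by rewrite /B mulrCA [_ ^+ e2 * _]mulrA Ze mul1r.
- by apply: (@not_divX _ 1%N); rewrite fcoefYM.
Qed.

(** The centres of the form and of [y^m = x^n] follow the
    Euclidean algorithm, and the values of [h] that govern the last eigenvalue
    are multiplied by a monomial, as those of [y^m]. *)
Lemma affine_euclid : (m < n)%N -> nonresonant m n h ->
  exists D', [/\ strict_transform (Some 0) w =
      euclid_form m (n - m) (r + s + m) s D',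
    heavy m (n - m) (X * Y * D') & nonresonant m (n - m) (X * Y * D')].
Proof.
move=> mn nr; have neq_mn : m != n by rewrite ltn_eqF.
have lm : l = m by rewrite /l /minn mn.
have Z0 : Z 0 = Y by rewrite scale0r addr0.
have nm0 : (0 < n - m)%N by rewrite subn_gt0.
have [u eu] := affine_rest_x 0 neq_mn.
have [D' eD] : divides Y u.
  have [|/divY /(_ 1%N) /eqP|//] := @prime_y K X u.
    by rewrite -eu; exact: affine_rest_y.
  by rewrite /= oner_eq0.
have {u eu eD} eR : affine_rest 0 = X * Y * D' by rewrite eu eD mulrA.
have rsm : (0 < r + s + m)%N by rewrite addn_gt0 m0 orbT.
exists D'; split.
- have [HA HB] := euclid_formE (r + s + m) s D' m0 nm0.
  rewrite (gtn_eqF rsm) expr0 mul1r in HA HB.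
  have eA : log_x m (n - m) (r + s + m) (X * Y * D') = affine_a 0.
    rewrite /log_x /affine_a Z0 eR lm subnn expr0 mul1r.
    have -> : (r + s + m + (n - m) = r + s + n)%N by rewrite -addnA subnKC // ltnW.
    rewrite (natrB _ (ltnW mn)); set a := m%:R; set b := n%:R.
    by rewrite -[b - a]opprB mulNr opprK.
  have eB : log_y m (n - m) s (X * Y * D') = affine_b 0.
    by rewrite /log_y /affine_b Z0 eR lm subnn expr0 mul1r.
  apply: affine_strict; first by rewrite Z0 HA eA.
    by rewrite Z0 HB eB.
  move=> dX; have : divides X (Y * affine_a 0).
    by case: dX => v ev; rewrite -eA -HA ev; exists (Y ^+ e2 * v); ring.
  apply: (@not_divX _ m.+1); rewrite fcoefYM /affine_a Z0 lm subnn expr0 mul1r.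
  rewrite fcoefD fcoefB !fcoef_natM fcoefYn fcoefXn eqxx /= (ltn_eqF nm0) mulr0 subr0.
  rewrite [_ * affine_rest 0]mulrC (fcoefM_row0 _ (b := m)); last first.
    by move=> j _; apply: ((divX _).1 (affine_rest_x 0 neq_mn)).
  by rewrite ((divX _).1 (affine_rest_x 0 neq_mn)) mul0r addr0 eqxx mulr1 natr_neq0.
- rewrite -eR => a b lt_ab; rewrite fcoef_shiftx lm fcoef_affine big1 // => j _.
  case: (ltngtP j b) => jb; last 1 first.
  + rewrite hh ?mul0r //; rewrite jb.
    move: lt_ab; rewrite !mulnBr; have := ltn_ord j; nia.
  + by rewrite bin_small // mulr0n mulr0.
  + by rewrite expr0n subn_eq0 leqNgt jb mul0rn mulr0.
- rewrite -eR => x1 y1 x10 y10 e a b a0 b0.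
  have y0 : x1 * y1 != 0 by rewrite mulf_neq0.
  have e' : (x1 * y1) ^+ m = x1 ^+ n.
    by rewrite exprMn e -exprD subnKC // ltnW.
  have := nr x1 (x1 * y1) x10 y0 e' a b a0 b0.
  have P0 := congx_AXn x1 m0; have Q0 := congx_AXn y1 nm0.
  have -> : quasi_part m n (m * n) h x1 (x1 * y1) =
      x1 ^+ m * quasi_part m (n - m) (m * (n - m)) (affine_rest 0) x1 y1.
    rewrite /quasi_part.
    have -> : (x1 * y1)%:A * X ^+ n =
        x1%:A * X ^+ m * (y1%:A * X ^+ (n - m) + 0%:A).
      by rewrite scale0r addr0 algM -{1}(subnKC (ltnW mn)) exprD; ring.
    rewrite -subst_affine // affine_h rmorphM rmorphXn /= subst_x // lm.
    rewrite exprMn -algXn -exprM -mulrA fcoefAM fcoefXnM.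
    by rewrite leq_mul2l ltnW ?orbT // mulnBr.
  apply: contraNneq => e0; rewrite exprMn.
  apply/eqP; apply: etrans (etrans (congr1 (fun v => x1 ^+ m * v) e0) (mulr0 _)).
  ring.
Qed.

Lemma infty_euclid : (n < m)%N -> nonresonant m n h ->
  exists D', [/\ strict_transform None w =
      euclid_form (m - n) n r (r + s + n) D',
    heavy (m - n) n (X * Y * D') & nonresonant (m - n) n (X * Y * D')].
Proof.
move=> nm nr; have neq_mn : m != n by rewrite gtn_eqF.
have ln : l = n by rewrite /l minnC /minn nm.
have mn0 : (0 < m - n)%N by rewrite subn_gt0.
have [u eu] := infty_rest_y neq_mn.
have [D' eD] : divides X u.
  have [|/divX /(_ 1%N) /eqP|//] := @prime_x K Y u.
    by rewrite -eu; exact: infty_rest_x.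
  by rewrite /= oner_eq0.
have {u eu eD} eR : infty_rest = X * Y * D'.
  by rewrite eu eD mulrA [Y * X]mulrC.
have rsn : (0 < r + s + n)%N by rewrite addn_gt0 n0 orbT.
exists D'; split.
- have [HA HB] := euclid_formE r (r + s + n) D' mn0 n0.
  rewrite (gtn_eqF rsn) expr0 mulr1 in HA HB.
  have eA : log_x (m - n) n r (X * Y * D') = infty_a.
    by rewrite /log_x /infty_a eR ln subnn expr0 mulr1.
  have eB : log_y (m - n) n (r + s + n) (X * Y * D') = infty_b.
    rewrite /log_y /infty_b eR ln subnn expr0 mulr1.
    have -> : (r + s + n + (m - n) = r + s + m)%N by rewrite -addnA subnKC // ltnW.
    by rewrite (natrB _ (ltnW nm)).
  apply: infty_strict; first by rewrite HA eA.
    by rewrite HB eB.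
  move=> dY; have : divides Y (X * infty_b).
    by case: dY => v ev; rewrite -eB -HB ev; exists (X ^+ e1 * v); ring.
  apply: (@not_divY _ n.+1); rewrite fcoefXM /infty_b ln subnn expr0 mulr1.
  rewrite fcoefD fcoefB !fcoef_natM fcoefYn fcoefXn eqxx (ltn_eqF mn0) andbF.
  rewrite mulr0 sub0r.
  rewrite [_ * infty_rest]mulrC (fcoefM_col0 _ (a := n)); last first.
    by move=> j _; apply: ((divY _).1 (infty_rest_y neq_mn)).
  rewrite ((divY _).1 (infty_rest_y neq_mn)) mul0r addr0 mulr1 oppr_eq0.
  exact: natr_neq0.
- rewrite -eR => a b lt_ab; rewrite fcoef_shifty ln fcoef_infty.
  case: leqP => // ab; apply: hh.
  move: lt_ab; rewrite !mulnBl; nia.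
- rewrite -eR => x1 y1 x10 y10 e a b a0 b0.
  have x0 : x1 * y1 != 0 by rewrite mulf_neq0.
  have e' : y1 ^+ m = (x1 * y1) ^+ n.
    by rewrite exprMn -e -exprD subnK // ltnW.
  have := nr (x1 * y1) y1 x0 y10 e' a b a0 b0.
  have P0 := congx_AXn x1 mn0; have Q0 := congx_AXn y1 n0.
  have -> : quasi_part m n (m * n) h (x1 * y1) y1 =
      y1 ^+ n * quasi_part (m - n) n ((m - n) * n) infty_rest x1 y1.
    rewrite /quasi_part.
    have -> : (x1 * y1)%:A * X ^+ m = x1%:A * X ^+ (m - n) * (y1%:A * X ^+ n).
      by rewrite algM -{1}(subnK (ltnW nm)) exprD; ring.
    rewrite -subst_infty // infty_h rmorphM rmorphXn /= subst_y // ln.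
    rewrite exprMn -algXn -exprM -mulrA fcoefAM fcoefXnM.
    by rewrite leq_mul2r ltnW ?orbT // mulnBl.
  have -> : y1 ^+ m = y1 ^+ (m - n) * y1 ^+ n by rewrite -exprD subnK // ltnW.
  apply: contraNneq => e0.
  apply/eqP; apply: etrans (etrans (congr1 (fun v => y1 ^+ n * v) e0) (mulr0 _)).
  ring.
Qed.

Lemma divisor_at_affine :
  divisor_at (r + s + m) s (divisor_transform (Some 0) E).
Proof.
rewrite divisor_affine0; have XY := fps_x_neq_y K.
split; first by rewrite addn_gt0 m0 orbT; case: ifP; rewrite !inE eqxx.
  by case: ifP; rewrite !inE eq_sym (negPf XY) ?eqxx.
move=> e; case: ifP => _; rewrite !inE.
  by case/orP => /eqP ->; [left | right].
by move/eqP ->; left.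
Qed.

Lemma divisor_at_infty :
  divisor_at r (r + s + n) (divisor_transform None E).
Proof.
rewrite divisor_infty; have XY := fps_x_neq_y K.
split; last 2 first.
- by rewrite addn_gt0 n0 orbT; case: ifP; rewrite !inE eqxx.
- move=> e; case: ifP => _; rewrite !inE.
    by case/orP => /eqP ->; [right | left].
  by move/eqP ->; right.
by case: ifP; rewrite !inE (negPf XY) ?eqxx.
Qed.

End Step.
End EuclidStep.

(** * The reduction of singularities *)

Section Reduction.
Variable K : numClosedFieldType.
Implicit Types (D : fps K) (w : Defs.form K) (T : seq (near_point K))
  (g : Defs.form K * seq (fps K)).

Local Notation X := (fps_x K).
Local Notation Y := (fps_y K).

Definition blowup_at (d : direction K) g :=
  (strict_transform d g.1, divisor_transform d g.2).

Definition germ_from g (P : near_point K) :=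
  foldl (fun g d => blowup_at d g) g P.

(** The second condition ensures that [T] is contained in every resolution. *)
Definition reduces T g := [/\ centres T,
  forall P, P \in T -> ~ resolved (germ_from g P) &
  forall P, in_fibre T P -> settled (germ_from g P)].

Lemma reduces_nil g : settled g -> reduces [::] g.
Proof.
move=> gs; split=> // P [_ H]; case: P / (lastP P) H => // P d H.
by have := H P d erefl.
Qed.

Lemma reduces_cons d T g : ~ resolved g -> reduces T (blowup_at d g) ->
  (forall e, e <> d -> settled (blowup_at e g)) ->
  reduces ([::] :: map (cons d) T) g.
Proof.
move=> gnr [[Tu Tc] Tn Tf] ge.
have memT e P : (e :: P \in [::] :: map (cons d) T) = (e == d) && (P \in T).
  rewrite inE /=; apply/mapP/andP => [[Q QT [-> ->]]|[/eqP-> PT]].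
    by rewrite eqxx.
  by exists P.
split.
- split.
    rewrite /= map_inj_uniq ?Tu ?andbT => [|P Q [] //].
    by apply/negP => /mapP[].
  move=> [|e P] f; first by move=> _; rewrite inE eqxx.
  by rewrite rcons_cons !memT => /andP[-> /Tc ->].
- move=> [|e P]; first by [].
  by rewrite memT => /andP[/eqP-> /Tn].
move=> [|e P] [nP HP]; first by rewrite inE eqxx in nP.
rewrite memT negb_and in nP.
have [ed|ed] := eqVneq e d.
  rewrite ed /=; apply: Tf; split=> [|Q f eP].
    by move: nP; rewrite ed eqxx.
  have := HP (e :: Q) f; rewrite rcons_cons eP => /(_ erefl).
  by rewrite memT => /andP[].
have {HP} -> : P = [::].
  case: P / (lastP P) HP {nP} => // Q f HP.
  by have := HP (e :: Q) f erefl; rewrite memT (negPf ed).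
by apply: ge; apply/eqP.
Qed.

(** A shortest centre of [T] missing from a resolution [T'] would be a point of
    the surface obtained by blowing up [T'], where the germ is not resolved. *)
Lemma reduces_minimal T w : reduces T (w, [::]) -> minimal_reduction w T.
Proof.
move=> [Tc Tn Tf]; split=> [|T' [Tc' Tf']].
  by split=> // P /Tf[].
apply: uniq_leq_size; first by case: Tc.
have sub P : P \in T -> (forall s d, P = rcons s d -> s \in T') -> P \in T'.
  move=> PT HP; apply: contrapT => /negP nP.
  by apply: (Tn P PT); apply: Tf'; split.
elim/last_ind => [|P d IH] PT.
  by apply: (sub _ PT) => s d; case: s.
apply: (sub _ PT) => s f /rcons_inj[<- _]; apply: IH.
by case: Tc => _; apply; exact: PT.
Qed.

Definition euclid_germ (m n : nat) g := exists r s D,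
  [/\ g.1 = euclid_form m n r s D, divisor_at r s g.2,
    (0 < s)%N || (1 < m)%N, (0 < r)%N || (1 < n)%N &
    heavy m n (X * Y * D) /\ nonresonant m n (X * Y * D)].

(** The centres are the infinitely near points of the curve [y^m = x^n], as
    given by the Euclidean algorithm for [m] and [n]. *)
Lemma euclid_reduction (m n : nat) : (0 < m)%N -> (0 < n)%N ->
  exists T, forall g, euclid_germ m n g -> reduces T g.
Proof.
have [N] := ubnP (m + n); elim: N m n => // N IH m n ltN m0 n0.
have nres g : euclid_germ m n g -> ~ resolved g.
  by case: g => w E [r [s [D [/= -> hE sm rn _]]]]; apply: euclid_not_resolved.
case: (ltngtP m n) => mn.
- have [||T HT] := IH m (n - m)%N _ m0; [lia|lia|].
  exists ([::] :: map (cons (Some 0)) T) => g gmn.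
  apply: reduces_cons; first exact: nres.
    apply: HT; case: g gmn => w E [r [s [D [/= -> hE sm rn [hh nr]]]]].
    have [D' [eD hh' nr']] := affine_euclid r s m0 n0 hh mn nr.
    exists (r + s + m)%N, s, D'; split=> //.
      exact: divisor_at_affine.
    by rewrite addn_gt0 m0 orbT.
  case: g gmn => w E [r [s [D [/= -> hE sm rn [hh nr]]]]] [c|] ne.
    apply: affine_settled_edge => //; last by rewrite ltn_eqF.
    by apply/eqP => c0; apply: ne; rewrite c0.
  by apply: infty_settled => //; apply: ltnW.
- have [||T HT] := IH (m - n)%N n _ _ n0; [lia|lia|].
  exists ([::] :: map (cons None) T) => g gmn.
  apply: reduces_cons; first exact: nres.
    apply: HT; case: g gmn => w E [r [s [D [/= -> hE sm rn [hh nr]]]]].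
    have [D' [eD hh' nr']] := infty_euclid r s m0 n0 hh mn nr.
    exists r, (r + s + n)%N, D'; split=> //.
      exact: divisor_at_infty.
    by rewrite addn_gt0 n0 orbT.
  case: g gmn => w E [r [s [D [/= -> hE sm rn [hh nr]]]]] [c|] // _.
  have [->|c0] := eqVneq c 0.
    by apply: affine_settled_origin => //; apply: ltnW.
  by apply: affine_settled_edge => //; rewrite gtn_eqF.
exists ([::] :: map (cons (Some 0)) [::]) => g gmn.
have all_settled d : settled (blowup_at d g).
  case: g gmn => w E [r [s [D [/= -> hE sm rn [hh nr]]]]].
  case: d => [c|]; last by apply: infty_settled => //; rewrite mn.
  have [->|c0] := eqVneq c 0.
    by apply: affine_settled_origin => //; rewrite mn.
  have [cm|cm] := eqVneq (c ^+ m) 1.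
    exact: affine_settled_root.
  exact: affine_settled_diagonal.
apply: reduces_cons; [exact: nres | exact: reduces_nil | by []].
Qed.

End Reduction.

(** * The theorem *)

Section CuspidalReduction.
Variable K : numClosedFieldType.

Local Notation X := (fps_x K).
Local Notation Y := (fps_y K).

Lemma d_cuspE p q : d_form (cusp K p q) = cusp_form p q 0.
Proof.
rewrite /d_form cuspE /cusp_form /cusp_series !mulr0 !addr0.
by rewrite dxD dxN dyD dyN !dx_exp !dy_exp dxX dxY dyX dyY; congr pair; ring.
Qed.

Lemma cuspidal_formE p q (D : cps K) : cuspidal_form p q D = cusp_form p q D.
Proof.
rewrite /cuspidal_form d_cuspE /cusp_form /= !mulr0 !addr0.
by congr pair; ring.
Qed.

Lemma heavy0 m n : heavy m n (0 : fps K). Proof. by []. Qed.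

Lemma nonresonant0 m n : nonresonant m n (0 : fps K).
Proof.
move=> x0 y0 x00 y00 _ a b a0 b0.
rewrite /quasi_part rmorph0 fcoef0 addr0 -mulrDl -natrD mulf_neq0 ?expf_neq0 //.
by rewrite pnatr_eq0 -lt0n addn_gt0 b0.
Qed.

(** The same centres reduce every foliation that passes the two tests on the
    weights of [D], in particular [d(y^p - x^q)] itself. *)
Lemma cusp_form_reduction p q : (0 < p)%N -> (0 < q)%N ->
  exists T, forall D : fps K,
    ((1 < p)%N -> (1 < q)%N ->
      heavy p q (X * Y * D) /\ nonresonant p q (X * Y * D)) ->
    reduces T (cusp_form p q D, [::]).
Proof.
move=> p0 q0; have [p1|p1] := ltnP 1 p; last first.
  exists [::] => D _; apply/reduces_nil/settled_regular_cusp => //.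
  by rewrite eqn_leq p1 p0.
have [q1|q1] := ltnP 1 q; last first.
  exists [::] => D _; apply/reduces_nil/settled_regular_cusp => //.
  by rewrite [(q == _)]eqn_leq q1 q0 orbT.
have [T HT] := euclid_reduction K p0 q0; exists T => D HD.
apply: HT; exists 0%N, 0%N, D; split; rewrite ?p1 ?q1 //=.
- by rewrite euclid_form0.
- exact: HD.
Qed.

End CuspidalReduction.

Lemma intersection_number_ge (R : realType) (f g : cps R[i]) (n : nat)
    (h : 'I_n -> cps R[i]) :
  (forall a : 'I_n -> R[i], in_ideal2 f g (\sum_(k < n) a k *: h k) ->
    forall k, a k = 0) ->
  ((n%:R)%:E <= intersection_number f g)%E.
Proof. by move=> Hh; apply: ereal_sup_ubound; exists n; split=> //; exists h. Qed.

Theorem theorem1p2 (R : realType) (p q : nat) (Delta : cps R[i])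
  (hp : (0 < p)%N) (hq : (0 < q)%N)
  (hfol : foliation_form (cuspidal_form p q Delta))
  (hnd : non_dicritical (cuspidal_form p q Delta)) :
  (second_type (cuspidal_form p q Delta) <->
     (((PH p q)%:R - 1)%:E <= intersection_number Delta (cusp R[i] p q))%E) /\
  (second_type (cuspidal_form p q Delta) <->
     same_reduction (cuspidal_form p q Delta) (d_form (cusp R[i] p q))).
Proof.
have weights : (1 < p)%N -> (1 < q)%N ->
    heavy p q (fps_x R[i] * fps_y R[i] * (Delta : fps R[i])) /\
    nonresonant p q (fps_x R[i] * fps_y R[i] * (Delta : fps R[i])).
  by move=> p1 q1; apply: non_dicritical_heavy => //; rewrite -cuspidal_formE.
have [T HT] := cusp_form_reduction R[i] hp hq.
have redD := HT _ weights; rewrite -cuspidal_formE in redD.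
have red0 : reduces T (d_form (cusp R[i] p q), [::]).
  rewrite d_cuspE; apply: HT => _ _; rewrite mulr0.
  by split; [exact: heavy0 | exact: nonresonant0].
have st : second_type (cuspidal_form p q Delta).
  exists T; first exact: (reduces_minimal redD).
  by case: redD => _ _ sett P /sett[].
have sr : same_reduction (cuspidal_form p q Delta) (d_form (cusp R[i] p q)).
  exists T; first exact: (reduces_minimal redD).
  exact: (reduces_minimal red0).
suff int : (((PH p q)%:R - 1)%:E <= intersection_number Delta (cusp R[i] p q))%E.
  by split; split.
have [/andP[p1 q1]|pq1] := boolP ((1 < p) && (1 < q))%N; last first.
  have -> : PH p q = 0%N by rewrite /PH; move: pq1; rewrite negb_and -!leqNgt; nia.
  have -> : (0%N%:R - 1)%:E = (-1)%:E :> \bar R by rewrite sub0r.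
  apply: (@le_trans _ _ 0%:E); first by rewrite lee_fin lerN10.
  by apply: (@intersection_number_ge R _ _ 0 (fun=> 0)) => a _ [].
have [n [h [le_n Hh]]] := independent_mod p1 q1 (weights p1 q1).1.
apply: le_trans (intersection_number_ge Hh).
rewrite lee_fin lerBlDr natr1 ler_nat.
by move: le_n p1 q1; rewrite /PH; nia.
Qed.
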